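(* The sequence $(L^{(2)}_n)_{n\ge 1}$ satisfies the weak large deviation principle in $\mathcal P(S^2)$ with rate function $I^{(2)}$ given by $$I^{(2)}(\mu)=\begin{cases}(\Lambda^{(2)})^*(\mu)=J^{(2)}(\mu)=R^{(2)}(\mu) & \text{if } \mu\in\mathcal A^{(2)}_{\mathrm{bal}},\\ \infty & \text{otherwise.}\end{cases}$$ (In particular the three quantities in the first line coincide for every $\mu\in\mathcal A^{(2)}_{\mathrm{bal}}$.)
   Context: Markov chain. $S$ is a countable discrete set, $\mathbb N=\{1,2,\dots\}$, and $(X_n)_{n\ge1}$ is a Markov chain on $S$ with arbitrary transition kernel $p$ and arbitrary initial distribution $\beta$; $\mathbb P,\mathbb E$ denote its law and expectation. No irreducibility or exponential tightness is assumed. The pair empirical measure is $L^{(2)}_n=\frac1n\sum_{k=1}^n\delta_{(X_k,X_{k+1})}\in\mathcal P(S^2)$. Reachability. For $x,y\in S$, $x\leadsto y$ means that there are $n\ge1$ and $x=x_1,x_2,\dots,x_{n+1}=y$ in $S$ with $p(x_i,x_{i+1})>0$ for all $1\le i\le n$ (so $x\leadsto x$ may fail). An irreducible class is a maximal nonempty subset $C\subseteq S$ with $x\leadsto y$ for all $(x,y)\in C^2$; $(C_j)_{j\in\mathcal J}$ is the countable family of all irreducible classes. $C_j\leadsto C_{j'}$ means some $y\in C_{j'}$ is reachable from some $x\in C_j$. $\beta\leadsto y$ means $y\in\operatorname{supp}\beta$ or $x\leadsto y$ for some $x\in\operatorname{supp}\beta$; $\beta\leadsto C_j$ means $\beta\leadsto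 y$ for some $y\in C_j$. Measures. $\mathcal P(S^2)$ is the set of probability measures on $S^2$ with the weak topology: the coarsest topology making $\mu\mapsto\langle\mu,V\rangle=\sum_{u}V(u)\mu(u)$ continuous for every bounded $V:S^2\to\mathbb R$ (set of such $V$: $\mathcal B(S^2)$); it is metrized by total variation. $\mu|_A$ denotes the measure $\mu(A\cap\cdot)$. $\mu\in\mathcal P(S^2)$ is balanced if $\mu(A\times S)=\mu(S\times A)$ for all $A\subseteq S$; $\mathcal P_{\mathrm{bal}}(S^2)$ is the set of balanced probability measures; $\mu^{(1)}(A)=\mu(A\times S)$. $\mu\in\mathcal P(S^2)$ is pre-admissible if $\mu=\sum_{j\in\mathcal J_\mu}\mu|_{C_j^2}$ for some $\mathcal J_\mu\subseteq\mathcal J$, taken minimal, i.e. $\mathcal J_\mu=\{j:\mu(C_j^2)>0\}$. A pre-admissible $\mu$ is admissible if moreover $\leadsto$ is total on $(C_j)_{j\in\mathcal J_\mu}$ (for $j,j'\in\mathcal J_\mu$, $C_j\leadsto C_{j'}$ or $C_{j'}\leadsto C_j$) and $\beta\leadsto C_j$ for all $j\in\mathcal J_\mu$. $\mathcal A^{(2)}$ is the set of admissible measures, and $\mathcal A^{(2)}_{\mathrm{bal}}=\mathcal A^{(2)}\cap\mathcal P_{\mathrm{bal}}(S^2)$. Functions. - $\Lambda^{(2)}(V)=\limsup_{n\to\infty}\frac1n\log\mathbb E[e^{n\langle L^{(2)}_n,V\rangle}]$ for $V\in\mathcal B(S^2)$, and $(\Lambda^{(2)})^*(\mu)=\sup_{V\in\mathcal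 B(S^2)}(\langle\mu,V\rangle-\Lambda^{(2)}(V))$. - $J^{(2)}(\mu)=\sup_{f}\langle\mu,\log\frac{f}{Pf}\rangle$ for $\mu\in\mathcal P_{\mathrm{bal}}(S^2)$, the supremum being over $f:S^2\to(0,\infty)$ bounded away from $0$ and $\infty$, with $Pf(x,y)=\sum_{z\in S}p(y,z)f(y,z)$. - $R^{(2)}(\mu)=H(\mu|\mu^{(1)}\otimes p)$ for $\mu\in\mathcal P_{\mathrm{bal}}(S^2)$, where $(\mu^{(1)}\otimes p)(x,y)=\mu^{(1)}(x)p(x,y)$ and $H(\mu|\nu)=\sum_u\mu(u)\log\frac{\mu(u)}{\nu(u)}$ if $\mu\ll\nu$ (with $0\log0=0$), $H(\mu|\nu)=\infty$ otherwise. Weak LDP. A sequence $(Y_n)$ of random elements of a Hausdorff space $\mathcal X$ satisfies the weak LDP with rate function $I$ if $I:\mathcal X\to[0,+\infty]$ is lower semicontinuous, $\limsup_n\frac1n\log\mathbb P(Y_n\in K)\le-\inf_KI$ for every compact $K$, and $\liminf_n\frac1n\log\mathbb P(Y_n\in U)\ge-\inf_UI$ for every open $U$. *)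

(* Defs.v *)
From HB Require Import structures.
From mathcomp Require Import all_boot all_order all_algebra.
From mathcomp Require Import all_classical all_reals all_analysis.

Set Implicit Arguments.
Unset Strict Implicit.
Unset Printing Implicit Defensive.

Import Order.TTheory GRing.Theory Num.Theory.
Import numFieldNormedType.Exports.

Local Open Scope classical_set_scope.
Local Open Scope ring_scope.

(* All sequences are indexed from 0: a term with index n stands for the term
   with index n + 1 of the corresponding sequence starting at 1. In particular
   the speed attached to index n is n.+1. *)

(* The countable discrete space S is a measurable type satisfying [discrete];
   every subset of S * S is then measurable as well. *)
Definition discrete d (S : measurableType d) : Prop :=
  countable [set: S] /\ forall A : set S, measurable A.

Section weak_topology.
Context d (T : measurableType d) (R : realType).

Definition pairing (mu : probability T R) (V : T -> R) : R :=
  Rintegral mu setT V.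

(* The coarsest topology making mu |-> pairing mu V continuous for every
   bounded V, i.e. the initial topology of the map into the product space.
   Only used when every subset of T is measurable. *)
Definition weak_prob : Type := initial_topology
  (fun mu : probability T R =>
    (fun V => pairing mu (sval V)) : {ptws {V : T -> R | bounded_fun V} -> R}).

HB.instance Definition _ := Topological.on weak_prob.

End weak_topology.

Section weak_ldp.
Local Open Scope ereal_scope.
Context d (Omega : measurableType d) (R : realType) (P : probability Omega R).

Definition weak_ldp (X : topologicalType) (Y : nat -> Omega -> X)
    (I : X -> \bar R) : Prop :=
  [/\ forall x, 0 <= I x,
      lower_semicontinuous I,
      forall K, compact K ->
        limn_esup (fun n => (n.+1%:R^-1)%:E * lne (P (Y n @^-1` K)))
          <= - ereal_inf (I @` K)
    & forall U, open U ->
        - ereal_inf (I @` U)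
          <= limn_einf (fun n => (n.+1%:R^-1)%:E * lne (P (Y n @^-1` U)))].

End weak_ldp.

Section chain.
Local Open Scope ereal_scope.
Context dO (Omega : measurableType dO) d (S : measurableType d) (R : realType).
Variables (P : probability Omega R) (beta : probability S R)
  (p : R.-pker S ~> S).

(* The Markov property is written without division by the probability of the
   conditioning event. *)
Definition markov_chain (X : nat -> {RV P >-> S}) : Prop :=
  (forall x, P (X 0%N @^-1` [set x]) = beta [set x]) /\
  (forall n (x : nat -> S),
    P [set w | forall k, (k <= n.+1)%N -> X k w = x k] =
    P [set w | forall k, (k <= n)%N -> X k w = x k] * p (x n) [set x n.+1]).

Section empirical_measure.
Variables (X : nat -> {RV P >-> S}) (n : nat) (w : Omega).

Definition pair_emp : set (S * S) -> \bar R :=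
  mscale (n.+1%:R^-1 : R)%R%:nng%R (msum (fun k => \d_(X k w, X k.+1 w)) n.+1).

HB.instance Definition _ := Measure.on pair_emp.

Let pair_emp_setT : pair_emp setT = 1.
Proof.
rewrite /pair_emp /mscale /= /msum.
under eq_bigr do rewrite /= diracE in_setT.
by rewrite sumEFin sumr_const card_ord -EFinM mulVf ?pnatr_eq0.
Qed.

HB.instance Definition _ :=
  Measure_isProbability.Build _ _ _ pair_emp pair_emp_setT.

End empirical_measure.

Definition L2 (X : nat -> {RV P >-> S}) (n : nat) (w : Omega) :
  probability (S * S)%type R := pair_emp X n w.

Definition reach (x y : S) : Prop :=
  exists n (z : nat -> S), [/\ (0 < n)%N, z 0%N = x, z n = y
    & forall i, (i < n)%N -> 0 < p (z i) [set z i.+1]].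

Definition irr_class (C : set S) : Prop :=
  [/\ C !=set0, forall x y, C x -> C y -> reach x y
    & forall C', C `<=` C' -> (forall x y, C' x -> C' y -> reach x y) ->
        C' = C].

Definition class_reach (C C' : set S) : Prop :=
  exists x y, [/\ C x, C' y & reach x y].

Definition init_reach (y : S) : Prop :=
  0 < beta [set y] \/ exists2 x, 0 < beta [set x] & reach x y.

Definition init_reach_class (C : set S) : Prop :=
  exists2 y, C y & init_reach y.

Implicit Types mu : probability (S * S)%type R.

(* The smallest index set J that can occur in [pre_admissible]. *)
Definition classes_of mu : set (set S) :=
  [set C | irr_class C /\ 0 < mu (C `*` C)].

Definition pre_admissible mu : Prop :=
  exists2 J : set (set S), J `<=` irr_class &
    forall A, mu A = \esum_(C in J) mu ((C `*` C) `&` A).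

Definition admissible mu : Prop :=
  [/\ pre_admissible mu,
      forall C C', classes_of mu C -> classes_of mu C' ->
        class_reach C C' \/ class_reach C' C
    & forall C, classes_of mu C -> init_reach_class C].

Definition balanced mu : Prop :=
  forall A : set S, mu (A `*` setT) = mu (setT `*` A).

Definition adm_bal mu : Prop := admissible mu /\ balanced mu.

Definition Lambda2 (X : nat -> {RV P >-> S}) (V : S * S -> R) : \bar R :=
  limn_esup (fun n => (n.+1%:R^-1)%:E *
    lne 'E_P[fun w => (expR (n.+1%:R * pairing (L2 X n w) V))%R]).

Definition Lambda2_conj (X : nat -> {RV P >-> S}) mu : \bar R :=
  ereal_sup [set (pairing mu V)%:E - Lambda2 X V | V in bounded_fun].

Definition Pop (f : S * S -> R) (u : S * S) : R :=
  Rintegral (p u.2) setT (fun z => f (u.2, z)).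

Definition J2 mu : \bar R :=
  ereal_sup [set (pairing mu (fun u => ln (f u / Pop f u)))%:E | f in
    [set f : S * S -> R | exists a b, 0 < a /\ forall u, a <= f u <= b]%R].

(* Relative entropy with respect to the measure of mass function nu. The
   integral against mu is the sum of mu u * ln (mu u / nu u) over the points u
   with mu u > 0; its negative part is finite when nu has finite total mass. *)
Definition rel_entropy d' (T : measurableType d') (mu : probability T R)
    (nu : T -> \bar R) : \bar R :=
  if `[< forall u, nu u = 0 -> mu [set u] = 0 >]
  then \int[mu]_u (ln (fine (mu [set u]) / fine (nu u)))%:E
  else +oo.

Definition R2 mu : \bar R :=
  rel_entropy mu (fun u => mu ([set u.1] `*` setT) * p u.1 [set u.2]).

Definition I2 (X : nat -> {RV P >-> S}) mu : \bar R :=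
  if `[< adm_bal mu >] then Lambda2_conj X mu else +oo.

End chain.

(* Main.v *)
Require Import Defs.
From HB Require Import structures.
From mathcomp Require Import all_boot all_order all_algebra.
From mathcomp Require Import all_classical all_reals all_analysis.
From mathcomp Require Import ring lra zify.

(**
The upper bound is local. If [mu] is balanced and admissible, Chebyshev's
inequality with a suitable bounded [V] gives the rate [Lambda2_conj mu] near
[mu]. Otherwise [mu] has a neighborhood which the empirical measure almost
surely leaves for good: its two marginals differ by at most one jump, an edge
inside no irreducible class is used at most once, and any two visited edges are
comparable and reachable from the initial law.

For the lower bound, greedily subtracting cycles from [mu] leaves nothing
(otherwise the residual circulation would have a cycle, by the recurrence
argument behind Poincare's theorem), so [mu] is approximated from below by a
finitely supported circulation [nu], whose relative entropy is almost that of
[mu]. Cut the stationary chain with edge law [nu] into blocks of length [n] and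
group the words with the same end points and the same edge counts; there are
only polynomially many groups, so by convexity the [nu]-average of the logarithm
of the probability of a group is at least [- n R2] up to [o(n)]. Repeat each
group proportionally to its [nu]-probability, close it into a loop, and visit
the loops in an order compatible with reachability: all the resulting words
have an empirical measure close to [mu].

This yields [Lambda2_conj mu <= R2 mu]. Conversely [R2 mu <= J2 mu], by testing
with [f] equal to the density on a finite set and to a small constant elsewhere,
and [J2 mu <= Lambda2_conj mu], since [Lambda2 (log (f / Pf)) <= 0].
*)

(** Without irreducibility the stationary chain with edge law [nu] need not be ergodic: its long
    paths need not have edge statistics [nu], and no law of large numbers produces the right words.
    What survives is the linear identity [sum_Qword_vsum], exact for every block length. The
    averaging it expresses is then carried out by hand inside a single path, and totality of
    reachability is what allows the groups to be visited one after the other. Groups are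
    unavoidable: the logarithmic weight of one word lacks the entropy of [nu], which the sum over a
    group restores up to the logarithm of the number of groups. Relative entropy is not continuous,
    so a circulation merely close to [mu] would not do. The bound [nu <= mu], valid before
    normalization, is what controls it: sums of the log density under [nu] are compared with those
    under [mu], negative terms being compensated by the reference measure. As no tightness is
    available, every approximation uses finitely many edges, and the words that close the loops form
    a finite set whose cost is bounded before the block length is chosen. *)

Set Implicit Arguments.
Unset Strict Implicit.
Unset Printing Implicit Defensive.

Import Order.TTheory GRing.Theory Num.Theory.
Import numFieldNormedType.Exports.

Local Open Scope classical_set_scope.
Local Open Scope ring_scope.

(** * Limits superior and the weak topology *)

Section limsup.
Local Open Scope ereal_scope.
Context {R : realType}.
Implicit Types (u v : (\bar R)^nat) (c : \bar R).

Lemma limn_esup_le_near u c :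
  (\forall n \near \oo, u n <= c) -> limn_esup u <= c.
Proof.
move=> uc; rewrite /limn_esup /limf_esup.
apply: ereal_inf_le => /=; exists (ereal_sup (u @` [set n | u n <= c])).
  by exists [set n | u n <= c].
by apply: ge_ereal_sup => _ [n /= unc <-].
Qed.

Lemma limn_esup_lt_near u c :
  limn_esup u < c -> \forall n \near \oo, u n < c.
Proof.
rewrite /limn_esup /limf_esup => /ereal_inf_lt[_ /= [A FA <-] Ac].
apply: filterS FA => n An; apply: le_lt_trans Ac.
by apply: ereal_sup_ubound; exists n.
Qed.

Lemma le_limn_einf_near u c :
  (\forall n \near \oo, c <= u n) -> c <= limn_einf u.
Proof.
move=> uc; rewrite /limn_einf leeNr; apply: limn_esup_le_near.
by apply: filterS uc => n; rewrite leeN2.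
Qed.

Lemma le_limn_esup_near u c :
  (\forall n \near \oo, c <= u n) -> c <= limn_esup u.
Proof. by move/le_limn_einf_near/le_trans; apply; exact: limn_einf_sup. Qed.

Lemma lte_real_dense c d : c < d -> exists a : R, c < a%:E < d.
Proof.
case: c d => [r| |] [s| |]//; rewrite ?ltxx ?ltNge ?leey ?leNye//= -?ltNge.
- rewrite lte_fin => rs; exists ((r + s) / 2)%R.
  by rewrite !lte_fin !midf_lt.
- by move=> _; exists (r + 1)%R; rewrite lte_fin ltrDl ltr01 ltry.
- by move=> _; exists (s - 1)%R; rewrite ltNyr lte_fin gtrDl ltrN10.
- by move=> _; exists 0%R; rewrite ltNyr ltry.
Qed.

(** Density of the reals in the extended reals reduces the bound to real levels, so that infinite
    rates never enter the estimates at fixed [n]. *)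
Lemma ge_limn_esup u c :
  (forall a : R, c < a%:E -> \forall n \near \oo, u n <= a%:E) ->
  limn_esup u <= c.
Proof.
move=> h; rewrite leNgt; apply/negP => /lte_real_dense[a /andP[/h ca]].
by rewrite ltNge (limn_esup_le_near ca).
Qed.

End limsup.

Section weak_topology.
Context d (T : measurableType d) (R : realType).
Implicit Types (V : T -> R) (mu nu : weak_prob T R).

Lemma bounded_funP V :
  bounded_fun V <-> exists2 M : R, 0 < M & forall u, `|V u| <= M.
Proof.
split=> [[M [Mreal bM]]|[M M0 bM]].
  exists (Num.max 1 (M + 1)); first by rewrite lt_max ltr01.
  by move=> u; apply: bM => //; rewrite lt_max ltrDl ltr01 orbT.
exists M; split; first exact: num_real.
by move=> x Mx u _; apply: le_trans (bM u) (ltW Mx).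
Qed.

Lemma pairing_near V mu (e : R) : bounded_fun V -> 0 < e ->
  nbhs mu [set nu | `|pairing nu V - pairing mu V| < e].
Proof.
move=> bV e0.
pose f (nu : probability T R) :=
  (fun W => pairing nu (sval W)) : {ptws {W : T -> R | bounded_fun W} -> R}.
have cf : {for mu, continuous (f : weak_prob T R -> _)}.
  exact: initial_continuous.
have pc : (fun g : {ptws {W : T -> R | bounded_fun W} -> R} =>
    g (exist _ V bV)) @ nbhs (f mu) --> f mu (exist _ V bV).
  have /cvg_sup/(_ (exist _ V bV)) h : nbhs (f mu) --> f mu by apply: cvg_id.
  move=> A; rewrite nbhsE => -[C [oC Cf] CA]; apply: h => /=.
  exists ((fun g : {W : T -> R | bounded_fun W} -> R =>
    g (exist _ V bV)) @^-1` C); split => //; [by exists C | by move=> g; exact: CA].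
have /cvgrPdist_lt/(_ e e0) : (fun nu : weak_prob T R => pairing nu V) @ mu
    --> pairing mu V.
  exact: (cvg_comp _ _ cf pc).
by apply: filterS => nu /=; rewrite distrC.
Qed.

(** The sets containing a basic neighborhood of [mu] form a filter [F] whose image converges to
    [f mu] coordinate by coordinate. As [U] is the preimage of an open set of the product, it
    belongs to [F]. The common bound [M] is what later estimates need of the finitely many test
    functions. *)
Lemma weak_open_pairing (U : set (weak_prob T R)) mu : open U -> U mu ->
  exists k (V : nat -> T -> R) (M e : R),
  [/\ 0 < e, 0 < M, forall i u, `|V i u| <= M &
   forall nu, (forall i, (i < k)%N -> `|pairing nu (V i) - pairing mu (V i)| < e) ->
   U nu].
Proof.
move=> oU Umu.
pose F : set_system (weak_prob T R) := [set A |
  exists k (V : nat -> T -> R) (M e : R),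
  [/\ 0 < e, 0 < M, forall i u, `|V i u| <= M &
   forall nu, (forall i, (i < k)%N ->
     `|pairing nu (V i) - pairing mu (V i)| < e) -> A nu]].
suff : F U by [].
have FF : Filter F.
  split.
  - exists 0%N, (fun _ _ => 0), 1, 1; split => //; first by move=> *; rewrite normr0.
  - move=> A B [k1 [V1 [M1 [e1 [e10 M10 b1 h1]]]]]
      [k2 [V2 [M2 [e2 [e20 M20 b2 h2]]]]].
    exists (k1 + k2)%N, (fun i => if (i < k1)%N then V1 i else V2 (i - k1)%N),
      (M1 + M2), (Num.min e1 e2); split.
    + by rewrite lt_min e10.
    + exact: addr_gt0.
    + move=> i u; case: ifP => _.
        by rewrite (le_trans (b1 _ _))// lerDl ltW.
      by rewrite (le_trans (b2 _ _))// lerDr ltW.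
    + move=> nu h; split.
        apply: h1 => i ik; have := h i; rewrite ik (leq_trans ik) ?leq_addr//.
        by move=> /(_ erefl); rewrite lt_min => /andP[].
      apply: h2 => i ik; have := h (k1 + i)%N.
      rewrite ltn_add2l ik => /(_ erefl).
      by rewrite ltnNge leq_addr/= addKn lt_min => /andP[].
  - move=> A B AB [k [V [M [e [e0 M0 b h]]]]].
    by exists k, V, M, e; split => // nu /h/AB.
pose f (nu : weak_prob T R) :=
  (fun W => pairing nu (sval W)) : {ptws {W : T -> R | bounded_fun W} -> R}.
have cvgf : f @ F --> f mu.
  apply/cvg_sup => W A; move=> [_ [[C oC <-] /= Cf BA]].
  have /nbhs_ballP[e /= e0 eC] : nbhs (pairing mu (sval W)) C.
    exact: open_nbhs_nbhs.
  have /bounded_funP[M M0 bM] := svalP W.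
  exists 1%N, (fun _ => sval W), M, e; split => // nu /(_ 0%N erefl) h.
  by apply: BA; apply: eC; rewrite /ball/= distrC.
case: oU => B oB BU.
have /cvgf : nbhs (f mu) B.
  by apply: open_nbhs_nbhs; split => //; move: Umu; rewrite -BU.
by rewrite -BU.
Qed.

End weak_topology.

(** * Probabilities on a countable space *)

Section esum_seq.
Context (T : choiceType) (R : realType).

Lemma esum_le_seq (D : set T) (a : T -> \bar R) (c : \bar R) :
  (forall s : seq T, uniq s -> (forall u, u \in s -> D u) ->
    (\sum_(u <- s) a u <= c)%E) ->
  (\esum_(u in D) a u <= c)%E.
Proof.
move=> h; apply: ge_ereal_sup => _ [A [fA AD] <-].
rewrite fsbig_finite//=; apply: h => [|u]; first exact: finmap.fset_uniq.
by rewrite in_fset_set// => /set_mem/AD.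
Qed.

Lemma le_sum_esum (D : set T) (a : T -> \bar R) (s : seq T) :
  (forall u, 0 <= a u)%E -> uniq s -> (forall u, u \in s -> D u) ->
  (\sum_(u <- s) a u <= \esum_(u in D) a u)%E.
Proof.
move=> a0 us sD; apply: esum_ge; exists [set` s].
  by split; [exact: finite_seq | move=> u; exact: sD].
by rewrite fsbig_seq.
Qed.

End esum_seq.

Section fibers.
Context d (Om : measurableType d) (R : realType) (mu : {measure set Om -> \bar R}).
Context (T : choiceType) (Z : Om -> T).
Hypotheses (cT : countable [set: T])
  (mZ : forall t, measurable (Z @^-1` [set t])).

Lemma measurable_fibers (A : set T) : measurable (Z @^-1` A).
Proof.
have -> : Z @^-1` A = \bigcup_t (Z @^-1` (A `&` [set t])).
  rewrite eqEsubset; split => [w Aw|w [t _ []//]].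
  by exists (Z w).
apply: countable_bigcupT_measurable => // t; have [At|nA] := pselect (A t).
  by rewrite (_ : A `&` _ = [set t])// setIidr// => _ ->.
rewrite (_ : A `&` _ = set0) ?preimage_set0; first exact: measurable0.
by rewrite eqEsubset; split => // u [Au /= ut]; apply: nA; rewrite -ut.
Qed.

(** An injection of [T] into the integers cuts [A] into pieces [G k] with at most one point each,
    and the integral is countably additive over their preimages. *)
Lemma integral_fibers (A : set T) (F : T -> \bar R) : (forall t, 0 <= F t)%E ->
  (\int[mu]_(w in Z @^-1` A) F (Z w) =
   \esum_(t in A) (F t * mu (Z @^-1` [set t])))%E.
Proof.
move=> F0; have /countable_injP[i iinj] := cT.
pose G k := A `&` i @^-1` [set k].
have GA : A = \bigcup_k G k.
  rewrite eqEsubset; split => [u Du|u [k _ []//]].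
  by exists (i u).
have tG : trivIset setT G.
  by move=> k l _ _ [u [[_ <-] [_ <-]]].
rewrite GA preimage_bigcup ge0_integral_bigcup//; last 3 first.
  - by move=> k; exact: measurable_fibers.
  - move=> _ B _; rewrite -preimage_bigcup.
    exact: (measurable_fibers ((\bigcup_k G k) `&` F @^-1` B)).
  - by move=> k l _ _ [w [Gk Gl]]; apply: tG => //; exists (Z w).
rewrite nneseries_sum_bigcup//; last first.
  by move=> u; apply: mule_ge0.
apply: eq_eseriesr => k _.
have [->|/set0P[u [Du iu]]] := eqVneq (G k) set0.
  by rewrite preimage_set0 integral_set0 esum_set0.
have -> : G k = [set u].
  rewrite eqEsubset; split => [v [Dv iv]|v ->] //.
  by apply: iinj; rewrite ?inE// iu iv.
rewrite esum_set1 ?mule_ge0// (eq_integral (cst (F u))).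
  by rewrite integral_cst.
by move=> w; rewrite inE => /= ->.
Qed.

End fibers.

Section discrete_measure.
Context d (T : measurableType d) (R : realType).
Hypothesis dT : discrete T.

Lemma discrete_measurable (A : set T) : measurable A.
Proof. by case: dT. Qed.

Lemma integral_esum (mu : {measure set T -> \bar R}) (D : set T)
  (f : T -> \bar R) : (forall u, 0 <= f u)%E ->
  (\int[mu]_(u in D) f u = \esum_(u in D) (f u * mu [set u]))%E.
Proof.
move=> f0; apply: (@integral_fibers _ _ _ _ _ (@id T)) => //; first by case: dT.
by move=> u; exact: discrete_measurable.
Qed.

Lemma measure_esum (mu : {measure set T -> \bar R}) (D : set T) :
  (mu D = \esum_(u in D) mu [set u])%E.
Proof.
rewrite -[LHS]mul1e -integral_cst; last exact: discrete_measurable.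
rewrite integral_esum => [|u]; last by rewrite lee01.
by apply: eq_esum => u _; rewrite mul1e.
Qed.

End discrete_measure.

Lemma discrete_prod d (S : measurableType d) :
  discrete S -> discrete (S * S)%type.
Proof.
move=> dS; have [cS mS] := dS; split.
  by rewrite -setXTT; exact: countableX.
move=> A; have -> : A = \bigcup_u (A `&` [set u]).
  rewrite eqEsubset; split => [u Au|u [v _ []//]].
  by exists u.
apply: countable_bigcupT_measurable; first by rewrite -setXTT; exact: countableX.
move=> [x y]; have [Axy|nA] := pselect (A (x, y)).
  rewrite (_ : A `&` _ = [set x] `*` [set y]); first exact: measurableX.
  by rewrite eqEsubset; split => [_ [_ ->]|[a b] [/= -> ->]].
rewrite (_ : A `&` _ = set0); first exact: measurable0.
by rewrite eqEsubset; split => // u [Au /= uxy]; apply: nA; rewrite -uxy.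
Qed.

Section mass.
Context d (T : measurableType d) (R : realType).
Hypothesis dT : discrete T.
Implicit Types (mu : probability T R) (V f : T -> R).

Definition mass mu u : R := fine (mu [set u]).

Lemma massE mu u : mu [set u] = (mass mu u)%:E.
Proof. by rewrite /mass fineK// fin_num_measure//; exact: discrete_measurable. Qed.

Lemma mass_esum mu D : mu D = (\esum_(u in D) (mass mu u)%:E)%E.
Proof. by rewrite (measure_esum dT); apply: eq_esum => u _; exact: massE. Qed.

Lemma mass_ge0 mu u : 0 <= mass mu u.
Proof. exact/fine_ge0/measure_ge0. Qed.

Lemma bounded_integrable mu V : bounded_fun V -> mu.-integrable setT (EFin \o V).
Proof.
move=> bV; apply: measurable_bounded_integrable => //.
  by apply: le_lt_trans (probability_le1 _ _) (ltry _).
by move=> ? ? ?; exact: discrete_measurable.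
Qed.

Lemma bounded_funD V W : bounded_fun V -> bounded_fun W ->
  bounded_fun (fun u => V u + W u).
Proof.
move=> /bounded_funP[M M0 bV] /bounded_funP[N N0 bW]; apply/bounded_funP.
exists (M + N); first exact: addr_gt0.
by move=> u; rewrite (le_trans (ler_normD _ _))// lerD.
Qed.

Lemma bounded_funZ a V : bounded_fun V -> bounded_fun (fun u => a * V u).
Proof.
move=> /bounded_funP[M M0 bV]; apply/bounded_funP.
exists ((`|a| + 1) * M); first by rewrite mulr_gt0// ltr_wpDl.
by move=> u; rewrite normrM ler_pM// lerDl.
Qed.

Lemma bounded_fun_cst c : bounded_fun (fun _ : T => c : R).
Proof.
by apply/bounded_funP; exists (`|c| + 1) => [|u]; rewrite ?ltr_wpDl ?lerDl.
Qed.

Lemma bounded_fun_indic (A : set T) : bounded_fun (\1_A : T -> R).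
Proof.
apply/bounded_funP; exists 1 => // u; rewrite indicE.
by case: (u \in A); rewrite ?normr1 ?normr0.
Qed.

Lemma pairingD mu V W : bounded_fun V -> bounded_fun W ->
  pairing mu (fun u => V u + W u) = pairing mu V + pairing mu W.
Proof. by move=> bV bW; apply: RintegralD => //; exact: bounded_integrable. Qed.

Lemma pairingZ mu a V : bounded_fun V ->
  pairing mu (fun u => a * V u) = a * pairing mu V.
Proof. by move=> bV; apply: RintegralZl => //; exact: bounded_integrable. Qed.

Lemma pairing_cst mu c : pairing mu (fun=> c) = c.
Proof.
transitivity (c * fine (mu setT)); first exact: Rintegral_cst.
by rewrite probability_setT mulr1.
Qed.

Lemma pairing_indic mu A : pairing mu \1_A = fine (mu A).
Proof.
rewrite /pairing /Rintegral integral_indic// ?setIT//.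
exact: discrete_measurable.
Qed.

Lemma le_pairing mu V W : bounded_fun V -> bounded_fun W ->
  (forall u, V u <= W u) -> pairing mu V <= pairing mu W.
Proof.
by move=> bV bW h; apply: le_Rintegral => //; exact: bounded_integrable.
Qed.

Lemma bounded_fun_sum (F : seq T) (a : T -> R) :
  bounded_fun (fun u => \sum_(v <- F) a v * (u == v)%:R).
Proof.
elim: F => [|v F IH].
  by rewrite (_ : (fun _ => _) = fun=> 0); [exact: bounded_fun_cst|apply/funext => u; rewrite big_nil].
rewrite (_ : (fun _ => _) =
  fun u => a v * \1_[set v] u + \sum_(w <- F) a w * (u == w)%:R).
  by apply: bounded_funD => //; apply: bounded_funZ; exact: bounded_fun_indic.
by apply/funext => u; rewrite big_cons indicE in_set1.
Qed.

Lemma pairing_sum mu c (F : seq T) (a : T -> R) :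
  pairing mu (fun u => c + \sum_(v <- F) a v * (u == v)%:R) =
  c + \sum_(v <- F) a v * mass mu v.
Proof.
rewrite pairingD ?pairing_cst; [|exact: bounded_fun_cst|exact: bounded_fun_sum].
congr (_ + _); elim: F => [|v F IH].
  by rewrite big_nil -[RHS](pairing_cst mu); congr pairing; apply/funext => u; rewrite big_nil.
rewrite big_cons -IH /mass -pairing_indic -pairingZ; last exact: bounded_fun_indic.
rewrite -pairingD; [|apply: bounded_funZ; exact: bounded_fun_indic|exact: bounded_fun_sum].
by congr pairing; apply/funext => u; rewrite big_cons indicE in_set1.
Qed.

Lemma sum_delta (F : seq T) (a : T -> R) u : uniq F ->
  \sum_(v <- F) a v * (u == v)%:R = if u \in F then a u else 0.
Proof.
elim: F => [|v F IH]; first by rewrite big_nil.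
rewrite big_cons in_cons /= => /andP[vF /IH ->].
have [->|uv] := eqVneq u v; last by rewrite mulr0 add0r.
by rewrite (negbTE vF) mulr1 addr0.
Qed.

(** The finite combination of indicators equal to [h] on [F] and to [c] elsewhere lies below [V];
    its pairing is an explicit finite sum. *)
Lemma pairing_ge_off mu V (F : seq T) (h : T -> R) c : bounded_fun V -> uniq F ->
  (forall u, u \in F -> h u <= V u) -> (forall u, u \notin F -> c <= V u) ->
  c + \sum_(u <- F) (h u - c) * mass mu u <= pairing mu V.
Proof.
move=> bV uF hF hnF; rewrite -pairing_sum; apply: le_pairing => //.
  apply: bounded_funD; [exact: bounded_fun_cst|exact: bounded_fun_sum].
move=> u; rewrite sum_delta//; case: ifPn => uF'; last by rewrite addr0 hnF.
by rewrite addrC subrK hF.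
Qed.

(** The part of [mu] not covered by [nu] has mass [1 - \sum_(u <- F) nu u], and [V] is at most [M]
    there. One side comes from [pairing_ge_off] with [c = - M], the other from the same bound for
    [- V]. *)
Lemma pairing_approx mu V (M : R) (F : seq T) (nu : T -> R) : uniq F ->
  (forall u, `|V u| <= M) -> (forall u, u \in F -> 0 <= nu u <= mass mu u) ->
  `|pairing mu V - \sum_(u <- F) nu u * V u| <= M * (1 - \sum_(u <- F) nu u).
Proof.
move=> uF bM hnu.
have h W : (forall u, `|W u| <= M) -> - (M * (1 - \sum_(u <- F) nu u)) <=
    pairing mu W - \sum_(u <- F) nu u * W u.
  move=> bW.
  have bW' : bounded_fun W.
    apply/bounded_funP; exists (`|M| + 1) => [|u]; first by rewrite ltr_wpDl.
    by rewrite (le_trans (bW u))// (le_trans (ler_norm _))// lerDl.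
  have := @pairing_ge_off mu W F W (- M) bW' uF (fun u _ => lexx _).
  have -> : - (M * (1 - \sum_(u <- F) nu u)) =
      - M + \sum_(u <- F) (W u - - M) * nu u - \sum_(u <- F) nu u * W u.
    rewrite -addrA -sumrB mulrBr mulr1 opprB addrC; congr (_ + _).
    by rewrite mulr_sumr; apply: eq_bigr => u _; ring.
  move=> H; rewrite lerD2r; apply: le_trans (H _); last first.
    by move=> u _; have := bW u; rewrite ler_norml => /andP[].
  rewrite lerD2l big_seq [leRHS]big_seq; apply: ler_sum => u /hnu/andP[_ le].
  by rewrite ler_wpM2l// opprK; have := bW u; rewrite ler_norml lerNl -subr_ge0 opprK addrC => /andP[].
rewrite ler_norml h//=.
have bN u : `|-1 * V u| <= M by rewrite mulN1r normrN.
have := h (fun u => -1 * V u) bN; rewrite pairingZ; last first.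
  apply/bounded_funP; exists (`|M| + 1) => [|u]; first by rewrite ltr_wpDl.
  by rewrite (le_trans (bM u))// (le_trans (ler_norm _))// lerDl.
rewrite (_ : \sum_(u <- F) nu u * (-1 * V u) = - \sum_(u <- F) nu u * V u).
  by set K := M * _; lra.
by rewrite -sumrN; apply: eq_bigr => u _; rewrite mulN1r mulrN.
Qed.

Lemma sum_mass_le1 mu (s : seq T) : uniq s -> \sum_(u <- s) mass mu u <= 1.
Proof.
move=> us; have := @pairing_ge_off mu (fun=> 1) s (fun=> 1) 0.
rewrite pairing_cst add0r; under eq_bigr do rewrite subr0 mul1r.
by apply => //; exact: bounded_fun_cst.
Qed.

Lemma mass_exhaust mu (e : R) : 0 < e ->
  exists2 s : seq T, uniq s & 1 - e < \sum_(u <- s) mass mu u.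
Proof.
move=> e0; apply: contrapT => h.
have : (mu setT <= (1 - e)%:E)%E.
  rewrite measure_esum//; apply: esum_le_seq => s us _.
  rewrite (eq_bigr (fun u => (mass mu u)%:E)); last by move=> u _; exact: massE.
  rewrite sumEFin lee_fin leNgt.
  by apply/negP => hs; apply: h; exists s.
by rewrite probability_setT lee_fin leNgt ltrBlDr ltrDl e0.
Qed.

Lemma integral_exhaust mu (f : T -> R) (c : \bar R) : (forall u, 0 <= f u) ->
  (c < \int[mu]_u (f u)%:E)%E ->
  exists2 s : seq T, uniq s & (c < (\sum_(u <- s) f u * mass mu u)%:E)%E.
Proof.
move=> f0 cf; apply: contrapT => h; move: cf; rewrite ltNge => /negP; apply.
rewrite integral_esum//.
apply: esum_le_seq => s us _.
rewrite (eq_bigr (fun u => (f u * mass mu u)%:E)); last first.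
  by move=> u _; rewrite EFinM -massE.
rewrite sumEFin leNgt.
by apply/negP => hs; apply: h; exists s.
Qed.

Lemma integral_le_seq mu (f : T -> R) (c : \bar R) : (forall u, 0 <= f u) ->
  (forall s : seq T, uniq s -> ((\sum_(u <- s) f u * mass mu u)%:E <= c)%E) ->
  (\int[mu]_u (f u)%:E <= c)%E.
Proof.
move=> f0 h; rewrite leNgt; apply/negP => /(integral_exhaust f0)[s /h].
by rewrite leNgt => /negP.
Qed.

Lemma le_sum_integral mu (f : T -> R) (s : seq T) : (forall u, 0 <= f u) ->
  uniq s -> ((\sum_(u <- s) f u * mass mu u)%:E <= \int[mu]_u (f u)%:E)%E.
Proof.
move=> f0 us; rewrite integral_esum//.
apply: le_trans (le_sum_esum _ us _) => //; last first.
  by move=> u; rewrite mule_ge0// lee_fin.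
rewrite -sumEFin; apply: lee_sum => u _.
by rewrite EFinM -massE.
Qed.

End mass.

(** * Words and the law of finite paths *)

(** The remaining fields of the structure are propositions, hence irrelevant. This matters because
    [L2] takes its values in the packed type, not in set functions. *)
Lemma eq_probability d (T : measurableType d) (R : realType)
  (mu nu : probability T R) : mu = nu :> (set T -> \bar R) -> mu = nu.
Proof.
case: mu => m [[a1 a2] [a3] [a4] [a5] [a6] [a7] [a8]].
case: nu => n [[b1 b2] [b3] [b4] [b5] [b6] [b7] [b8]] /= e; subst n.
rewrite (Prop_irrelevance b1 a1) (Prop_irrelevance b2 a2).
rewrite (Prop_irrelevance b3 a3) (Prop_irrelevance b4 a4).
rewrite (Prop_irrelevance b5 a5) (Prop_irrelevance b6 a6).
by rewrite (Prop_irrelevance b7 a7) (Prop_irrelevance b8 a8).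
Qed.

Section words.
Context (S : choiceType) (R : realType).
Implicit Types (x y : S) (s : seq S) (q : S -> S -> R).

(** A word is a start [x] and the list [s] of the next vertices, so it is never empty and [size s]
    counts its edges. *)
Fixpoint edges x s : seq (S * S) :=
  if s is y :: s' then (x, y) :: edges y s' else [::].

Definition wt q x s : R := \prod_(e <- edges x s) q e.1 e.2.

Definition vsum (V : S * S -> R) x s : R := \sum_(e <- edges x s) V e.

Lemma size_edges x s : size (edges x s) = size s.
Proof. by elim: s x => //= y s IH x; rewrite IH. Qed.

Lemma nth_edges x0 x s i : (i < size s)%N ->
  nth (x0, x0) (edges x s) i = (nth x0 (x :: s) i, nth x0 (x :: s) i.+1).
Proof. by elim: s x i => // y s IH x [|i] //= /IH ->. Qed.

Lemma edges_cat x s1 s2 :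
  edges x (s1 ++ s2) = edges x s1 ++ edges (last x s1) s2.
Proof. by elim: s1 x => //= y s IH x; rewrite IH. Qed.

Lemma edges_map (f : nat -> S) m n :
  edges (f m) [seq f k | k <- iota m.+1 n] =
  [seq (f k, f k.+1) | k <- iota m n].
Proof. by elim: n m => //= n IH m; rewrite IH. Qed.

Lemma wt_nil q x : wt q x [::] = 1.
Proof. by rewrite /wt big_nil. Qed.

Lemma wt_cons q x y s : wt q x (y :: s) = q x y * wt q y s.
Proof. by rewrite /wt big_cons. Qed.

Lemma wt_nth q x0 x s : wt q x s =
  \prod_(k < size s) q (nth x0 (x :: s) k) (nth x0 (x :: s) k.+1).
Proof.
elim: s x => [|y s IH] x; first by rewrite big_ord0 wt_nil.
by rewrite big_ord_recl wt_cons IH.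
Qed.

Lemma wt_cat q x s1 s2 : wt q x (s1 ++ s2) = wt q x s1 * wt q (last x s1) s2.
Proof. by rewrite /wt edges_cat big_cat. Qed.

Lemma wt_ge0 q x s : (forall a b, 0 <= q a b) -> 0 <= wt q x s.
Proof. by move=> q0; apply: prodr_ge0. Qed.

Lemma vsum_cat V x s1 s2 :
  vsum V x (s1 ++ s2) = vsum V x s1 + vsum V (last x s1) s2.
Proof. by rewrite /vsum edges_cat big_cat. Qed.

Lemma vsum_le V (M : R) x s : (forall u, `|V u| <= M) ->
  `|vsum V x s| <= M * (size s)%:R.
Proof.
move=> bV; rewrite /vsum -(size_edges x); elim: (edges x s) => [|e l IH].
  by rewrite big_nil normr0 mulr0.
rewrite big_cons (le_trans (ler_normD _ _))//= -addn1 natrD mulrDr mulr1 addrC.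
exact: lerD.
Qed.

End words.

Section path_law.
Context dO (Omega : measurableType dO) d (S : measurableType d) (R : realType).
Variables (P : probability Omega R) (beta : probability S R) (p : R.-pker S ~> S).
Hypothesis hS : discrete S.

(** Repackages [p x] as a probability, so that the facts about [mass] and [pairing] apply to
    transition probabilities. *)
Definition pker x : set S -> \bar R := p x.
HB.instance Definition _ x := Measure.on (pker x).
Let pker_setT x : pker x setT = 1%E. Proof. exact: prob_kernel. Qed.
HB.instance Definition _ x :=
  Measure_isProbability.Build _ _ _ (pker x) (pker_setT x).

Definition pr x y : R := mass (pker x) y.

Lemma prE x y : p x [set y] = (pr x y)%:E.
Proof. exact: (massE hS (pker x)). Qed.

Lemma pr_ge0 x y : 0 <= pr x y.
Proof. exact: mass_ge0. Qed.

Variable X : nat -> {RV P >-> S}.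

Definition traj n w : seq S := [seq X k w | k <- iota 1 n].

Definition path_of n w : S * seq S := (X 0%N w, traj n w).

Lemma size_traj n w : size (traj n w) = n.
Proof. by rewrite size_map size_iota. Qed.

Lemma edges_traj n w :
  edges (X 0%N w) (traj n w) = [seq (X k w, X k.+1 w) | k <- iota 0 n].
Proof. exact: (edges_map (fun k => X k w)). Qed.

Lemma take_traj m n w : (m <= n)%N -> take m (traj n w) = traj m w.
Proof. by move=> mn; rewrite -map_take take_iota (minn_idPl mn). Qed.

Lemma countable_paths : countable [set: S * seq S].
Proof.
have [/countable_injP[i iinj] _] := hS.
have ii : injective i by move=> x y; apply: iinj; rewrite inE.
apply/countable_injP; exists (fun u => pickle (i u.1, map i u.2)).
move=> [x s] [y t] _ _ /(pcan_inj pickleK)[/ii -> /(inj_map ii) ->//].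
Qed.

Lemma path_fiber n x s : path_of n @^-1` [set (x, s)] =
  if size s == n then [set w | forall k, (k <= n)%N -> X k w = nth x (x :: s) k]
  else set0.
Proof.
case: eqP => sn; rewrite eqEsubset; split => w //=; last first.
- by move=> [_ sE]; apply: sn; rewrite -sE size_traj.
- move=> h; have h0 := h 0%N isT; rewrite /path_of h0; congr (_, _).
  apply: (@eq_from_nth _ x); rewrite size_traj// => k kn.
  by rewrite (nth_map 0%N) ?size_iota// nth_iota// add1n h.
move=> [x0 sE] [|k] kn //=.
by rewrite -sE (nth_map 0%N) ?size_iota// nth_iota// add1n.
Qed.

Lemma measurable_path_fiber n u : measurable (path_of n @^-1` [set u]).
Proof.
case: u => x s; rewrite path_fiber; case: eqP => _; last exact: measurable0.
rewrite (_ : [set _ | _] =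
  \bigcap_(k in [set k | (k <= n)%N]) (X k @^-1` [set nth x (x :: s) k])) //.
apply: bigcap_measurable => [|k kn]; first by exists 0%N.
rewrite -[_ @^-1` _]setTI; apply: measurable_funP => //.
exact: discrete_measurable.
Qed.

Lemma measurable_path n A : measurable (path_of n @^-1` A).
Proof.
by apply: measurable_fibers; [exact: countable_paths|exact: measurable_path_fiber].
Qed.

Lemma L2_path n w w' : path_of n.+1 w = path_of n.+1 w' -> L2 X n w = L2 X n w'.
Proof.
move=> pE; have x0 := congr1 fst pE; have tE := congr1 snd pE.
rewrite /= in x0 tE; apply: eq_probability; apply/funext => A.
rewrite /= /pair_emp /mscale/= /msum; congr (_ * _)%E.
have := edges_traj n.+1 w; rewrite x0 tE edges_traj => h.
apply: eq_bigr => -[k /= kn] _.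
have := congr1 (fun l => nth (X 0%N w, X 0%N w) l k) h.
by rewrite !(nth_map 0%N) ?size_iota// nth_iota// => ->.
Qed.

(** [L2 X n] averages [n.+1] pairs, hence factors through [path_of X n.+1], which has countably many
    values and measurable fibers. No sigma-algebra on the space of measures is involved. *)
Lemma measurable_L2 n (K : set (probability (S * S)%type R)) :
  measurable (L2 X n @^-1` K).
Proof.
rewrite (_ : _ @^-1` _ =
  path_of n.+1 @^-1` [set path_of n.+1 w | w in L2 X n @^-1` K]).
  exact: measurable_path.
rewrite eqEsubset; split => w /=; first by move=> Kw; exists w.
by move=> [w' Kw' /L2_path <-].
Qed.

Lemma pairing_L2 n w (V : S * S -> R) : bounded_fun V ->
  pairing (L2 X n w) V = n.+1%:R^-1 * vsum V (X 0%N w) (traj n.+1 w).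
Proof.
move=> bV; have /bounded_funP[M M0 bM] := bV.
have hS2 := discrete_prod hS.
have h0 u : 0 <= V u + M.
  by rewrite -lerBlDr sub0r; have := bM u; rewrite ler_norml => /andP[].
(* Adding [M] makes the integrand nonnegative, as the rules for scaled measures and finite sums of
   measures require; the constant cancels at the end. *)
have : pairing (L2 X n w) (fun u => V u + M) =
    n.+1%:R^-1 * \sum_(k < n.+1) (V (X k w, X k.+1 w) + M).
  rewrite /pairing /Rintegral.
  rewrite ge0_integral_mscale; [|by []|by move=> ? ? ?; exact: discrete_measurable|by move=> u _; rewrite lee_fin].
  rewrite ge0_integral_measure_sum; [|by []|by move=> u _; rewrite lee_fin|by move=> ? ? ?; exact: discrete_measurable].
  rewrite (eq_bigr (fun k : 'I_n.+1 => (V (X k w, X k.+1 w) + M)%:E)).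
    by rewrite sumEFin.
  move=> k _; rewrite integral_dirac//; last by move=> ? ? ?; exact: discrete_measurable.
  by rewrite diracT mul1e.
rewrite pairingD//; last exact: bounded_fun_cst.
rewrite pairing_cst big_split/= sumr_const card_ord mulrDr -[M *+ _]mulr_natl.
rewrite mulKf ?pnatr_eq0// => /addIr ->; congr (_ * _).
by rewrite /vsum edges_traj big_map -[iota 0 _]/(index_iota 0 n.+1) big_mkord.
Qed.

Hypothesis hX : markov_chain beta p X.

Lemma prob_word_fun n (z : nat -> S) :
  P [set w | forall k, (k <= n)%N -> X k w = z k] =
  (mass beta (z 0%N) * \prod_(k < n) pr (z k) (z k.+1))%:E.
Proof.
elim: n => [|n IH].
  rewrite big_ord0 mulr1 -massE// -hX.1; congr (P _).
  rewrite eqEsubset; split => w /=; first by apply.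
  by move=> h k; rewrite leqn0 => /eqP ->.
by rewrite hX.2 IH prE -EFinM big_ord_recr/= mulrA.
Qed.

Lemma prob_path n x s : P (path_of n @^-1` [set (x, s)]) =
  (if size s == n then mass beta x * wt pr x s else 0)%:E.
Proof.
rewrite path_fiber; case: eqP => [<-|_]; last by rewrite measure0.
rewrite prob_word_fun /=; congr ((_ * _)%:E).
by rewrite (wt_nth _ x).
Qed.

Lemma integral_path n (F : S * seq S -> \bar R) (A : set (S * seq S)) :
  (forall u, 0 <= F u)%E ->
  (\int[P]_(w in path_of n @^-1` A) F (path_of n w) =
  \esum_(u in A) (F u *
    (if size u.2 == n then mass beta u.1 * wt pr u.1 u.2 else 0)%:E))%E.
Proof.
move=> F0; rewrite integral_fibers//; last 2 first.
- exact: countable_paths.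
- exact: measurable_path_fiber.
by apply: eq_esum => -[x s] _; rewrite -prob_path.
Qed.

Lemma prob_path_set n (A : set (S * seq S)) :
  P (path_of n @^-1` A) = (\esum_(u in A)
    (if size u.2 == n then mass beta u.1 * wt pr u.1 u.2 else 0)%:E)%E.
Proof.
rewrite -[LHS]mul1e -integral_cst; last exact: measurable_path.
rewrite (integral_path n (F := fun=> 1%E)) => [|_]; last exact: lee01.
by apply: eq_esum => u _; rewrite mul1e.
Qed.

(** [A] is contained in the event that the path of length [n] has weight 0, a countable union of
    null events. *)
Lemma traj_null n (A : set Omega) :
  (forall w, A w -> mass beta (X 0%N w) * wt pr (X 0%N w) (traj n w) = 0) ->
  measurable A -> P A = 0%E.
Proof.
move=> h mA; apply/eqP; rewrite -measure_le0.
apply: (@le_trans _ _ (P (path_of n @^-1`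
  [set u | mass beta u.1 * wt pr u.1 u.2 = 0]))).
  by apply: le_measure; rewrite ?inE//; exact: measurable_path.
rewrite prob_path_set esum1// => u /= ->.
by rewrite if_same.
Qed.

(** Only the first [m] steps are prescribed: the lower bound can leave the end of a path free. *)
Lemma prob_words_le m x (l : seq (seq S)) (A : set Omega) : measurable A ->
  uniq l -> all (fun s => size s == m) l ->
  (forall w, X 0%N w = x -> traj m w \in l -> A w) ->
  ((mass beta x * \sum_(s <- l) wt pr x s)%:E <= P A)%E.
Proof.
move=> mA ul sl h.
apply: (@le_trans _ _ (P (path_of m @^-1` [set u | u.1 = x /\ u.2 \in l]))); last first.
  apply: le_measure; rewrite ?inE//; first exact: measurable_path.
  by move=> w [/= wx wl]; exact: h.
rewrite prob_path_set mulr_sumr.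
pose a (u : S * seq S) : \bar R :=
  (if size u.2 == m then mass beta u.1 * wt pr u.1 u.2 else 0)%:E.
have a0 u : (0 <= a u)%E.
  rewrite lee_fin; case: ifP => // _; rewrite mulr_ge0 ?mass_ge0//.
  by apply: wt_ge0 => *; exact: pr_ge0.
apply: le_trans (le_sum_esum (s := [seq (x, s) | s <- l]) a0 _ _).
- rewrite big_map -sumEFin big_seq [leRHS]big_seq; apply: lee_sum => s sl'.
  by rewrite /a /= (allP sl _ sl').
- by rewrite map_inj_uniq// => s s' [].
- by move=> _ /mapP[s sl' ->].
Qed.

End path_law.

(** * Reachability and admissibility *)

Section reachability.
Context d (S : measurableType d) (R : realType) (beta : probability S R)
  (p : R.-pker S ~> S).
Hypothesis hS : discrete S.
Local Notation pr := (pr p).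
Local Notation reach := (reach p).
Local Notation init_reach := (init_reach beta p).

Lemma wt_gt0_edges x s : 0 < wt pr x s <->
  forall e, e \in edges x s -> 0 < pr e.1 e.2.
Proof.
elim: s x => [|y s IH] x; first by rewrite wt_nil; split.
rewrite wt_cons /=; split => [h e|h].
  have [ws0 ps0] : 0 < wt pr y s /\ 0 < pr x y.
    have p0 := pr_ge0 p x y; have w0 : 0 <= wt pr y s by apply: wt_ge0; exact: pr_ge0.
    move: h; rewrite !lt_neqAle p0 w0 !(eq_sym 0) mulf_eq0 negb_or.
    by rewrite mulr_ge0// !andbT => /andP[].
  by rewrite in_cons => /predU1P[->//|]; exact: (IH y).1.
rewrite mulr_gt0 ?(h (x, y)) ?mem_head//.
by apply/IH => e es; apply: h; rewrite in_cons es orbT.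
Qed.

Lemma reachP x y :
  reach x y <-> exists s, [/\ s != [::], last x s = y & 0 < wt pr x s].
Proof.
split=> [[n [z [n0 z0 zn zp]]]|[s [s0 sy /wt_gt0_edges ws]]].
  exists [seq z k | k <- iota 1 n]; split.
  - by case: n n0 {zn zp}.
  - rewrite -zn -z0; case: n n0 {zn zp} => // n _.
    by rewrite -[n.+1]addn1 iotaD map_cat last_cat /= add1n addn1.
  - apply/wt_gt0_edges => e; rewrite -z0 (edges_map z) => /mapP[k].
    rewrite mem_iota add0n => /andP[_ /zp + ->] /=.
    by rewrite (prE p hS) lte_fin.
exists (size s), (nth x (x :: s)); split => //.
- by case: s s0 {sy ws}.
- by rewrite -sy nth_last.
move=> i si; rewrite (prE p hS) lte_fin; apply: (ws (_, _)).
have -> : (nth x (x :: s) i, nth x (x :: s) i.+1) = nth (x, x) (edges x s) i.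
  by rewrite nth_edges.
by rewrite mem_nth// size_edges.
Qed.

Lemma reach_trans x y z : reach x y -> reach y z -> reach x z.
Proof.
move=> /reachP[s [s0 <- ws]] /reachP[t [t0 <- wt']]; apply/reachP.
exists (s ++ t); split; first by case: (s) s0.
  by rewrite last_cat.
by rewrite wt_cat mulr_gt0.
Qed.

Lemma reach1 x y : 0 < pr x y -> reach x y.
Proof.
by move=> xy; apply/reachP; exists [:: y]; rewrite wt_cons wt_nil mulr1.
Qed.

Lemma reach_word x s : 0 < wt pr x s -> last x s = x \/ reach x (last x s).
Proof.
move=> ws; have [->|s0] := eqVneq s [::]; first by left.
by right; apply/reachP; exists s.
Qed.

Lemma init_reach_trans x y : init_reach x -> reach x y -> init_reach y.
Proof.
move=> [bx|[z bz zx]] xy; right; first by exists x.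
by exists z => //; exact: reach_trans xy.
Qed.

(** Admissibility read on the charged edges instead of on classes. Mutual reachability of the two
    ends says that the edge lies inside one irreducible class. *)
Definition admissible_edges (mu : probability (S * S)%type R) :=
  [/\ forall e, 0 < mass mu e -> reach e.1 e.2 /\ reach e.2 e.1,
      forall e e', 0 < mass mu e -> 0 < mass mu e' ->
        reach e.1 e'.1 \/ reach e'.1 e.1
    & forall e, 0 < mass mu e -> init_reach e.1].

Definition class_of x : set S := [set z | reach x z /\ reach z x].

Lemma irr_class_of x : reach x x -> irr_class p (class_of x).
Proof.
move=> xx; split; first by exists x.
  by move=> y z [_ yx] [xz _]; exact: reach_trans xz.
move=> C' sub h; rewrite eqEsubset; split => // y C'y.
have C'x : C' x by exact: sub.
by split; exact: h.
Qed.

Lemma irr_class_eq C C' x : irr_class p C -> irr_class p C' -> C x -> C' x ->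
  C = C'.
Proof.
move=> [_ CC mC] [_ CC' mC'] Cx C'x.
have h : C `|` C' = C.
  apply: mC => [y|y z]; first by left.
  move=> [Cy|C'y] [Cz|C'z].
  - exact: CC.
  - exact: reach_trans (CC _ _ Cy Cx) (CC' _ _ C'x C'z).
  - exact: reach_trans (CC' _ _ C'y C'x) (CC _ _ Cx Cz).
  - exact: CC'.
have h' : C `|` C' = C'.
  apply: mC' => [y|y z]; first by right.
  move=> [Cy|C'y] [Cz|C'z].
  - exact: CC.
  - exact: reach_trans (CC _ _ Cy Cx) (CC' _ _ C'x C'z).
  - exact: reach_trans (CC' _ _ C'y C'x) (CC _ _ Cx Cz).
  - exact: CC'.
by rewrite -h [RHS](esym h').
Qed.

Lemma admissibleP mu : admissible beta p mu <-> admissible_edges mu.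
Proof.
have hS2 := discrete_prod hS; split.
  move=> [[J Jirr muJ] tot ini].
  have cls e : 0 < mass mu e -> exists C, [/\ C e.1, C e.2 & classes_of p mu C].
    move=> me; have mue : (0 < mu [set e])%E by rewrite (massE hS2) lte_fin.
    have [C [JC Ce]] : exists C, J C /\ (C `*` C) e.
      apply: contrapT => h; move: mue; rewrite muJ esum1 ?ltxx// => C JC.
      rewrite (_ : _ `&` _ = set0) ?measure0// eqEsubset; split => // u [Cu ue].
      by apply: h; exists C; rewrite -[e]ue.
    case: Ce => Ce1 Ce2; exists C; split => //; split; first exact: Jirr.
    apply: lt_le_trans mue _; apply: le_measure; rewrite ?inE.
    - exact: discrete_measurable.
    - exact: discrete_measurable.
    - by move=> u ->.
  split.
  - by move=> e /cls[C [C1 C2 [[_ CC _] _]]]; split; exact: CC.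
  - move=> e e' /cls[C [C1 C2 hC]] /cls[C' [C1' C2' hC']].
    have [[_ CC _] _] := hC; have [[_ CC' _] _] := hC'.
    have [[a [b [Ca Cb ab]]]|[a [b [Ca Cb ab]]]] := tot _ _ hC hC'.
      by left; exact: reach_trans (reach_trans (CC _ _ C1 Ca) ab) (CC' _ _ Cb C1').
    by right; exact: reach_trans (reach_trans (CC' _ _ C1' Ca) ab) (CC _ _ Cb C1).
  - move=> e /cls[C [C1 C2 hC]]; have [y Cy iy] := ini _ hC.
    have [[_ CC _] _] := hC.
    exact: init_reach_trans iy (CC _ _ Cy C1).
move=> [A1 A2 A3].
have cls C : classes_of p mu C -> exists e, [/\ C e.1, C e.2 & 0 < mass mu e].
  move=> [_ muC]; apply: contrapT => h; move: muC.
  rewrite (mass_esum hS2) esum1 ?ltxx// => e [C1 C2].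
  congr _%:E; apply/eqP; rewrite eq_le mass_ge0 andbT leNgt.
  by apply/negP => me; apply: h; exists e.
have clsof e : 0 < mass mu e -> classes_of p mu (class_of e.1) /\
    (class_of e.1 `*` class_of e.1) e.
  move=> me; have [e12 e21] := A1 _ me; have e11 := reach_trans e12 e21.
  split; last by split; split.
  split; first exact: irr_class_of.
  apply: (@lt_le_trans _ _ (mu [set e])); first by rewrite (massE hS2) lte_fin.
  apply: le_measure; rewrite ?inE; try exact: discrete_measurable.
  by move=> u -> ; split; split.
split.
- exists (classes_of p mu) => [C []//|A].
  rewrite (mass_esum hS2).
  rewrite [RHS](eq_esum (b := fun C => (\esum_(u in (C `*` C) `&` A) (mass mu u)%:E)%E)); last first.
    by move=> C _; exact: mass_esum.
  pose J C := (C `*` C) `&` A.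
  rewrite esum_esum; last by move=> *; rewrite lee_fin mass_ge0.
  (* Two irreducible classes with a common point are equal, so a pair (class, edge) is determined by
     its edge and the double sum is a sum over the union. An edge of positive mass lies in the class
     of its origin, so nothing is lost outside the union. *)
  rewrite -(@reindex_esum _ _ _ _ (\bigcup_(C in classes_of p mu) J C) snd
    (fun e => (mass mu e)%:E)); last first.
    split; first by move=> [C e] [/= hC Je]; exists C.
    - move=> [C [x y]] [C' [x' y']] /=; rewrite !inE => -[/= [hC _] [[Cx _] _]].
      move=> [/= [hC' _] [[C'x _] _]] [xx yy]; rewrite xx yy; congr (_, _).
      by apply: (irr_class_eq hC hC' Cx); rewrite xx.
    - by move=> e [C hC Je]; exists (C, e).
  rewrite [LHS]esum_mkcond [RHS]esum_mkcond; apply: eq_esum => e _.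
  case: ifPn => [|eA]; last first.
    rewrite ifF//; apply/negbTE; apply: contra eA; rewrite !inE.
    by move=> [C _ []].
  rewrite inE => Ae; case: ifPn => // he.
  congr _%:E; apply/eqP; rewrite eq_le mass_ge0 andbT leNgt.
  apply/negP => /clsof[c1 c2]; move/negP: he; apply; rewrite inE.
  by exists (class_of e.1).
- move=> C C' /[dup] hC /cls[e [C1 _ me]] /[dup] hC' /cls[e' [C1' _ me']].
  have [h|h] := A2 _ _ me me'; first by left; exists e.1, e'.1.
  by right; exists e'.1, e.1.
- by move=> C /cls[e [C1 _ /A3 i]]; exists e.1.
Qed.

Lemma edge_split x s (e : S * S) : e \in edges x s -> exists s1 s2,
  [/\ s = s1 ++ e.2 :: s2, last x s1 = e.1 &
   edges x s = edges x s1 ++ e :: edges e.2 s2].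
Proof.
elim: s x => [//|y s IH] x /=; rewrite in_cons => /predU1P[->|/IH].
  by exists [::], s.
by move=> [s1 [s2 [-> h1 h2]]]; exists (y :: s1), s2; rewrite h2.
Qed.

Lemma wt_split x s (e : S * S) : 0 < wt pr x s -> e \in edges x s -> exists s1 s2,
  [/\ edges x s = edges x s1 ++ e :: edges e.2 s2, last x s1 = e.1,
   last e.2 s2 = last x s & [/\ 0 < wt pr x s1, 0 < pr e.1 e.2 & 0 < wt pr e.2 s2]].
Proof.
move=> ws /edge_split[s1 [s2 [sE h1 h2]]]; exists s1, s2; split => //.
  by rewrite sE last_cat.
move/wt_gt0_edges: ws => ws; split; rewrite ?wt_gt0_edges.
- by move=> f f1; apply: ws; rewrite h2 mem_cat f1.
- by apply: ws; rewrite h2 mem_cat mem_head orbT.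
- by move=> f f1; apply: ws; rewrite h2 mem_cat in_cons f1 !orbT.
Qed.

Lemma init_reach_word x s e : 0 < mass beta x -> 0 < wt pr x s ->
  e \in edges x s -> init_reach e.1.
Proof.
move=> bx ws /(wt_split ws)[s1 [s2 [_ <- _ [w1 _ _]]]].
have ix : init_reach x by left; rewrite (massE hS) lte_fin.
by have [->//|] := reach_word w1; exact: init_reach_trans.
Qed.

Lemma edge_reach_last x s e : 0 < wt pr x s -> e \in edges x s ->
  e.2 = last x s \/ reach e.2 (last x s).
Proof.
move=> ws /(wt_split ws)[s1 [s2 [_ _ <- [_ _ w2]]]].
by have [->|] := reach_word w2; [left|right].
Qed.

Lemma edge_reach1_last x s e : 0 < wt pr x s -> e \in edges x s ->
  reach e.1 (last x s).
Proof.
move=> ws es; have [s1 [s2 [_ _ _ [_ h _]]]] := wt_split ws es.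
by have [<-|] := edge_reach_last ws es; [|apply: reach_trans]; exact: reach1.
Qed.

(** Along the word one of the two edges is traversed before the other. *)
Lemma comparable_word x s e e' : 0 < wt pr x s -> e' != e ->
  e \in edges x s -> e' \in edges x s -> reach e.1 e'.1 \/ reach e'.1 e.1.
Proof.
move=> ws ee' /(wt_split ws)[s1 [s2 [-> h1 _ [w1 h w2]]]].
rewrite mem_cat in_cons (negbTE ee')/= => /orP[e1|/(wt_split w2)].
  by right; rewrite -h1; exact: edge_reach1_last.
move=> [t1 [t2 [_ <- _ [v1 _ _]]]]; left.
by have [->|] := reach_word v1; [|apply: reach_trans]; exact: reach1.
Qed.

Lemma reach_repeat x s e : 0 < wt pr x s -> (1 < count_mem e (edges x s))%N ->
  reach e.2 e.1.
Proof.
move=> ws ce; have es : e \in edges x s by rewrite -has_pred1 has_count ltnW.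
have [s1 [s2 [E h1 _ [w1 h w2]]]] := wt_split ws es.
(* The word between two occurrences may be empty; then [e] is a self-loop, and it is itself the step
   witnessing [reach]. *)
have loop : e.2 = e.1 \/ reach e.2 e.1 -> reach e.2 e.1.
  by move=> [e21|//]; rewrite e21; apply: reach1; rewrite -[X in pr _ X]e21.
apply: loop; move: ce; rewrite E count_cat /= eqxx add1n addnS ltnS.
rewrite addn_gt0 -!has_count !has_pred1 => /orP[e1|/(wt_split w2)].
  by rewrite -h1; exact: edge_reach_last.
move=> [t1 [t2 [_ <- _ [v1 _ _]]]].
by have [->|] := reach_word v1; [left|right].
Qed.

End reachability.

Lemma near_invn (R : realType) (a : R) : 0 < a ->
  \forall n \near \oo, n.+1%:R^-1 <= a.
Proof.
move=> a0; exists (Num.truncn a^-1).+1 => // n /= hn.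
rewrite -[leRHS]invrK lef_pV2 ?posrE ?invr_gt0//.
have := truncnS_gt a^-1; move/ltW/le_trans; apply.
by rewrite ler_nat (leq_trans hn).
Qed.

(** * Neighborhoods of measures that are not admissible or not balanced *)

Section far.
Context dO (Omega : measurableType dO) d (S : measurableType d) (R : realType).
Variables (P : probability Omega R) (beta : probability S R) (p : R.-pker S ~> S).
Variable X : nat -> {RV P >-> S}.
Hypotheses (hS : discrete S) (hX : markov_chain beta p X).
Local Notation prob2 := (probability (S * S)%type R).
Local Notation wprob2 := (weak_prob (S * S)%type R).

Let hS2 := discrete_prod hS.

Lemma mass_near (mu : wprob2) e (a : R) : 0 < a ->
  nbhs mu [set nu : wprob2 | `|mass nu e - mass mu e| < a].
Proof.
move=> a0; have := pairing_near mu (bounded_fun_indic _ [set e]) a0.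
by apply: filterS => nu /=; rewrite !(pairing_indic hS2).
Qed.

Lemma mass_L2 n w e : mass (L2 X n w) e =
  n.+1%:R^-1 * (count_mem e (edges (X 0%N w) (traj X n.+1 w)))%:R.
Proof.
rewrite /mass -(pairing_indic hS2) pairing_L2//; last exact: bounded_fun_indic.
congr (_ * _); rewrite /vsum; elim: (edges _ _) => [|f l IH]; first by rewrite big_nil.
by rewrite big_cons IH indicE in_set1 /= natrD.
Qed.

(** A single passage contributes only [n.+1%:R^-1], which is eventually at most [a]. *)
Lemma near_mass_repeat e (a : R) : 0 < a -> \forall n \near \oo, forall w,
  a < mass (L2 X n w) e -> (1 < count_mem e (edges (X 0%N w) (traj X n.+1 w)))%N.
Proof.
move=> a0; near=> n => w; rewrite mass_L2 => h; rewrite ltnNge; apply/negP => h1.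
move: h; apply/negP; rewrite -leNgt.
apply: (@le_trans _ _ n.+1%:R^-1); last by near: n; exact: near_invn.
by rewrite ler_piMr ?invr_ge0// lern1.
Unshelve. all: by end_near. Qed.

Lemma good_path_null n (A : set Omega) : measurable A ->
  (forall w, A w -> 0 < mass beta (X 0%N w) ->
    0 < wt (pr p) (X 0%N w) (traj X n w) -> False) -> P A = 0%E.
Proof.
move=> mA h; apply: (traj_null hS hX (n := n)) => // w Aw.
have [b0|b0] := eqVneq (mass beta (X 0%N w)) 0; first by rewrite b0 mul0r.
have [->|w0] := eqVneq (wt (pr p) (X 0%N w) (traj X n w)) 0; first by rewrite mulr0.
exfalso; apply: (h w Aw); rewrite lt_neqAle eq_sym ?b0 ?w0 ?mass_ge0//.
by apply: wt_ge0; exact: pr_ge0.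
Qed.

(** The two properties of [U] serve different ends: missing [adm_bal] gives lower semicontinuity of
    [I2] at [mu], and the null probabilities give the upper bound. *)
Definition unreachable_near (mu : wprob2) := exists U : set wprob2,
  [/\ nbhs mu U, forall nu, U nu -> ~ adm_bal beta p nu &
      \forall n \near \oo, P (L2 X n @^-1` U) = 0%E].

(** Paired with [L2 X n w], the difference [V] of the two indicators telescopes along the path, so
    it is at most [n.+1%:R^-1] in absolute value. It is 0 on balanced measures and nonzero at [mu];
    half its value at [mu] separates them. *)
Lemma unbalanced_near (mu : wprob2) : ~ balanced mu -> unreachable_near mu.
Proof.
move=> /existsNP[A hA].
pose V (u : S * S) : R := \1_(A `*` setT) u + -1 * \1_(setT `*` A) u.
have bV : bounded_fun V.
  apply: bounded_funD; first exact: bounded_fun_indic.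
  by apply: bounded_funZ; exact: bounded_fun_indic.
have pV (nu : prob2) : pairing nu V = fine (nu (A `*` setT)) - fine (nu (setT `*` A)).
  rewrite pairingD//; last by apply: bounded_funZ; exact: bounded_fun_indic.
    by rewrite pairingZ ?pairing_indic// ?mulN1r//; exact: bounded_fun_indic.
  exact: bounded_fun_indic.
have a0 : 0 < `|pairing mu V| / 2.
  rewrite divr_gt0// normr_gt0 pV subr_eq0; apply/eqP => h; apply: hA.
  rewrite -[LHS]fineK ?h ?fineK//; apply: fin_num_measure; exact: discrete_measurable.
exists [set nu | `|pairing nu V - pairing mu V| < `|pairing mu V| / 2]; split.
- exact: pairing_near.
- move=> nu /= h [_ bal]; move: h.
  have -> : pairing nu V = 0.
    by rewrite pV; apply/eqP; rewrite subr_eq0; apply/eqP; congr fine; exact: bal.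
  rewrite sub0r normrN.
  by rewrite ltNge ler_pdivrMr// ler_peMr ?ler1n.
near=> n.
have hn : n.+1%:R^-1 <= `|pairing mu V| / 2 / 2.
  by near: n; apply: near_invn; rewrite divr_gt0.
rewrite (_ : _ @^-1` _ = set0) ?measure0//.
rewrite eqEsubset; split => // w /=.
have -> : pairing (L2 X n w) V = n.+1%:R^-1 * (\1_A (X 0%N w) - \1_A (X n.+1 w)).
  rewrite pairing_L2//; congr (_ * _); rewrite /vsum edges_traj big_map.
  rewrite -[iota 0 _]/(index_iota 0 n.+1).
  pose f k : R := - \1_A (X k w).
  rewrite (eq_bigr (fun k => f k.+1 - f k)) => [|k _].
    by rewrite telescope_sumr// /f opprK addrC.
  rewrite /V /f !indicE opprK addrC.
  by rewrite !in_setX !in_setT andbT mulN1r.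
set t := _ * _ => h.
have : `|t| <= n.+1%:R^-1.
  rewrite /t normrM ger0_norm ?invr_ge0// ler_piMr ?invr_ge0// !indicE.
  by case: (X 0%N w \in A); case: (X n.+1 w \in A);
    rewrite ?subrr ?subr0 ?sub0r ?normrN ?normr0 ?normr1.
move=> ht; exfalso; have : `|pairing mu V| <= `|t| + `|t - pairing mu V|.
  by rewrite -{1}(subKr t (pairing mu V)) ler_normB.
have := normr_ge0 (t - pairing mu V); move: h ht hn.
move: (`|t|) (`|t - pairing mu V|) (`|pairing mu V|) (n.+1%:R^-1) => a b c e.
lra.
Unshelve. all: by end_near. Qed.

Lemma inadmissible_near (mu : wprob2) : ~ admissible beta p mu -> unreachable_near mu.
Proof.
move=> nA.
(* Near [mu], an edge charged by [mu] keeps half its mass, hence is traversed at least twice. Each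
   way of failing admissibility then contradicts what one path of positive weight can do. *)
have far1 e : 0 < mass mu e -> exists U : set wprob2,
    [/\ nbhs mu U, (forall nu, U nu -> 0 < mass nu e) &
      \forall n \near \oo, forall w, U (L2 X n w) ->
      (1 < count_mem e (edges (X 0%N w) (traj X n.+1 w)))%N].
  move=> me; have me2 : 0 < mass mu e / 2 by exact: divr_gt0.
  have hU nu : `|mass nu e - mass mu e| < mass mu e / 2 -> mass mu e / 2 < mass nu e.
    by rewrite ltr_norml => /andP[+ _]; lra.
  exists [set nu : wprob2 | `|mass nu e - mass mu e| < mass mu e / 2]; split.
  - exact: mass_near.
  - by move=> nu /hU; exact: lt_trans.
  - by have := near_mass_repeat e me2; apply: filterS => n h w /hU; exact: h.
have [A1|] := pselect (forall e, 0 < mass mu e -> reach p e.1 e.2 /\ reach p e.2 e.1);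
  last first.
  move=> /existsNP[e /not_implyP[me hr]].
  have [U [nU Um UL]] := far1 e me; exists U; split => //.
    by move=> nu /Um m0 [/(admissibleP _ _ hS)[/(_ _ m0)]].
  move: UL; apply: filterS => n UL; apply: (good_path_null (n := n.+1)).
    exact: measurable_L2.
  move=> w /UL c b0 w0; apply: hr; split; last exact: reach_repeat c.
  have ew : e \in edges (X 0%N w) (traj X n.+1 w).
    by rewrite -has_pred1 has_count ltnW.
  by apply: (reach1 hS); exact: (wt_gt0_edges p _ _).1 w0 _ ew.
have [A2|] := pselect (forall e e', 0 < mass mu e -> 0 < mass mu e' ->
        reach p e.1 e'.1 \/ reach p e'.1 e.1); last first.
  move=> /existsNP[e /existsNP[e' /not_implyP[me /not_implyP[me' hr]]]].
  have [U [nU Um UL]] := far1 e me; have [U' [nU' Um' UL']] := far1 e' me'.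
  exists (U `&` U'); split; first exact: filterI.
    by move=> nu [/Um m0 /Um' m0'] [/(admissibleP _ _ hS)[_ /(_ _ _ m0 m0')]].
  move: UL UL'; apply: filterS2 => n UL UL'; apply: (good_path_null (n := n.+1)).
    exact: measurable_L2.
  move=> w [/UL c /UL' c'] b0 w0; apply: hr.
  have [->|ee'] := eqVneq e' e.
    by left; have [] := A1 _ me; exact: reach_trans.
  by apply: (comparable_word hS w0) => //; rewrite -has_pred1 has_count ltnW.
have : ~ forall e, 0 < mass mu e -> init_reach beta p e.1.
  by move=> A3; apply: nA; apply/(admissibleP _ _ hS).
move=> /existsNP[e /not_implyP[me hr]].
have [U [nU Um UL]] := far1 e me; exists U; split => //.
  by move=> nu /Um m0 [/(admissibleP _ _ hS)[_ _ /(_ _ m0)]].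
move: UL; apply: filterS => n UL; apply: (good_path_null (n := n.+1)).
  exact: measurable_L2.
move=> w /UL c b0 w0; apply: hr; apply: (init_reach_word hS b0 w0).
by rewrite -has_pred1 has_count ltnW.
Qed.

Lemma not_adm_bal_near (mu : wprob2) : ~ adm_bal beta p mu -> unreachable_near mu.
Proof.
by move=> /not_andP[/inadmissible_near|/unbalanced_near].
Qed.

End far.

(** * The upper bound *)

Section mul_lne.
Local Open Scope ereal_scope.
Context {R : realType}.
Implicit Types (x : \bar R) (b : R).

Lemma mul_lne_le n x b : 0 <= x ->
  ((n.+1%:R^-1)%:E * lne x <= b%:E) = (x <= (expR (n.+1%:R * b))%:E).
Proof.
have n0 : (0 < n.+1%:R^-1 :> R)%R by rewrite invr_gt0 ltr0n.
case: x => [r| |]//; last by rewrite /= gt0_muley ?lte_fin// leye_eq.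
rewrite lee_fin le_eqVlt => /predU1P[<-|r0].
  by rewrite le0_lneNy// gt0_muleNy ?lte_fin// leNye lee_fin expR_ge0.
rewrite lne_EFin// -EFinM !lee_fin ler_pdivrMl ?ltr0n//.
by rewrite -ler_expR lnK.
Qed.

Lemma le_mul_lne n x b :
  0 <= x -> (b%:E <= (n.+1%:R^-1)%:E * lne x) = ((expR (n.+1%:R * b))%:E <= x).
Proof.
have n0 : (0 < n.+1%:R^-1 :> R)%R by rewrite invr_gt0 ltr0n.
case: x => [r| |]//; last by rewrite /= gt0_muley ?lte_fin// !leey.
rewrite lee_fin le_eqVlt => /predU1P[<-|r0].
  rewrite le0_lneNy// gt0_muleNy ?lte_fin// leeNy_eq/= lee_fin.
  by rewrite leNgt expR_gt0.
rewrite lne_EFin// -EFinM !lee_fin ler_pdivlMl ?ltr0n//.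
by rewrite -ler_expR lnK.
Qed.

Lemma near_expR_ge (C a : R) : (0 < a)%R ->
  \forall n \near \oo, (C <= expR (n.+1%:R * a))%R.
Proof.
move=> a0; have C0 : (0 < `|C| + 1)%R by rewrite ltr_wpDl.
apply: filterS (near_invn (divr_gt0 a0 C0)) => n na.
apply: le_trans (expR_ge1Dx _).
apply: (@le_trans _ _ (`|C| + 1)%R); first by rewrite (le_trans (ler_norm _))// lerDl.
rewrite addrC -[leRHS]add0r -subr_ge0.
move: na; rewrite ler_pdivlMr// ler_pdivrMl ?ltr0n//; lra.
Qed.

End mul_lne.

Section upper_bound.
Local Open Scope ereal_scope.
Context dO (Omega : measurableType dO) d (S : measurableType d) (R : realType).
Variables (P : probability Omega R) (beta : probability S R) (p : R.-pker S ~> S).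
Variable X : nat -> {RV P >-> S}.
Hypotheses (hS : discrete S) (hX : markov_chain beta p X).
Local Notation wprob2 := (weak_prob (S * S)%type R).
Implicit Types (A B : set wprob2) (c : R).

Let hS2 := discrete_prod hS.

(** Exponential rate at most [c], unfolded into bounds on probabilities at fixed [n], which can be
    added. *)
Definition exp_small A c := forall a : R, (c < a)%R ->
  \forall n \near \oo, P (L2 X n @^-1` A) <= (expR (n.+1%:R * a))%:E.

Lemma exp_smallP A c : exp_small A c <->
  limn_esup (fun n => (n.+1%:R^-1)%:E * lne (P (L2 X n @^-1` A))) <= c%:E.
Proof.
split=> [h|h a ca].
  apply: ge_limn_esup => a; rewrite lte_fin => /h; apply: filterS => n.
  by rewrite mul_lne_le.
have /limn_esup_lt_near : limn_esup (fun n =>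
    (n.+1%:R^-1)%:E * lne (P (L2 X n @^-1` A))) < a%:E.
  by apply: le_lt_trans h _; rewrite lte_fin.
by apply: filterS => n /ltW; rewrite mul_lne_le.
Qed.

Lemma exp_small_sub A B c : A `<=` B -> exp_small B c -> exp_small A c.
Proof.
move=> AB h a /h; apply: filterS => n; apply: le_trans.
apply: le_measure; rewrite ?inE; try exact: measurable_L2.
by move=> w; exact: AB.
Qed.

Lemma exp_smallU A B c : exp_small A c -> exp_small B c -> exp_small (A `|` B) c.
Proof.
(* Half of the gap bounds each probability; the other half makes [expR (n.+1%:R * (a - b))] at least
   2 and absorbs the number of sets. *)
move=> hA hB a ca; pose b := ((c + a) / 2)%R.
have [cb ba] : (c < b /\ 0 < a - b)%R.
  by rewrite subr_gt0; split; rewrite /b ?midf_lt//; lra.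
near=> n.
have An : P (L2 X n @^-1` A) <= (expR (n.+1%:R * b))%:E by near: n; exact: hA.
have Bn : P (L2 X n @^-1` B) <= (expR (n.+1%:R * b))%:E by near: n; exact: hB.
have n2 : (2 <= expR (n.+1%:R * (a - b)))%R by near: n; exact: near_expR_ge.
rewrite preimage_setU; apply: (@le_trans _ _ (P (L2 X n @^-1` A) + P (L2 X n @^-1` B))).
  by apply: measureU2; exact: measurable_L2.
apply: le_trans (leeD An Bn) _.
rewrite -EFinD lee_fin -[a](subrK b) mulrDr expRD.
have : (0 <= expR (n.+1%:R * b))%R by exact: expR_ge0.
move: (expR (n.+1%:R * b)) n2 => x n2 x0.
by apply: (@le_trans _ _ (2 * x)%R); [lra|rewrite ler_wpM2r].
Unshelve. all: by end_near. Qed.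

Lemma exp_small0 c : exp_small set0 c.
Proof.
by move=> a _; near=> n; rewrite preimage_set0 measure0 lee_fin expR_ge0.
Unshelve. all: by end_near. Qed.

(** A finite subcover argument in filter form: if [K] is not small, the sets [A] with [K] minus [A]
    small form a proper filter, and a small neighborhood of one of its cluster points gives the
    contradiction. *)
Lemma exp_small_compact (K : set wprob2) c : compact K ->
  (forall mu, K mu -> exists2 U, nbhs mu U & exp_small U c) -> exp_small K c.
Proof.
move=> cK loc; apply: contrapT => nK.
pose F : set_system wprob2 := [set A | exp_small (K `\` A) c].
have FF : ProperFilter F.
  split; first by rewrite /F /= setD0.
  split.
  - by rewrite /F /= setDT; exact: exp_small0.
  - by move=> A B; rewrite /F /= setDIr; exact: exp_smallU.
  - by move=> A B AB; apply: exp_small_sub; exact: setDS.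
have FK : F K by rewrite /F /= setDv; exact: exp_small0.
have [mu [Kmu clmu]] := cK F FF FK.
have [U nU sU] := loc mu Kmu.
have FU : F (~` U).
  by apply: exp_small_sub sU => nu [_ /= /contrapT].
by have [nu []] := clmu _ _ FU nU.
Qed.

Lemma prob_L2_lt (V : S * S -> R) (b : R) n : bounded_fun V ->
  (expR (n.+1%:R * b))%:E * P (L2 X n @^-1` [set nu | b <= pairing nu V]%R) <=
  'E_P[fun w => (expR (n.+1%:R * pairing (L2 X n w) V))%R].
Proof.
move=> bV; rewrite unlock; set A := L2 X n @^-1` _.
have mA : measurable A by exact: measurable_L2.
rewrite -integral_cst//; apply: (@le_trans _ _
  (\int[P]_(w in A) (expR (n.+1%:R * pairing (L2 X n w) V))%:E)).
  apply: ge0_le_integral => //.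
  - by move=> w _; rewrite lee_fin expR_ge0.
  - move=> _ B _; apply: measurableI => //.
    exact: (measurable_L2 hS X n [set nu | B (expR (n.+1%:R * pairing nu V))%:E]).
  - by move=> w Aw; rewrite lee_fin ler_expR ler_wpM2l.
apply: ge0_subset_integral => // _ B _; apply: measurableI => //.
exact: (measurable_L2 hS X n [set nu | B (expR (n.+1%:R * pairing nu V))%:E]).
Qed.

Lemma exp_small_chebyshev (V : S * S -> R) (b c : R) : bounded_fun V ->
  Lambda2 X V < (b + c)%:E -> exp_small [set nu | b <= pairing nu V]%R c.
Proof.
move=> bV /limn_esup_lt_near h a ca; move: h; apply: filterS => n.
move=> /ltW; rewrite mul_lne_le; last first.
  by apply: expectation_ge0 => w; exact: expR_ge0.
move=> /(le_trans (prob_L2_lt b n bV)); rewrite mulrDr expRD EFinM.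
rewrite lee_pmul2l ?fin_numE// ?lte_fin ?expR_gt0// => /le_trans; apply.
by rewrite lee_fin ler_expR ler_wpM2l// ltW.
Qed.

(** Part of the strict gap goes into [b < pairing mu V], so that [b <= pairing nu V] defines a
    neighborhood of [mu] to which Chebyshev's inequality applies. *)
Lemma Lambda2_conj_gt (mu : wprob2) c : c%:E < Lambda2_conj X mu ->
  exists (V : S * S -> R) (b : R), [/\ bounded_fun V, (b < pairing mu V)%R &
    Lambda2 X V < (b - c)%:E].
Proof.
move=> /ereal_sup_gt[_ [V bV <-]] h.
have /lte_real_dense[b /andP[Lb bp]] : Lambda2 X V + c%:E < (pairing mu V)%:E.
  case: (Lambda2 X V) h => [r| |]//; last by move=> _; rewrite addNye ltNyr.
  by rewrite -EFinB -EFinD !lte_fin; lra.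
exists V, b; split; [exact: bV|by move: bp; rewrite lte_fin|].
case: (Lambda2 X V) Lb => [r| |]//; last by move=> _; exact: ltNyr.
by rewrite -EFinD !lte_fin; lra.
Qed.

Lemma exp_small_nbhs (mu : wprob2) c : c%:E < I2 beta p X mu ->
  exists2 U, nbhs mu U & exp_small U (- c).
Proof.
rewrite /I2; case: asboolP => [_ /Lambda2_conj_gt[V [b [bV bp LV]]]|na _].
  exists [set nu | b <= pairing nu V]%R; last exact: exp_small_chebyshev.
  have := pairing_near mu bV (_ : 0 < pairing mu V - b)%R.
  rewrite subr_gt0 => /(_ bp); apply: filterS => nu /=.
  by rewrite ltr_norml => /andP[+ _]; lra.
have [U [nU _ UL]] := not_adm_bal_near hS hX na.
exists U => // a _; move: UL; apply: filterS => n ->.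
by rewrite lee_fin expR_ge0.
Qed.

(** On [adm_bal] the function is a supremum of continuous functions of [mu]; the points outside have
    a neighborhood where it is infinite. *)
Lemma I2_lsc : lower_semicontinuous (I2 beta p X : wprob2 -> _).
Proof.
move=> mu c; rewrite {1}/I2; case: asboolP => [_ /Lambda2_conj_gt[V [b [bV bp LV]]]|na _].
  exists [set nu : wprob2 | b <= pairing nu V]%R.
    have := pairing_near mu bV (_ : 0 < pairing mu V - b)%R.
    rewrite subr_gt0 => /(_ bp); apply: filterS => nu /=.
    by rewrite ltr_norml => /andP[+ _]; lra.
  move=> nu /= bnu; rewrite /I2; case: ifP => _; last exact: ltry.
  apply: (@lt_le_trans _ _ ((pairing nu V)%:E - Lambda2 X V)); last first.
    by apply: ereal_sup_ubound; exists V.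
  case: (Lambda2 X V) LV => [r| |]//; last by move=> _; exact: ltry.
  by rewrite -EFinB !lte_fin; lra.
have [U [nU nadm _]] := not_adm_bal_near hS hX na.
exists U => // nu /nadm nu_na; rewrite /I2; case: asboolP => // _; exact: ltry.
Qed.

Lemma Lambda2_cst0 : Lambda2 X (cst 0%R) = 0.
Proof.
rewrite /Lambda2 (_ : (fun _ => _) = cst 0).
  exact: (cvg_limn_einf_sup (cvg_cst _)).2.
apply/funext => n; rewrite (_ : (fun _ => _) = cst 1%R).
  by rewrite expectation_cst lne1 mule0.
by apply/funext => w; rewrite pairing_cst mulr0 expR0.
Qed.

Lemma I2_ge0 mu : 0 <= I2 beta p X mu.
Proof.
rewrite /I2; case: ifP => // _; apply: ereal_sup_ubound; exists (cst 0%R).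
  exact: bounded_fun_cst.
by rewrite Lambda2_cst0 pairing_cst sube0.
Qed.

Lemma compact_upper_bound (K : set wprob2) : compact K ->
  limn_esup (fun n => (n.+1%:R^-1)%:E * lne (P (L2 X n @^-1` K)))
          <= - ereal_inf (I2 beta p X @` K).
Proof.
move=> cK; rewrite leeNr leNgt; apply/negP => /lte_real_dense[c /andP[Lc cI]].
move: Lc; rewrite lteNl; apply/negP; rewrite -leNgt -EFinN; apply/exp_smallP.
apply: exp_small_compact => // mu Kmu; apply: exp_small_nbhs.
by apply: lt_le_trans cI _; apply: ereal_inf_lbound; exists mu.
Qed.

End upper_bound.

(** * The Feynman-Kac functional of log f / Pf *)

Lemma ler_sum_subseq (R : numDomainType) (T : eqType) (F : T -> R) (l l' : seq T) :
  (forall i, 0 <= F i) -> uniq l -> {subset l <= l'} ->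
  \sum_(i <- l) F i <= \sum_(i <- l') F i.
Proof.
move=> F0; elim: l l' => [|a l IH] l' /=; first by rewrite big_nil sumr_ge0.
move=> /andP[al ul] ll'; have al' : a \in l' by apply: ll'; rewrite mem_head.
rewrite big_cons (perm_big _ (perm_to_rem al')) big_cons lerD2l; apply: IH => // x xl.
have : x \in l' by apply: ll'; rewrite in_cons xl orbT.
rewrite (perm_mem (perm_to_rem al')) in_cons => /predU1P[xa|//].
by move: al; rewrite -xa xl.
Qed.

Section path_sums.
Context (S : choiceType) (R : realType).
Variable q : S -> S -> R.
Hypotheses (q0 : forall x y, 0 <= q x y)
  (q1 : forall x (l : seq S), uniq l -> \sum_(y <- l) q x y <= 1).

(** Enlarging [l] to all combinations of one of its heads with one of its tails makes the sum factor
    through the first step, whatever the shape of [l]. *)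
Lemma sum_wt_le1 n x (l : seq (seq S)) : uniq l -> all (fun s => size s == n) l ->
  \sum_(s <- l) wt q x s <= 1.
Proof.
elim: n x l => [|n IH] x l ul sl.
  apply: (@le_trans _ _ (\sum_(s <- [:: [::]]) wt q x s)).
    apply: ler_sum_subseq => // [s|s /(allP sl)]; first exact: wt_ge0.
    by case: s.
  by rewrite big_seq1 wt_nil.
pose H := undup (map (head x) l); pose T := undup (map behead l).
apply: (@le_trans _ _ (\sum_(s <- [seq y :: t | y <- H, t <- T]) wt q x s)).
  apply: ler_sum_subseq => // [s|s ls]; first exact: wt_ge0.
  have := allP sl _ ls; case: s ls => // y t ls _.
  by apply: allpairs_f; rewrite mem_undup; apply/mapP; exists (y :: t).
rewrite big_allpairs_dep (le_trans _ (q1 x (undup_uniq (map (head x) l))))//.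
apply: ler_sum => y _; under eq_bigr do rewrite wt_cons.
rewrite -mulr_sumr ler_piMr// IH ?undup_uniq//.
apply/allP => t; rewrite mem_undup => /mapP[s /(allP sl) /eqP ss ->].
by rewrite size_behead ss.
Qed.

Lemma esum_paths_le1 (b : S -> R) n : (forall x, 0 <= b x) ->
  (forall l : seq S, uniq l -> \sum_(x <- l) b x <= 1) ->
  (\esum_(u in [set u : S * seq S | size u.2 == n])
    (b u.1 * wt q u.1 u.2)%:E <= 1)%E.
Proof.
move=> b0 b1; apply: esum_le_seq => l ul sl; rewrite sumEFin lee_fin.
pose H := undup (map fst l); pose T := undup (map snd l).
apply: (@le_trans _ _ (\sum_(u <- [seq (y, t) | y <- H, t <- T]) b u.1 * wt q u.1 u.2)).
  apply: ler_sum_subseq => // [u|[y t] ls]; first by rewrite mulr_ge0// wt_ge0.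
  by apply: allpairs_f; rewrite mem_undup; apply/mapP; exists (y, t).
rewrite big_allpairs (le_trans _ (b1 _ (undup_uniq (map fst l))))//.
apply: ler_sum => y _ /=.
rewrite -mulr_sumr ler_piMr// (@sum_wt_le1 n) ?undup_uniq//.
by apply/allP => t; rewrite mem_undup => /mapP[s /sl /= ss ->].
Qed.

End path_sums.

Section log_ratio.
Context dO (Omega : measurableType dO) d (S : measurableType d) (R : realType).
Variables (P : probability Omega R) (beta : probability S R) (p : R.-pker S ~> S).
Variable X : nat -> {RV P >-> S}.
Hypotheses (hS : discrete S) (hX : markov_chain beta p X).
Let hS2 := discrete_prod hS.
Variables (f : S * S -> R) (a b : R).
Hypotheses (a0 : 0 < a) (hf : forall u, a <= f u <= b).

Definition log_ratio (u : S * S) : R := ln (f u / Pop p f u).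

(** [Pop p f (x, y)] depends on [y] only; this is that function, whose ratios telescope along a
    path. *)
Let g y := pairing (pker p y) (fun z => f (y, z)).

Let f0 u : 0 < f u. Proof. by case/andP: (hf u) => /(lt_le_trans a0). Qed.

Let bf y : bounded_fun (fun z => f (y, z)).
Proof.
have b0 : 0 < b by have /andP[/(le_trans) h /h/(lt_le_trans a0)] := hf point.
by apply/bounded_funP; exists b => // z; rewrite gtr0_norm//; case/andP: (hf (y, z)).
Qed.

Lemma Pop_bounds u : a <= Pop p f u <= b.
Proof.
rewrite -[Pop p f u]/(g u.2) /g; apply/andP; split.
  rewrite -[leLHS](pairing_cst (pker p u.2) a); apply: le_pairing => //.
    exact: bounded_fun_cst.
  by move=> z; case/andP: (hf (u.2, z)).
rewrite -[leRHS](pairing_cst (pker p u.2) b); apply: le_pairing => //.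
  exact: bounded_fun_cst.
by move=> z; case/andP: (hf (u.2, z)).
Qed.

Let g0 y : 0 < g y.
Proof. by have /andP[/(lt_le_trans a0)] := Pop_bounds (y, y). Qed.

Lemma bounded_log_ratio : bounded_fun log_ratio.
Proof.
have ba : 1 <= b / a.
  by rewrite ler_pdivlMr// mul1r; have /andP[/le_trans] := hf point; apply.
apply/bounded_funP; exists (ln (b / a) + 1); first by rewrite ltr_wpDl// ln_ge0.
move=> u; rewrite /log_ratio; have /andP[l1 l2] := Pop_bounds u.
have P0 := lt_le_trans a0 l1; have /andP[f1 f2] := hf u.
have b0 := lt_le_trans P0 l2.
rewrite ler_wpDr// ler_norml -lnV ?posrE ?divr_gt0// !ler_ln ?posrE ?invr_gt0 ?divr_gt0//.
rewrite invf_div; apply/andP; split.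
  by apply: ler_pM; rewrite ?invr_ge0 ?(ltW a0) ?(ltW b0) ?lef_pV2 ?posrE.
by apply: ler_pM; rewrite ?invr_ge0 ?(ltW P0) ?(ltW (f0 u)) ?lef_pV2 ?posrE.
Qed.

(* The kernel p(x,y) f(x,y) / g(x) is a Markov kernel, and the product of the
   ratios f / Pf along a path telescopes to a density with respect to it. *)
Let q x y := pr p x y * f (x, y) / g x.

Lemma log_ratio_wt x s :
  expR (vsum log_ratio x s) * wt (pr p) x s = wt q x s * (g x / g (last x s)).
Proof.
elim: s x => [|y s IH] x /=.
  by rewrite /vsum big_nil expR0 !wt_nil mulfV// gt_eqF.
rewrite /vsum big_cons expRD lnK; last by rewrite posrE divr_gt0//; exact: g0.
rewrite -[Pop p f (x, y)]/(g y) !wt_cons.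
transitivity (f (x, y) / g y * pr p x y *
  (expR (\sum_(e <- edges y s) log_ratio e) * wt (pr p) y s)); first by ring.
rewrite IH /q; field.
by rewrite !gt_eqF.
Qed.

Lemma sum_q_le1 x (l : seq S) : uniq l -> \sum_(y <- l) q x y <= 1.
Proof.
move=> ul; rewrite -mulr_suml ler_pdivrMr// mul1r.
have h : 0 + \sum_(y <- l) (f (x, y) - 0) * mass (pker p x) y <= g x.
  by apply: (@pairing_ge_off _ _ _ hS _ _ l (fun y => f (x, y)) 0) => // u _; exact: ltW.
apply: le_trans h; rewrite add0r; apply: ler_sum => y _.
by rewrite subr0 mulrC.
Qed.

(** After the change of kernel only the boundary factor [g x / g (last x s)] remains. It is at most
    [b / a] whatever [n], so it disappears at the exponential scale. *)
Lemma expectation_log_ratio n :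
  ('E_P[fun w => expR (n.+1%:R * pairing (L2 X n w) log_ratio)] <= (b / a)%:E)%E.
Proof.
have b0 : 0 < b by have /andP[/(le_trans) h /h/(lt_le_trans a0)] := hf point.
rewrite unlock.
pose F (u : S * seq S) : \bar R := (expR (vsum log_ratio u.1 u.2))%:E.
have -> : (\int[P]_w (expR (n.+1%:R * pairing (L2 X n w) log_ratio))%:E =
    \int[P]_(w in path_of X n.+1 @^-1` setT) F (path_of X n.+1 w))%E.
  rewrite preimage_setT; apply: eq_integral => w _.
  rewrite pairing_L2//; last exact: bounded_log_ratio.
  by rewrite mulrA mulfV ?pnatr_eq0// mul1r.
rewrite (integral_path hS hX); last by move=> u; rewrite lee_fin expR_ge0.
have q0 x y : 0 <= q x y by rewrite divr_ge0 ?mulr_ge0 ?pr_ge0 ?ltW.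
pose G (u : S * seq S) := mass beta u.1 * wt q u.1 u.2.
have G0 u : 0 <= G u by rewrite mulr_ge0 ?mass_ge0// wt_ge0.
apply: esum_le_seq => l ul _.
apply: (@le_trans _ _ (\sum_(u <- [seq u <- l | size u.2 == n.+1]) b / a * G u)%:E).
  rewrite big_filter [in leRHS]big_mkcond -sumEFin; apply: lee_sum => -[x s] _ /=.
  case: ifP => _; last by rewrite mule0.
  rewrite -EFinM lee_fin mulrCA log_ratio_wt /G [leRHS]mulrC /=.
  apply: (@le_trans _ _ (mass beta x * wt q x s * (g x / g (last x s)))).
    by rewrite !mulrA.
  rewrite ler_wpM2l ?mulr_ge0 ?mass_ge0 ?wt_ge0//.
  have /andP[_ h1] := Pop_bounds (x, x); have /andP[h2 _] := Pop_bounds (last x s, last x s).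
  apply: ler_pM; rewrite ?invr_ge0 ?(ltW (g0 _)) ?lef_pV2 ?posrE//.
rewrite -mulr_sumr lee_fin ler_piMr ?divr_ge0 ?(ltW a0) ?(ltW b0)//.
rewrite -lee_fin -sumEFin.
apply: le_trans (esum_paths_le1 q0 sum_q_le1 n.+1 (mass_ge0 beta) (fun l => @sum_mass_le1 _ _ _ hS beta l)).
apply: le_sum_esum => [u||u]; [by rewrite lee_fin G0|exact: filter_uniq|].
by rewrite mem_filter => /andP[].
Qed.

Lemma Lambda2_log_ratio_le0 : (Lambda2 X log_ratio <= 0)%E.
Proof.
apply: ge_limn_esup => c; rewrite lte_fin => c0.
apply: filterS (near_expR_ge (b / a) c0) => n h.
rewrite mul_lne_le; last by apply: expectation_ge0 => w; exact: expR_ge0.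
by apply: le_trans (expectation_log_ratio n) _; rewrite lee_fin.
Qed.

End log_ratio.

Section J2_le.
Context dO (Omega : measurableType dO) d (S : measurableType d) (R : realType).
Variables (P : probability Omega R) (beta : probability S R) (p : R.-pker S ~> S).
Variable X : nat -> {RV P >-> S}.
Hypotheses (hS : discrete S) (hX : markov_chain beta p X).

Lemma J2_le_Lambda2_conj (mu : probability (S * S)%type R) :
  (J2 p mu <= Lambda2_conj X mu)%E.
Proof.
apply: ge_ereal_sup => _ [f [a [b [a0 hf]]] <-].
apply: le_trans (ereal_sup_ubound _); last first.
  by exists (log_ratio p f) => //; exact: bounded_log_ratio hf.
have := Lambda2_log_ratio_le0 hS hX a0 hf.
case: (Lambda2 X _) => [r| |]//; last by move=> _; exact: leey.
by rewrite lee_fin => r0; rewrite -EFinB lee_fin -[leLHS]subr0 lerB.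
Qed.

End J2_le.

(** * Relative entropy *)

Section log_density.
Context d (T : measurableType d) (R : realType).
Hypothesis dT : discrete T.
Variables (mu : probability T R) (rho : T -> R).
Hypotheses (rho0 : forall u, 0 <= rho u)
  (rho1 : forall F : seq T, uniq F -> \sum_(u <- F) rho u <= 1)
  (ac : forall u, rho u = 0 -> mass mu u = 0).
Local Notation m := (mass mu).

Definition log_density u : R := ln (m u / rho u).
Local Notation g := log_density.

Lemma rho_gt0 u : 0 < m u -> 0 < rho u.
Proof.
move=> mu0; rewrite lt_neqAle rho0 andbT eq_sym; apply/eqP => /ac mu_0.
by move: mu0; rewrite mu_0 ltxx.
Qed.

(* The inequality ln t <= t - 1 at t = rho / (K m). *)
Lemma log_density_ge u (K : R) : 0 < K -> 0 <= (g u + ln K) * m u + rho u / K.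
Proof.
move=> K0; have := mass_ge0 mu u; rewrite le_eqVlt => /predU1P[<-|mu0].
  by rewrite mulr0 add0r divr_ge0// ltW.
have r0 := rho_gt0 mu0.
have t0 : 0 < rho u / (K * m u) by rewrite divr_gt0// mulr_gt0.
have -> : g u + ln K = - ln (rho u / (K * m u)).
  rewrite -lnV ?posrE// /g -lnM ?posrE ?divr_gt0//; congr ln.
  by field; rewrite !gt_eqF.
have -> : rho u / K = rho u / (K * m u) * m u by field; rewrite !gt_eqF.
rewrite -mulrDl; apply: mulr_ge0; last exact: ltW.
by rewrite addrC subr_ge0; exact/ltW/ln_sublinear.
Qed.

Let gp u := Num.max (g u) 0.
Let gn u := Num.max (- g u) 0.

Let gp0 u : 0 <= gp u. Proof. by rewrite /gp le_max lexx orbT. Qed.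
Let gn0 u : 0 <= gn u. Proof. by rewrite /gn le_max lexx orbT. Qed.

Let gE u : g u = gp u - gn u.
Proof.
rewrite /gp /gn; case: (leP (g u) 0) => h.
  by rewrite max_l ?oppr_ge0// sub0r opprK.
by rewrite max_r ?subr0// oppr_le0 ltW.
Qed.

Let sum_gE F :
  \sum_(u <- F) g u * m u = \sum_(u <- F) gp u * m u - \sum_(u <- F) gn u * m u.
Proof. by rewrite -sumrB; apply: eq_bigr => u _; rewrite -mulrBl -gE. Qed.

Let int_gE : (\int[mu]_u (g u)%:E = \int[mu]_u (gp u)%:E - \int[mu]_u (gn u)%:E)%E.
Proof.
rewrite integralE; congr (_ - _)%E; apply: eq_integral => u _.
  by rewrite funeposE EFin_max.
by rewrite funenegE EFin_max.
Qed.

(** Case [K = 1] of [log_density_ge]: the negative part times the mass is at most [rho]. This is why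
    the entropy integral is well defined. *)
Let int_gn : (\int[mu]_u (gn u)%:E <= 1)%E.
Proof.
apply: (integral_le_seq dT) => // F uF; rewrite lee_fin.
apply: le_trans (rho1 uF); apply: ler_sum => u _.
rewrite /gn maxEle; case: ifP => _; last first.
  by have := log_density_ge u (@ltr01 R); rewrite ln1 addr0 divr1; lra.
by rewrite mul0r.
Qed.

Let int_gn_fin : (\int[mu]_u (gn u)%:E \is a fin_num)%E.
Proof.
rewrite ge0_fin_numE; first exact: le_lt_trans int_gn (ltry _).
by apply: integral_ge0 => u _; rewrite lee_fin.
Qed.

(** [F0] captures enough of the positive part, while the negative part sums over any finite set to
    at most its finite integral; the bound therefore survives every enlargement of [F0]. *)
Lemma log_density_gt (c : R) : (c%:E < \int[mu]_u (g u)%:E)%E ->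
  exists2 F0 : seq T, uniq F0 & forall F, uniq F -> {subset F0 <= F} ->
    c < \sum_(u <- F) g u * m u.
Proof.
rewrite int_gE lteBrDr// => /(integral_exhaust dT gp0)[F0 uF0 h].
exists F0 => // F uF F0F; rewrite -lte_fin.
have le1 : \sum_(u <- F0) gp u * m u <= \sum_(u <- F) gp u * m u.
  by apply: ler_sum_subseq => // u; rewrite mulr_ge0// mass_ge0.
have := le_sum_integral dT mu gn0 uF.
rewrite sum_gE; move: h int_gn_fin; case: (\int[mu]_u (gn u)%:E)%E => // r.
by rewrite -EFinD !lte_fin => h _; rewrite lee_fin; move: le1; lra.
Qed.

Lemma log_density_lt (r e : R) : (\int[mu]_u (g u)%:E <= r%:E)%E -> 0 < e ->
  exists2 F0 : seq T, uniq F0 & forall F, uniq F -> {subset F0 <= F} ->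
    \sum_(u <- F) g u * m u < r + e.
Proof.
rewrite int_gE => hr e0.
have := int_gn_fin => /fineK; set B := fine _ => BE; rewrite -BE in hr.
have : ((B - e)%:E < \int[mu]_u (gn u)%:E)%E by rewrite -BE lte_fin; lra.
move=> /(integral_exhaust dT gn0)[F0 uF0 h].
exists F0 => // F uF F0F.
have le1 : \sum_(u <- F0) gn u * m u <= \sum_(u <- F) gn u * m u.
  by apply: ler_sum_subseq => // u; rewrite mulr_ge0// mass_ge0.
have le2 := le_sum_integral dT mu gp0 uF.
rewrite sum_gE; move: h hr le2; case: (\int[mu]_u (gp u)%:E)%E => // s.
by rewrite -EFinB !lte_fin !lee_fin; move: le1; lra.
Qed.

(** Shifting the log density by [ln K] and adding [rho u / K] gives nonnegative terms [H u], so
    passing to [F] and replacing [m] by the smaller [nu] can only decrease the sum. The shift costs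
    [ln K] on the missing mass and [K^-1] in total: [K] is meant to be large, and [nu] then close to
    full mass. *)
Lemma log_density_truncated (nu : T -> R) (F : seq T) (r K : R) : 1 <= K ->
  uniq F -> (forall u, u \in F -> 0 <= nu u <= m u) ->
  (\int[mu]_u (g u)%:E <= r%:E)%E ->
  \sum_(u <- F) g u * nu u <= r + (1 - \sum_(u <- F) nu u) * ln K + K^-1.
Proof.
move=> K1 uF hnu hr; apply/ler_addgt0Pr => e e0.
have K0 : 0 < K by exact: lt_le_trans K1.
have [F0 uF0 h] := log_density_lt hr e0.
pose G := undup (F ++ F0); have uG : uniq G by exact: undup_uniq.
have {}h : \sum_(u <- G) g u * m u < r + e.
  by apply: h => // u uF0'; rewrite mem_undup mem_cat uF0' orbT.
pose H u := (g u + ln K) * m u + rho u / K.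
have H0 u : 0 <= H u by exact: log_density_ge.
have FG : \sum_(u <- F) H u <= \sum_(u <- G) H u.
  by apply: ler_sum_subseq => // u uF'; rewrite mem_undup mem_cat uF'.
have GE : \sum_(u <- G) H u <= \sum_(u <- G) g u * m u + ln K + K^-1.
  rewrite /H big_split/= -mulr_suml; apply: lerD; last first.
    by rewrite ler_piMl ?invr_ge0 ?(ltW K0)// rho1.
  under eq_bigr do rewrite mulrDl; rewrite big_split/= lerD2l -mulr_sumr.
  by rewrite ler_piMr ?ln_ge0// sum_mass_le1.
have FE : \sum_(u <- F) g u * nu u + (\sum_(u <- F) nu u) * ln K <= \sum_(u <- F) H u.
  rewrite mulr_suml -big_split/= big_seq [leRHS]big_seq; apply: ler_sum => u uF'.
  have /andP[nu0 num] := hnu u uF'; rewrite [_ * ln K]mulrC -mulrDl.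
  have := mass_ge0 mu u; rewrite le_eqVlt => /predU1P[m0|m0].
    have -> : nu u = 0 by apply/eqP; rewrite eq_le nu0 andbT m0.
    by rewrite mulr0.
  have : 0 <= (g u + ln K) * m u + rho u / K := log_density_ge u K0.
  have t1 : 0 <= nu u / m u <= 1 by rewrite divr_ge0 ?(ltW m0)//= ler_pdivrMr// mul1r.
  have -> : (g u + ln K) * nu u = nu u / m u * ((g u + ln K) * m u).
    by field; rewrite gt_eqF.
  rewrite /H; have : 0 <= rho u / K by rewrite divr_ge0// ltW.
  move: (rho u / K) ((g u + ln K) * m u) (nu u / m u) t1 => a b t /andP[t0 t1] a0 ab.
  (* With [0 <= t <= 1], [0 <= a] and [0 <= b + a], one has [t * b <= t * (b + a) <= b + a]. *)
  by nra.
by move: h FG GE FE; lra.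
Qed.

End log_density.

(** * The reference measure in [R2] *)

Section marginal.
Context d (S : measurableType d) (R : realType).
Hypothesis hS : discrete S.
Variables (mu : probability (S * S)%type R) (p : R.-pker S ~> S).
Let hS2 := discrete_prod hS.

Definition marginal (x : S) : R := fine (mu ([set x] `*` setT)).

Lemma marginalE x : mu ([set x] `*` setT) = (marginal x)%:E.
Proof. by rewrite /marginal fineK// fin_num_measure//; exact: discrete_measurable. Qed.

Lemma marginal_ge0 x : 0 <= marginal x.
Proof. exact/fine_ge0/measure_ge0. Qed.

Lemma sum_mass_marginal x (l : seq S) : uniq l ->
  \sum_(y <- l) mass mu (x, y) <= marginal x.
Proof.
move=> ul; rewrite -lee_fin -marginalE (mass_esum hS2) -sumEFin.
rewrite -(big_map (fun y => (x, y)) xpredT (fun u => (mass mu u)%:E)).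
apply: le_sum_esum => [u||u]; first by rewrite lee_fin mass_ge0.
  by rewrite map_inj_uniq// => y y' [].
by move=> /mapP[y _ ->].
Qed.

Lemma mass_le_marginal x y : mass mu (x, y) <= marginal x.
Proof. by have := sum_mass_marginal x (l := [:: y]) isT; rewrite big_seq1. Qed.

Lemma sum_marginal_le1 (l : seq S) : uniq l -> \sum_(x <- l) marginal x <= 1.
Proof.
move=> ul; pose W x : S * S -> R := \1_([set x] `*` setT).
have bW x : bounded_fun (W x) by exact: bounded_fun_indic.
have [bl ->] : bounded_fun (fun u => \sum_(x <- l) W x u) /\
    \sum_(x <- l) marginal x = pairing mu (fun u => \sum_(x <- l) W x u).
  elim: l {ul} => [|x l [bl IH]].
    rewrite big_nil (_ : (fun _ => _) = cst 0); last first.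
      by apply/funext => u; rewrite big_nil.
    by split; [exact: bounded_fun_cst|rewrite pairing_cst].
  rewrite (_ : (fun _ => _) = (fun u => W x u + \sum_(x <- l) W x u)); last first.
    by apply/funext => u; rewrite big_cons.
  split; first exact: bounded_funD.
  by rewrite big_cons IH pairingD// pairing_indic.
rewrite -[leRHS](pairing_cst mu 1); apply: le_pairing => //.
  exact: bounded_fun_cst.
move=> u; rewrite (eq_bigr (fun x => 1 * (u.1 == x)%:R)) => [|x _].
  by rewrite sum_delta//; case: ifP.
by rewrite /W indicE in_setX in_setT andbT in_set1 mul1r.
Qed.

Definition ref_density (u : S * S) : R := marginal u.1 * pr p u.1 u.2.

Lemma ref_density_ge0 u : 0 <= ref_density u.
Proof. by rewrite mulr_ge0 ?marginal_ge0 ?pr_ge0. Qed.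

Lemma sum_ref_density_le1 (F : seq (S * S)) : uniq F ->
  \sum_(u <- F) ref_density u <= 1.
Proof.
move=> uF; pose H := undup (map fst F); pose T := undup (map snd F).
apply: (@le_trans _ _ (\sum_(u <- [seq (x, y) | x <- H, y <- T]) ref_density u)).
  apply: ler_sum_subseq => // [u|[x y] ls]; first exact: ref_density_ge0.
  by apply: allpairs_f; rewrite mem_undup; apply/mapP; exists (x, y).
rewrite big_allpairs (le_trans _ (sum_marginal_le1 (undup_uniq (map fst F))))//.
apply: ler_sum => x _; rewrite /ref_density /= -mulr_sumr ler_piMr ?marginal_ge0//.
by apply: (sum_mass_le1 hS (pker p x)); exact: undup_uniq.
Qed.

Lemma R2E : R2 p mu = if `[< forall u, ref_density u = 0 -> mass mu u = 0 >]
  then (\int[mu]_u (log_density mu ref_density u)%:E)%E else +oo%E.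
Proof.
have rE u : (mu ([set u.1] `*` setT) * p u.1 [set u.2] = (ref_density u)%:E)%E.
  by rewrite marginalE (prE p hS) -EFinM.
rewrite /R2 /rel_entropy; congr (if _ then _ else _).
  apply: asbool_equiv_eq; split => h u.
    by move=> r0; have := h u; rewrite rE r0 (massE hS2) => /(_ erefl) [].
  by rewrite rE (massE hS2) => -[/h ->].
by apply: eq_integral => u _; rewrite rE.
Qed.

End marginal.

Lemma finite_pos_bounds (T : eqType) (R : realFieldType) (F : seq T) (phi : T -> R)
  (delta : R) : 0 < delta -> (forall u, u \in F -> 0 < phi u) ->
  exists a b : R, [/\ 0 < a, a <= delta <= b & forall u, u \in F -> a <= phi u <= b].
Proof.
move=> d0; elim: F => [|v F IH] h; first by exists delta, delta; split; rewrite ?lexx.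
have [|a [b [a0 /andP[ad db] hF]]] := IH; first by move=> u uF; apply: h; rewrite in_cons uF orbT.
have v0 : 0 < phi v by apply: h; rewrite mem_head.
exists (Num.min a (phi v)), (Num.max b (phi v)); split.
- by rewrite lt_min a0.
- by rewrite ge_min ad le_max db.
- move=> u; rewrite in_cons => /predU1P[->|/hF/andP[h1 h2]].
    by rewrite ge_min le_max lexx !orbT.
  by rewrite ge_min le_max h1 h2.
Qed.

Lemma uniq_section (T1 T2 : eqType) (F : seq (T1 * T2)) y :
  uniq F -> uniq [seq v.2 | v <- F & v.1 == y].
Proof.
move=> uF; rewrite map_inj_in_uniq ?filter_uniq// => -[x z] [x' z'].
by rewrite !mem_filter /= => /andP[/eqP-> _] /andP[/eqP-> _] ->.
Qed.

(** * Test functions for [J2] built from the density *)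

Section R2_le_J2.
Context d (S : measurableType d) (R : realType).
Hypothesis hS : discrete S.
Variables (mu : probability (S * S)%type R) (p : R.-pker S ~> S).
Let hS2 := discrete_prod hS.
Local Notation m := (mass mu).
Local Notation pr := (pr p).

(** Take [f] equal to [phi] on [F] and to [delta] elsewhere. The last hypothesis gives
    [Pf <= 1 + delta] everywhere, and [pairing_ge_off] collects the two lower bounds on
    [ln (f / Pf)]. *)
Lemma J2_ge (F : seq (S * S)) (phi : S * S -> R) (delta : R) : uniq F -> 0 < delta ->
  (forall u, u \in F -> 0 < phi u) ->
  (forall y, \sum_(u <- F | u.1 == y) phi u * pr u.1 u.2 <= 1) ->
  ((\sum_(u <- F) ln (phi u) * m u + (1 - \sum_(u <- F) m u) * ln delta -
    ln (1 + delta))%:E <= J2 p mu)%E.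
Proof.
move=> uF d0 phi0 phi1.
have [a [b [a0 /andP[ad db] hF]]] := finite_pos_bounds d0 phi0.
pose f u := if u \in F then phi u else delta.
have hf u : a <= f u <= b by rewrite /f; case: ifP => [/hF//|_]; rewrite ad.
have f0 u : 0 < f u by apply: lt_le_trans a0 _; case/andP: (hf u).
apply: (@le_trans _ _ (pairing mu (log_ratio p f))%:E); last first.
  by apply: ereal_sup_ubound; exists f => //; exists a, b.
have Pf u : Pop p f u <= 1 + delta.
  pose Fy := [seq v.2 | v <- F & v.1 == u.2].
  have uFy : uniq Fy by exact: uniq_section.
  have mem_Fy z : (z \in Fy) = ((u.2, z) \in F).
    apply/mapP/idP => [[v]|uz]; last by exists (u.2, z); rewrite ?mem_filter ?eqxx.
    by rewrite mem_filter => /andP[/eqP <- vF ->]; rewrite -surjective_pairing.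
  apply: (@le_trans _ _ (pairing (pker p u.2)
      (fun z => delta + \sum_(v <- Fy) phi (u.2, v) * (z == v)%:R))).
    rewrite -[Pop p f u]/(pairing (pker p u.2) (fun z => f (u.2, z))).
    apply: (le_pairing hS).
    - apply/bounded_funP; exists b => [|z]; first exact: lt_le_trans db.
      by rewrite gtr0_norm//; case/andP: (hf (u.2, z)).
    - by apply: bounded_funD; [exact: bounded_fun_cst|exact: bounded_fun_sum].
    - move=> z; rewrite sum_delta// /f mem_Fy; case: ifPn => [uzF|_]; last by rewrite addr0.
      by rewrite lerDr ltW.
  rewrite (pairing_sum hS) [leRHS]addrC lerD2l big_map big_filter (le_trans _ (phi1 u.2))//.
  rewrite le_eqVlt; apply/orP; left; apply/eqP; apply: eq_bigr => v /eqP vu.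
  by rewrite -vu -surjective_pairing.
have Pf0 u : 0 < Pop p f u.
  by apply: (lt_le_trans a0); have /andP[] := Pop_bounds p hS a0 hf u.
have d1 : 0 < 1 + delta by rewrite addr_gt0.
pose c := ln delta - ln (1 + delta).
apply: le_trans (_ : ((c + \sum_(u <- F) ((ln (phi u) - ln (1 + delta)) - c) * m u)%:E <= _)%E).
  rewrite lee_fin [in leRHS](eq_bigr (fun u => ln (phi u) * m u - ln delta * m u)); last first.
    by move=> u _; rewrite -mulrBl /c opprB addrA subrK.
  by rewrite sumrB -mulr_sumr /c; lra.
rewrite lee_fin; apply: (pairing_ge_off hS2) => //.
- exact: (bounded_log_ratio p hS a0 hf).
- move=> u uF'; rewrite /log_ratio ln_div ?posrE// /f uF' lerD2l lerN2.
  by rewrite ler_ln ?posrE.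
- move=> u uF'; rewrite /log_ratio ln_div ?posrE// /f (negbTE uF') lerD2l lerN2.
  by rewrite ler_ln ?posrE.
Qed.

Lemma R2_le_J2 : (R2 p mu <= J2 p mu)%E.
Proof.
rewrite (R2E hS); case: asboolP => [ac|/existsNP[[x y] /not_implyP[r0 m0]]].
  rewrite leNgt; apply/negP => /lte_real_dense[c /andP[Jc cR]].
  have [c' /andP[cc' c'R]] := lte_real_dense cR.
  rewrite lte_fin in cc'.
  have [F0 uF0 hF0] := log_density_gt hS2 (ref_density_ge0 mu p)
    (sum_ref_density_le1 hS mu p) ac c'R.
  pose e := (c' - c) / 2; have e0 : 0 < e by rewrite divr_gt0// subr_gt0.
  (* The mass left outside [G] will be below [e / K], so the penalty [(1 - mass) * ln e] for [f = e]
     off [F] is at least [- e]. *)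
  pose K := `|ln e| + 1; have K0 : 0 < K by rewrite ltr_wpDl.
  have [F1 uF1 hF1] := mass_exhaust hS2 mu (divr_gt0 e0 K0).
  pose G := undup (F0 ++ F1); have uG : uniq G by exact: undup_uniq.
  have c'G : c' < \sum_(u <- G) log_density mu (ref_density mu p) u * m u.
    by apply: hF0 => // u uF; rewrite mem_undup mem_cat uF.
  have mG : 1 - e / K < \sum_(u <- G) m u.
    apply: lt_le_trans hF1 _; apply: ler_sum_subseq => // [u|u uF].
      exact: mass_ge0.
    by rewrite mem_undup mem_cat uF orbT.
  pose F := [seq u <- G | 0 < m u]; have uF : uniq F by exact: filter_uniq.
  have sumF (h : S * S -> R) : \sum_(u <- F) h u * m u = \sum_(u <- G) h u * m u.
    rewrite big_filter big_mkcond; apply: eq_bigr => u _; case: ifPn => //.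
    by rewrite -leNgt => mu0; rewrite (_ : m u = 0) ?mulr0//; apply/eqP; rewrite eq_le mu0 mass_ge0.
  have sumF1 : \sum_(u <- F) m u = \sum_(u <- G) m u.
    by have := sumF (fun=> 1); under eq_bigr do rewrite mul1r; under [RHS]eq_bigr do rewrite mul1r.
  have F_gt0 u : u \in F -> 0 < m u by rewrite mem_filter => /andP[].
  have rho_gt0' u : u \in F -> 0 < ref_density mu p u.
    move=> /F_gt0; exact: (rho_gt0 (ref_density_ge0 mu p) ac).
  have phi0 u : u \in F -> 0 < m u / ref_density mu p u.
    by move=> uF'; rewrite divr_gt0 ?F_gt0 ?rho_gt0'.
  (* The transition probability cancels: the terms are the conditional masses
     [m (y, z) / marginal mu y]. *)
  have phi1 y : \sum_(u <- F | u.1 == y) m u / ref_density mu p u * pr u.1 u.2 <= 1.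
    have [m10|m10] := eqVneq (marginal mu y) 0.
      rewrite big1_seq// => u /andP[/eqP uy uF'].
      by have := rho_gt0' u uF'; rewrite /ref_density uy m10 mul0r ltxx.
    have m1_gt0 : 0 < marginal mu y by rewrite lt_neqAle eq_sym m10 marginal_ge0.
    rewrite big_seq_cond (eq_bigr (fun u => m (y, u.2) / marginal mu y)); last first.
      move=> u /andP[uF' /eqP uy]; have := rho_gt0' u uF'.
      rewrite [u in m u]surjective_pairing /ref_density uy => r0.
      have : pr y u.2 != 0 by apply: contraTneq r0 => ->; rewrite mulr0 ltxx.
      by move=> p0; field; rewrite m10 p0.
    rewrite -big_seq_cond -mulr_suml ler_pdivrMr// mul1r.
    have := sum_mass_marginal hS mu y (uniq_section y uF).
    by rewrite big_map big_filter.
  have := J2_ge uF e0 phi0 phi1.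
  apply/negP; rewrite -ltNge; apply: (lt_trans Jc); rewrite lte_fin.
  rewrite sumF sumF1; set A := \sum_(u <- G) _ * m u in c'G *.
  have lnE : ln (1 + e) <= e by apply: le_ln1Dx; apply: lt_trans e0.
  have mG1 : 0 <= 1 - \sum_(u <- G) m u by rewrite subr_ge0 sum_mass_le1.
  have h1 : - e <= (1 - \sum_(u <- G) m u) * ln e.
    have : (1 - \sum_(u <- G) m u) * - ln e <= (1 - \sum_(u <- G) m u) * K.
      by rewrite ler_wpM2l// /K (le_trans (ler_norm _))// normrN lerDl.
    have : (1 - \sum_(u <- G) m u) * K <= e.
      by rewrite -ler_pdivlMr// lerBlDr -lerBlDl ltW.
    by rewrite mulrN; lra.
  rewrite -[X in X < _]/(c); have : c = c' - 2 * e by rewrite /e; field.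
  by move: c'G h1 lnE; rewrite /log_density -/A; lra.
move: m0 => /eqP m0; have m_gt0 : 0 < m (x, y) by rewrite lt_neqAle eq_sym m0 mass_ge0.
rewrite leye_eq; apply/eqP/eqyP => A A0.
have p0 : pr x y = 0.
  move/eqP: r0; rewrite /ref_density mulf_eq0 => /orP[/eqP /= h|/eqP//].
  by have := mass_le_marginal hS mu x y; rewrite h leNgt m_gt0.
(* The edge is charged by [mu] but has transition probability 0, so a huge value of [f] there is
   invisible to [Pf]. With [delta = 1], this [B] makes the bound of [J2_ge] equal to the arbitrary
   [A]. *)
pose B := (A + ln 2) / m (x, y).
have phi1 z : \sum_(u <- [:: (x, y)] | u.1 == z) expR B * pr u.1 u.2 <= 1.
  by rewrite big_cons big_nil /= p0 mulr0 addr0; case: ifP.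
apply: le_trans (J2_ge (delta := 1) _ ltr01 (fun _ _ => expR_gt0 _) phi1) => //.
rewrite !big_seq1 ln1 mulr0 addr0 expRK lee_fin /B divfK ?gt_eqF//.
by rewrite -[1 + 1]/(2%:R : R) addrK.
Qed.

End R2_le_J2.

(** * Approximation by finite circulations *)

Lemma sum_count (T : eqType) (R : pzRingType) (F E : seq T) (h : T -> R) : uniq F ->
  {subset E <= F} -> \sum_(e <- F) (count_mem e E)%:R * h e = \sum_(e <- E) h e.
Proof.
move=> uF; elim: E => [|a E IH] EF.
  by rewrite big_nil big1// => e _; rewrite mul0r.
rewrite big_cons -IH; last by move=> e eE; apply: EF; rewrite in_cons eE orbT.
rewrite (eq_bigr (fun e => (a == e)%:R * h e + (count_mem e E)%:R * h e)); last first.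
  by move=> e _; rewrite /= natrD mulrDl.
rewrite big_split/=; congr (_ + _).
have aF : a \in F by apply: EF; rewrite mem_head.
rewrite (bigD1_seq a)//= eqxx mul1r big1 ?addr0// => e ea.
by rewrite eq_sym (negbTE ea) mul0r.
Qed.

(** [t] is the minimum over [E] of [r e] divided by the multiplicity of [e]. Nonnegativity of [r]
    comes after the existential so that [step] can be chosen for every [r], before the residuals are
    known to be nonnegative. *)
Lemma max_multiple (T : eqType) (R : realFieldType) (r : T -> R) (E : seq T) :
  exists t, (forall e, 0 <= r e) ->
  [/\ 0 <= t, forall e, t * (count_mem e E)%:R <= r e &
   E != [::] -> exists2 e, e \in E & t * (count_mem e E)%:R = r e].
Proof.
have c0 e : e \in E -> 0 < (count_mem e E)%:R :> R.
  by rewrite ltr0n -has_count has_pred1.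
have argmin (l : seq T) : l != [::] ->
    exists2 e0, e0 \in l & forall e, e \in l ->
      r e0 / (count_mem e0 E)%:R <= r e / (count_mem e E)%:R.
  elim: l => // a [|b l] IH _.
    by exists a; rewrite ?mem_head// => e; rewrite inE => /eqP ->.
  have [e0 e0l h] := IH isT.
  have [ale|/ltW ale] := lerP (r e0 / (count_mem e0 E)%:R) (r a / (count_mem a E)%:R).
    exists e0; first by rewrite in_cons e0l orbT.
    by move=> e; rewrite in_cons => /predU1P[->|/h].
  exists a; first by rewrite mem_head.
  by move=> e; rewrite in_cons => /predU1P[->//|/h]; exact: le_trans.
have [E0|E0] := eqVneq E [::].
  by exists 0 => r0; split => // e; rewrite E0 mulr0.
have [e0 e0E h] := argmin E E0.
exists (r e0 / (count_mem e0 E)%:R) => r0; split.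
- by rewrite divr_ge0.
- move=> e; have [eE|eE] := boolP (e \in E).
    by rewrite -ler_pdivlMr ?c0// h.
  by have /count_memPn -> := eE; rewrite mulr0.
- by move=> _; exists e0 => //; rewrite divfK// gt_eqF// c0.
Qed.

Lemma sum_edges_telescope (S : choiceType) (R : zmodType) (phi : S -> R) x s :
  \sum_(e <- edges x s) (phi e.1 - phi e.2) = phi x - phi (last x s).
Proof.
elim: s x => [|y s IH] x /=; first by rewrite big_nil subrr.
by rewrite big_cons IH addrA subrK.
Qed.

Section cycle_approx.
Context d (S : measurableType d) (R : realType).
Hypothesis hS : discrete S.
Variable mu : probability (S * S)%type R.
Hypothesis bal : balanced mu.
Let hS2 := discrete_prod hS.
Local Notation m := (mass mu).

Let enum_paths : exists c : nat -> S * seq S, forall u, exists i, c i = u.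
Proof.
have /countable_injP[j jinj] := countable_paths hS.
exists (fun i => if pselect (exists u, j u = i) is left h then projT1 (cid h)
  else (point, [::])) => u; exists (j u).
case: pselect => [h|]; last by case; exists u.
by apply: jinj; rewrite ?inE//; exact: (projT2 (cid h)).
Qed.

Let word := projT1 (cid enum_paths).
Let wordP u : exists i, word i = u.
Proof. exact: (projT2 (cid enum_paths)). Qed.

(** Words that do not close count as empty cycles, so enumerating all words enumerates all
    cycles. *)
Let cyc i : seq (S * S) :=
  let: (x, s) := word i in if last x s == x then edges x s else [::].

Let step (r : S * S -> R) E := projT1 (cid (max_multiple r E)).

Let res := fix res n : S * S -> R := if n is n'.+1
  then fun e => res n' e - step (res n') (cyc n') * (count_mem e (cyc n'))%:R else m.

Let t n := step (res n) (cyc n).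

Let resS n e : res n.+1 e = res n e - t n * (count_mem e (cyc n))%:R.
Proof. by []. Qed.

Let res_ge0 n e : 0 <= res n e.
Proof.
elim: n e => [|n IH] e; first exact: mass_ge0.
by rewrite resS subr_ge0; have [] := projT2 (cid (max_multiple (res n) (cyc n))) IH.
Qed.

Let t_ge0 n : 0 <= t n.
Proof. by have [] := projT2 (cid (max_multiple (res n) (cyc n))) (res_ge0 n). Qed.

Let res_exhausted n : cyc n != [::] -> exists2 e, e \in cyc n & res n.+1 e = 0.
Proof.
have [_ _ h /h[e eE tE]] := projT2 (cid (max_multiple (res n) (cyc n))) (res_ge0 n).
by exists e => //; rewrite resS /t tE subrr.
Qed.

Let res_le k n e : (k <= n)%N -> res n e <= res k e.
Proof.
move=> /subnK <-; elim: (n - k)%N => [|i IH]; first by rewrite add0n.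
by rewrite addSn resS (le_trans _ IH)// gerBl mulr_ge0.
Qed.

Let flow n e := m e - res n e.

Let flowE n e : flow n e = \sum_(j < n) t j * (count_mem e (cyc j))%:R.
Proof.
rewrite /flow; elim: n => [|n IH]; first by rewrite big_ord0 subrr.
by rewrite big_ord_recr -IH resS opprB addrCA addrC.
Qed.

Let supp n := undup (flatten [seq cyc j | j <- iota 0 n]).

Let cyc_supp n j : (j < n)%N -> {subset cyc j <= supp n}.
Proof.
move=> jn e ej; rewrite mem_undup; apply/flattenP; exists (cyc j) => //.
by apply/mapP; exists j => //; rewrite mem_iota.
Qed.

Let flow_supp n e : e \notin supp n -> flow n e = 0.
Proof.
move=> en; rewrite flowE big1// => j _.
have /count_memPn -> : e \notin cyc j by apply: contra en => /(cyc_supp (ltn_ord j)).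
by rewrite mulr0.
Qed.

Let sum_flow n (F : seq (S * S)) h : uniq F -> {subset supp n <= F} ->
  \sum_(e <- F) flow n e * h e = \sum_(j < n) t j * \sum_(e <- cyc j) h e.
Proof.
move=> uF sF; under eq_bigr do rewrite flowE mulr_suml.
rewrite exchange_big/=; apply: eq_bigr => j _.
rewrite -(sum_count h uF); last by move=> e ej; apply: sF; exact: (cyc_supp (ltn_ord j)).
by rewrite mulr_sumr; apply: eq_bigr => e _; rewrite mulrA.
Qed.

Let cyc_balanced j (phi : S -> R) : \sum_(e <- cyc j) (phi e.1 - phi e.2) = 0.
Proof.
rewrite /cyc; case: (word j) => x s; case: eqP => [lx|_]; last by rewrite big_nil.
by rewrite sum_edges_telescope lx subrr.
Qed.

Let flow_balanced n (F : seq (S * S)) (phi : S -> R) : uniq F -> {subset supp n <= F} ->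
  \sum_(e <- F) flow n e * (phi e.1 - phi e.2) = 0.
Proof.
move=> uF sF; rewrite (sum_flow (fun e => phi e.1 - phi e.2))// big1// => j _.
by rewrite cyc_balanced mulr0.
Qed.

(** Says that the nonincreasing residuals at [e] have a positive limit, without introducing the
    limit. *)
Let persistent e := exists2 a, 0 < a & forall n, a <= res n e.

Let not_persistent e a : ~ persistent e -> 0 < a -> exists N, forall n, (N <= n)%N -> res n e < a.
Proof.
move=> np a0; have [N hN] : exists N, res N e < a.
  apply: contrapT => h; apply: np; exists a => // n; rewrite leNgt.
  by apply/negP => hn; apply: h; exists n.
by exists N => n /(res_le e)/le_lt_trans; apply.
Qed.

Let not_persistent_sum (G : seq (S * S)) a :
  (forall e, e \in G -> ~ persistent e) -> 0 < a ->
  exists N, forall n, (N <= n)%N -> \sum_(e <- G) res n e < a.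
Proof.
elim: G a => [|e G IH] a hG a0; first by exists 0%N => n _; rewrite big_nil.
have a20 : 0 < a / 2 by rewrite divr_gt0.
have [|N1 h1] := IH (a / 2) _ a20; first by move=> f fG; apply: hG; rewrite in_cons fG orbT.
have [N2 h2] := not_persistent (hG e (mem_head _ _)) a20.
exists (maxn N1 N2) => n; rewrite geq_max => /andP[/h1 + /h2].
by rewrite big_cons; lra.
Qed.

(** Every cycle is treated at some stage [i], and the residual of one of its edges is 0 from then
    on. *)
Let persistent_acyclic x s : s != [::] -> last x s = x ->
  ~ (forall e, e \in edges x s -> persistent e).
Proof.
move=> s0 lx h; have [i wi] := wordP (x, s).
have ci : cyc i = edges x s by rewrite /cyc wi lx eqxx.
have [|e] := @res_exhausted i.
  by rewrite ci -size_eq0 size_edges size_eq0.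
rewrite ci => /h[a a0 /(_ i.+1)] + r0; rewrite r0.
by rewrite leNgt a0.
Qed.

(** Let [A] be the set of vertices reached from the end of [e0] along persistent edges. The edge
    [e0] enters [A], since otherwise it would close a persistent cycle, and brings in at least [a]
    at every stage. By balance as much must leave [A], but the edges leaving [A] are not persistent
    and their residuals become negligible. *)
Let no_persistent e0 : ~ persistent e0.
Proof.
move=> /[dup] pe0 [a a0 ha].
pose A : set S := [set z | exists s, last e0.2 s = z /\
  forall e, e \in edges e0.2 s -> persistent e].
have A2 : A e0.2 by exists [::].
have A1 : ~ A e0.1.
  move=> [s [ls hs]]; apply: (@persistent_acyclic e0.2 (rcons s e0.2)).
  - by case: (s).
  - by rewrite last_rcons.
  - move=> e; rewrite -cats1 edges_cat mem_cat => /orP[/hs//|].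
    by rewrite /= mem_seq1 ls -surjective_pairing => /eqP ->.
have outA e : A e.1 -> ~ A e.2 -> ~ persistent e.
  move=> [s [ls hs]] nA pe; apply: nA; exists (rcons s e.2); split.
    by rewrite last_rcons.
  move=> f; rewrite -cats1 edges_cat mem_cat => /orP[/hs//|].
  by rewrite /= mem_seq1 ls -surjective_pairing => /eqP ->.
pose phi x : R := \1_A x.
pose W (e : S * S) := phi e.1 - phi e.2.
have bi (B : set (S * S)) : bounded_fun (\1_B : S * S -> R) by exact: bounded_fun_indic.
have muW : pairing mu W = 0.
  have -> : W = fun u => \1_(A `*` setT) u + -1 * \1_(setT `*` A) u.
    apply/funext => u; rewrite /W /phi !indicE !in_setX !in_setT andbT.
    by rewrite mulN1r.
  rewrite pairingD// ?pairingZ// ?pairing_indic//; last exact: bounded_funZ.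
  by rewrite mulN1r; apply/eqP; rewrite subr_eq0; apply/eqP; congr fine; exact: bal.
have [G0 uG0 mG0] := mass_exhaust hS2 mu (divr_gt0 a0 (ltr0n R 2)).
pose G := undup (e0 :: G0); have uG : uniq G by exact: undup_uniq.
have e0G : e0 \in G by rewrite mem_undup mem_head.
have mG : 1 - a / 2 < \sum_(e <- G) m e.
  apply: lt_le_trans mG0 _; apply: ler_sum_subseq => // [e|e eG].
    exact: mass_ge0.
  by rewrite mem_undup in_cons eG orbT.
pose out (e : S * S) := (e.1 \in A) && (e.2 \notin A).
have [|N hN] := @not_persistent_sum [seq e <- G | out e] (a / 2) _ (divr_gt0 a0 (ltr0n R 2)).
  move=> e; rewrite mem_filter => /andP[/andP[/set_mem e1 /negP e2] _].
  by apply: outA => // e2'; apply: e2; rewrite inE.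
have {}hN := hN N (leqnn _).
pose F := undup (G ++ supp N); have uF : uniq F by exact: undup_uniq.
(* Equal to [mu] on [G] and at most [mu] elsewhere, so it misses less than [a / 2] of the mass. Its
   flow part is a circulation and pairs to 0 with [W], which leaves the residual on [G], at most
   [a / 2 - a]. *)
pose nu e := flow N e + (e \in G)%:R * res N e.
have flow0 e : 0 <= flow N e.
  by rewrite flowE sumr_ge0// => j _; rewrite mulr_ge0.
have hnu e : e \in F -> 0 <= nu e <= m e.
  move=> _; rewrite addr_ge0 ?mulr_ge0//= /nu /flow.
  by case: (e \in G); rewrite ?mul1r ?subrK// mul0r addr0 gerBl.
have GF (h : S * S -> R) : \sum_(e <- F) (e \in G)%:R * h e = \sum_(e <- G) h e.
  rewrite -(sum_count h uF (E := G)) => [|e eG]; last by rewrite mem_undup mem_cat eG.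
  by apply: eq_bigr => e _; rewrite count_uniq_mem.
have W1 e : `|W e| <= 1.
  rewrite /W /phi !indicE; case: (e.1 \in A); case: (e.2 \in A);
  by rewrite ?subrr ?subr0 ?sub0r ?normrN ?normr0 ?normr1.
have := pairing_approx hS2 uF W1 hnu.
rewrite muW sub0r normrN mul1r.
have -> : \sum_(e <- F) nu e * W e = \sum_(e <- G) res N e * W e.
  have sF : {subset supp N <= F} by move=> e eS; rewrite mem_undup mem_cat eS orbT.
  rewrite (eq_bigr (fun e => flow N e * (phi e.1 - phi e.2) +
    (e \in G)%:R * (res N e * W e))) => [|e _]; last by rewrite /nu mulrDl mulrA.
  by rewrite big_split/= flow_balanced// add0r (GF (fun e => res N e * W e)).
have le1 : \sum_(e <- G) m e <= \sum_(e <- F) nu e.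
  rewrite -GF; apply: ler_sum => e _; rewrite /nu.
  case: (e \in G); rewrite ?mul0r ?addr0// !mul1r /flow subrK//.
have le2 : \sum_(e <- G) res N e * W e <=
    \sum_(e <- [seq e <- G | out e]) res N e - a.
  have -> : a = \sum_(e <- G) a * (e0 == e)%:R.
    by rewrite sum_delta// e0G.
  rewrite big_filter [X in _ <= X - _]big_mkcond -sumrB; apply: ler_sum => e _.
  have [<-|ne] := eqVneq e0 e.
    rewrite /out /W /phi !indicE mulr1.
    rewrite (mem_set A2) (memNset A1).
    by rewrite /= !sub0r mulrN1 lerN2.
  rewrite mulr0 subr0 /out /W /phi !indicE.
  case: (e.1 \in A); case: (e.2 \in A) => /=; rewrite ?subrr ?subr0 ?sub0r ?mulr0 ?mulr1//.
  by rewrite mulrN1 oppr_le0.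
move=> /ler_normlP[+ _].
by move: hN mG le1 le2; lra.
Qed.

(** On a finite set [G] carrying almost all the mass the residuals tend to 0, as no edge is
    persistent; the flow subtracted up to a late stage is the approximation. *)
Lemma cycle_approx (eps : R) : 0 < eps -> exists (nu : S * S -> R) (F : seq (S * S)),
  [/\ uniq F, forall e, 0 <= nu e <= m e, forall e, e \notin F -> nu e = 0,
   1 - eps < \sum_(e <- F) nu e &
   forall phi : S -> R, \sum_(e <- F) nu e * (phi e.1 - phi e.2) = 0].
Proof.
move=> eps0; have e20 : 0 < eps / 2 by rewrite divr_gt0.
have [G uG mG] := mass_exhaust hS2 mu e20.
have [N hN] := not_persistent_sum (fun e (_ : e \in G) => @no_persistent e) e20.
exists (flow N), (undup (G ++ supp N)).
have flow0 e : 0 <= flow N e.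
  by rewrite flowE sumr_ge0// => j _; rewrite mulr_ge0.
split; first exact: undup_uniq.
- by move=> e; rewrite flow0 gerBl res_ge0.
- by move=> e; rewrite mem_undup mem_cat negb_or => /andP[_ /flow_supp].
- apply: (@lt_le_trans _ _ (\sum_(e <- G) flow N e)).
    by rewrite sumrB; have := hN N (leqnn _); lra.
  by apply: ler_sum_subseq => // e eG; rewrite mem_undup mem_cat eG.
- move=> phi; apply: flow_balanced; first exact: undup_uniq.
  by move=> e eS; rewrite mem_undup mem_cat eS orbT.
Qed.

End cycle_approx.

(** * Entropy of blocks *)

Lemma sum_support (R : nmodType) (T : eqType) (F G : seq T) (f : T -> R) :
  uniq F -> uniq G -> {subset F <= G} -> (forall e, e \notin F -> f e = 0) ->
  \sum_(e <- G) f e = \sum_(e <- F) f e.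
Proof.
move=> uF uG FG f0; rewrite (bigID [in F])/= [X in _ + X]big1// addr0 -big_filter.
apply: perm_big; apply: uniq_perm; rewrite ?filter_uniq// => e.
by rewrite mem_filter andb_idr//; exact: FG.
Qed.

(** Each key contributes exactly 1, or 0 when its total weight is 0, division by 0 being 0. *)
Lemma sum_ratio_le (R : realFieldType) (T K : eqType) (l : seq T) (ks : seq K)
  (key : T -> K) (w : T -> R) : uniq ks -> (forall s, 0 <= w s) ->
  (forall s, s \in l -> key s \in ks) ->
  \sum_(s <- l) w s / (\sum_(s' <- l | key s' == key s) w s') <= (size ks)%:R.
Proof.
move=> uk w0 hk.
rewrite (eq_big_seq (fun s => \sum_(k <- ks) (key s == k)%:R *
    (w s / (\sum_(s' <- l | key s' == k) w s')))); last first.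
  move=> s /hk ks'; rewrite [RHS](bigD1_seq (key s))//= eqxx mul1r.
  rewrite [X in _ + X]big1 ?addr0// => k ne.
  by rewrite eq_sym (negbTE ne) mul0r.
rewrite exchange_big/= -sum1_size natr_sum; apply: ler_sum => k _.
rewrite (eq_bigr (fun s => (if key s == k then w s else 0) /
    (\sum_(s' <- l | key s' == k) w s'))); last first.
  by move=> s _; case: ifP; rewrite ?mul1r ?mul0r.
rewrite -mulr_suml -big_mkcond/=; set A := \sum_(s <- l | _) _.
by have [->|A0] := eqVneq A 0; rewrite ?mul0r ?ler01 ?mulfV.
Qed.

Section wordsn.
Context (T : eqType).

Fixpoint wordsn (A : seq T) n : seq (seq T) :=
  if n is n'.+1 then [seq y :: s | y <- A, s <- wordsn A n'] else [:: [::]].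

Lemma uniq_wordsn A n : uniq A -> uniq (wordsn A n).
Proof.
move=> uA; elim: n => //= n IH; apply: allpairs_uniq => //.
by move=> [y s] [y' s'] _ _ /= [-> ->].
Qed.

Lemma size_wordsn A n : size (wordsn A n) = (size A ^ n)%N.
Proof. by elim: n => //= n IH; rewrite size_allpairs IH expnS. Qed.

Lemma mem_wordsn A n s :
  (s \in wordsn A n) = (size s == n) && all [in A] s.
Proof.
elim: n s => [|n IH] [|y s]//=.
  by apply/negbTE/negP => /allpairsP[[a b] [_ _]].
apply/allpairsP/idP => [[[a b] /= [aA +] [-> ->]]|].
  by rewrite IH eqSS => /andP[-> ->]; rewrite aA.
rewrite eqSS => /and3P[ss yA sA]; exists (y, s); split => //=.
by rewrite IH ss.
Qed.

End wordsn.

Section blocks.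
Context (S : choiceType) (R : realType).
Variables (pr : S -> S -> R) (nu : S * S -> R) (F : seq (S * S)).
Hypotheses (pr0 : forall x y, 0 <= pr x y) (uF : uniq F)
  (nu0 : forall e, 0 <= nu e) (nuF : forall e, e \notin F -> nu e = 0)
  (nu1 : \sum_(e <- F) nu e = 1)
  (nub : forall phi : S -> R, \sum_(e <- F) nu e * (phi e.1 - phi e.2) = 0)
  (nup : forall e, 0 < nu e -> 0 < pr e.1 e.2).

Definition verts := undup (map fst F ++ map snd F).
Local Notation V := verts.

Definition vmass x := \sum_(y <- V) nu (x, y).

(** Kernel of the stationary chain with edge law [nu]; it vanishes at a vertex of mass 0, where the
    division is by 0. *)
Definition step_kernel x y := nu (x, y) / vmass x.
Local Notation q := step_kernel.

Lemma uniq_verts : uniq V. Proof. exact: undup_uniq. Qed.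

Lemma verts_edge e : e \in F -> (e.1 \in V) && (e.2 \in V).
Proof.
by move=> eF; rewrite !mem_undup !mem_cat (map_f fst eF) (map_f snd eF) orbT.
Qed.

Lemma sum_verts (g : S * S -> R) :
  \sum_(x <- V) \sum_(y <- V) nu (x, y) * g (x, y) = \sum_(e <- F) nu e * g e.
Proof.
rewrite -(@sum_support _ _ F [seq (x, y) | x <- V, y <- V] (fun e => nu e * g e))//.
- by rewrite big_allpairs.
- by apply: allpairs_uniq; rewrite ?uniq_verts// => -[x y] [x' y'] _ _ [-> ->].
- by move=> [x y] /verts_edge/andP[xV yV]; exact: allpairs_f.
- by move=> e /nuF ->; rewrite mul0r.
Qed.

Lemma vmass_ge0 x : 0 <= vmass x. Proof. exact: sumr_ge0. Qed.

Lemma sum_vmass : \sum_(x <- V) vmass x = 1.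
Proof.
rewrite -nu1 -[RHS](eq_bigr _ (fun e _ => mulr1 (nu e))) -(sum_verts (fun=> 1)).
by apply: eq_bigr => x _; apply: eq_bigr => y _; rewrite mulr1.
Qed.

Lemma sum_delta_verts (f : S -> R) x : x \in V ->
  \sum_(y <- V) f y * (y == x)%:R = f x.
Proof.
move=> xV; rewrite (bigD1_seq x)//= ?uniq_verts// eqxx mulr1 big1 ?addr0// => y.
by move=> /negbTE ->; rewrite mulr0.
Qed.

(** The circulation property tested on the indicator of [x]; this is the stationarity of [vmass]. *)
Lemma vmass_in x : x \in V -> \sum_(y <- V) nu (y, x) = vmass x.
Proof.
move=> xV; apply/eqP; rewrite eq_sym -subr_eq0; apply/eqP.
rewrite -[RHS](nub (fun z => (z == x)%:R)).
rewrite -(sum_verts (fun e => (e.1 == x)%:R - (e.2 == x)%:R)) /=.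
rewrite [RHS](eq_bigr (fun z => vmass z * (z == x)%:R - \sum_(y <- V) nu (z, y) * (y == x)%:R)).
  rewrite sumrB sum_delta_verts//; congr (_ - _).
  by apply: eq_bigr => z _; rewrite (sum_delta_verts (fun y => nu (z, y))).
move=> z _; rewrite /vmass mulr_suml -sumrB; apply: eq_bigr => y _.
by rewrite mulrBr.
Qed.

Lemma vmass_step x y : x \in V -> y \in V -> vmass x * q x y = nu (x, y).
Proof.
move=> xV yV; rewrite /q; have [m0|m0] := eqVneq (vmass x) 0; last by field.
rewrite m0 mul0r; apply/esym/eqP; rewrite eq_le nu0 andbT -m0 /vmass.
by rewrite (bigD1_seq y)//= ?uniq_verts// lerDl sumr_ge0.
Qed.

Lemma nu_le_vmass x y : x \in V -> y \in V -> nu (x, y) <= vmass x.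
Proof.
by move=> xV yV; rewrite /vmass (bigD1_seq y)//= ?uniq_verts// lerDl sumr_ge0.
Qed.

Lemma q_ge0 x y : 0 <= q x y. Proof. by rewrite divr_ge0 ?vmass_ge0. Qed.

Lemma q_gt0 x y : 0 < q x y -> 0 < nu (x, y).
Proof.
rewrite /q !lt_neqAle !(eq_sym 0) mulf_eq0 negb_or nu0 andbT.
by move=> /andP[/andP[->]].
Qed.

Lemma wt_q_gt0 x s e : 0 < wt q x s -> e \in edges x s -> 0 < nu e.
Proof.
elim: s x => //= y s IH x; rewrite wt_cons => w0.
have [q0 w1] : 0 < q x y /\ 0 < wt q y s.
  have := q_ge0 x y; have := wt_ge0 y s q_ge0; move: w0.
  rewrite !lt_neqAle !(eq_sym 0) mulf_eq0 negb_or => /andP[/andP[-> ->] _] -> ->//.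
rewrite in_cons => /predU1P[->|]; [exact: q_gt0|exact: IH].
Qed.

Lemma sum_wt_q n x : x \in V -> 0 < vmass x -> \sum_(s <- wordsn V n) wt q x s = 1.
Proof.
elim: n x => [|n IH] x xV m0; first by rewrite big_seq1 wt_nil.
rewrite /= big_allpairs_dep.
rewrite (eq_big_seq (fun y => q x y)); last first.
  move=> y yV; under eq_bigr do rewrite wt_cons; rewrite -mulr_sumr.
  have [->|q0] := eqVneq (q x y) 0; first by rewrite mul0r.
  have qy : 0 < q x y by rewrite lt_neqAle eq_sym q0 q_ge0.
  (* By stationarity a vertex entered with positive probability has positive mass, so the chain
     never stops there. *)
  rewrite IH ?mulr1//; apply: lt_le_trans (q_gt0 qy) _.
  by rewrite -vmass_in// (bigD1_seq x)//= ?uniq_verts// lerDl sumr_ge0.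
by rewrite -mulr_suml mulfV// gt_eqF.
Qed.

(* Q x s is the probability of the word x :: s for the stationary chain. *)
Definition Qword x s := vmass x * wt q x s.

Lemma sum_Qword_fst n (f : S -> R) :
  \sum_(x <- V) \sum_(s <- wordsn V n) Qword x s * f x = \sum_(x <- V) vmass x * f x.
Proof.
apply: eq_big_seq => x xV; under eq_bigr do rewrite /Qword mulrAC.
rewrite -mulr_sumr; have [->|m0] := eqVneq (vmass x) 0; first by rewrite !mul0r.
by rewrite sum_wt_q ?mulr1// lt_neqAle eq_sym m0 vmass_ge0.
Qed.

Lemma sum_Qword n : \sum_(x <- V) \sum_(s <- wordsn V n) Qword x s = 1.
Proof.
rewrite -sum_vmass; have := sum_Qword_fst n (fun=> 1).
under eq_bigr do under eq_bigr do rewrite mulr1.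
by under [RHS]eq_bigr do rewrite mulr1.
Qed.

(** Each step of the stationary chain has law [nu]. The induction splits off the first step and sums
    out the starting vertex with [vmass_in]. *)
Lemma sum_Qword_vsum n (h : S * S -> R) :
  \sum_(x <- V) \sum_(s <- wordsn V n) Qword x s * vsum h x s =
  n%:R * \sum_(e <- F) nu e * h e.
Proof.
elim: n => [|n IH].
  rewrite mul0r big1// => x _; rewrite big_seq1 /vsum big_nil mulr0//.
rewrite -natr1 mulrDl mul1r -IH addrC.
transitivity (\sum_(x <- V) \sum_(y <- V) \sum_(s <- wordsn V n)
    (nu (x, y) * wt q y s * h (x, y) + nu (x, y) * wt q y s * vsum h y s)).
  apply: eq_big_seq => x xV; rewrite /= big_allpairs_dep; apply: eq_big_seq => y yV.
  apply: eq_bigr => s _; rewrite /Qword wt_cons mulrA vmass_step//.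
  by rewrite /vsum big_cons mulrDr.
under eq_bigr do under eq_bigr do rewrite big_split/=.
under eq_bigr do rewrite big_split/=.
rewrite big_split/=; congr (_ + _).
  rewrite -(sum_verts h); apply: eq_big_seq => x xV; apply: eq_big_seq => y yV.
  rewrite -mulr_suml -mulr_sumr; have [->|n0] := eqVneq (nu (x, y)) 0.
    by rewrite !mul0r.
  rewrite sum_wt_q ?mulr1//.
  apply: (@lt_le_trans _ _ (nu (x, y))); first by rewrite lt_neqAle eq_sym n0 nu0.
  by rewrite -vmass_in// (bigD1_seq x)//= ?uniq_verts// lerDl sumr_ge0.
rewrite exchange_big/=; apply: eq_big_seq => y yV.
rewrite exchange_big/=; apply: eq_bigr => s _.
under eq_bigr do rewrite -mulrA; rewrite -mulr_suml vmass_in//.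
by rewrite /Qword mulrA.
Qed.

Definition block_key x s := (last x s, [seq count_mem e (edges x s) | e <- F]).

(** The key counts only the edges of [F]; excluding the others makes it determine every edge sum. *)
Definition blocks_from n x := [seq s <- wordsn V n | all [in F] (edges x s)].

Definition block_weight n x s :=
  \sum_(s' <- blocks_from n x | block_key x s' == block_key x s) wt pr x s'.

(** A start, an end, and for each edge of [F] a count between 0 and [n]. *)
Definition key_number n : R := ((size V) ^ 2 * n.+1 ^ size F)%:R.

Lemma sum_block_ratio n :
  \sum_(x <- V) \sum_(s <- blocks_from n x) wt pr x s / block_weight n x s
  <= key_number n.
Proof.
have h x : x \in V -> \sum_(s <- blocks_from n x) wt pr x s / block_weight n x s
    <= (size V * n.+1 ^ size F)%:R.
  move=> xV; pose ks := [seq (y, c) | y <- V, c <- wordsn (iota 0 n.+1) (size F)].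
  have -> : (size V * n.+1 ^ size F)%N = size ks.
    by rewrite size_allpairs size_wordsn size_iota.
  apply: sum_ratio_le.
  - apply: allpairs_uniq; [exact: uniq_verts|exact/uniq_wordsn/iota_uniq|].
    by move=> [a b] [a' b'] _ _ [-> ->].
  - by move=> s; exact: wt_ge0.
  move=> s; rewrite mem_filter => /andP[aF]; rewrite mem_wordsn => /andP[/eqP sn sV].
  apply: allpairs_f.
    case/lastP: s sn sV {aF} => // s y _.
    by rewrite all_rcons last_rcons => /andP[].
  rewrite mem_wordsn size_map eqxx /=; apply/allP => _ /mapP[e _ ->].
  change (count_mem e (edges x s) \in iota 0 n.+1).
  by rewrite mem_iota ltnS -sn -(size_edges x) count_size.
rewrite big_seq; apply: (@le_trans _ _ (\sum_(x <- V | x \in V) (size V * n.+1 ^ size F)%:R)).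
  by apply: ler_sum => x; exact: h.
rewrite -big_seq big_const_seq count_predT iter_addr_0 -[_ *+ size V]mulr_natr -natrM.
by rewrite /key_number mulnC expnS expn1 mulnA.
Qed.

Lemma wt_le_block_weight n x s : s \in blocks_from n x ->
  wt pr x s <= block_weight n x s.
Proof.
move=> sb; rewrite /block_weight big_mkcond (bigD1_seq s)//= ?filter_uniq ?uniq_wordsn ?uniq_verts//.
rewrite eqxx lerDl sumr_ge0// => s' _; case: ifP => // _; exact: wt_ge0.
Qed.

Lemma Qword_gt0 n x s : s \in wordsn V n -> 0 < Qword x s ->
  [/\ s \in blocks_from n x, 0 < wt pr x s & 0 < wt q x s].
Proof.
move=> sn Q0; have w0 : 0 < wt q x s.
  have := wt_ge0 x s q_ge0; move: Q0; rewrite /Qword !lt_neqAle !(eq_sym 0).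
  by rewrite mulf_eq0 negb_or => /andP[/andP[_ ->] _] ->.
split => //.
  rewrite mem_filter sn andbT; apply/allP => e /(wt_q_gt0 w0) n0.
  by apply: contraTT n0 => /nuF ->; rewrite ltxx.
have : forall e, e \in edges x s -> 0 < pr e.1 e.2.
  by move=> e /(wt_q_gt0 w0)/nup.
rewrite /wt; elim: (edges x s) => [|e l IH] h; first by rewrite big_nil.
rewrite big_cons mulr_gt0 ?h ?mem_head ?IH// => f fl.
by rewrite h// in_cons fl orbT.
Qed.

Lemma vmass_le1 x : x \in V -> vmass x <= 1.
Proof.
move=> xV; rewrite -sum_vmass (bigD1_seq x)//= ?uniq_verts// lerDl sumr_ge0// => *.
exact: vmass_ge0.
Qed.

Lemma key_number_ge1 n : 1 <= key_number n.
Proof.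
rewrite /key_number ler1n muln_gt0 !expn_gt0 /= andbT lt0n size_eq0.
apply/orP; left; apply/eqP => V0; have := sum_vmass.
by rewrite V0 big_nil => /eqP; rewrite eq_sym oner_eq0.
Qed.

Lemma vsum_ln_ratio x s : 0 < wt q x s -> 0 < wt pr x s ->
  vsum (fun e => ln (q e.1 e.2 / pr e.1 e.2)) x s = ln (wt q x s / wt pr x s).
Proof.
rewrite /vsum /wt; have : forall e, 0 <= q e.1 e.2 /\ 0 <= pr e.1 e.2.
  by move=> e; rewrite q_ge0 pr0.
elim: (edges x s) => [|e l IH] h; first by rewrite !big_nil divr1 ln1.
rewrite !big_cons => q_gt p_gt; have [qe pe] := h e.
have pl0 : 0 <= \prod_(f <- l) pr f.1 f.2 by apply: prodr_ge0.
have ql0 : 0 <= \prod_(f <- l) q f.1 f.2 by apply: prodr_ge0 => *; exact: q_ge0.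
have [qe0 ql] : 0 < q e.1 e.2 /\ 0 < \prod_(f <- l) q f.1 f.2.
  move: q_gt; rewrite !lt_neqAle !(eq_sym 0) mulf_eq0 negb_or qe ql0.
  by rewrite !andbT => /andP[/andP[]].
have [pe0 pl] : 0 < pr e.1 e.2 /\ 0 < \prod_(f <- l) pr f.1 f.2.
  move: p_gt; rewrite !lt_neqAle !(eq_sym 0) mulf_eq0 negb_or pe pl0.
  by rewrite !andbT => /andP[/andP[]].
rewrite IH//; have -> : q e.1 e.2 * (\prod_(f <- l) q f.1 f.2) /
    (pr e.1 e.2 * \prod_(f <- l) pr f.1 f.2) =
    q e.1 e.2 / pr e.1 e.2 * (\prod_(f <- l) q f.1 f.2 / \prod_(f <- l) pr f.1 f.2).
  by field; rewrite !gt_eqF.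
by rewrite [RHS]lnM // posrE; exact: divr_gt0.
Qed.

(** Jensen's inequality for the logarithm, in the form [ln u <= u - 1] with
    [u = wt pr / (block_weight * Qword * K)]. The [Qword]-average of [u] is at most 1 because the
    ratios of word weight to group weight sum to at most the number [K] of groups. *)
Lemma block_entropy n :
  - n%:R * (\sum_(e <- F) nu e * ln (q e.1 e.2 / pr e.1 e.2)) - ln (key_number n)
  <= \sum_(x <- V) \sum_(s <- wordsn V n) Qword x s * ln (block_weight n x s).
Proof.
have alg1 (a b c k : R) : b != 0 -> c != 0 -> k != 0 ->
    a / b / k = c * (a / (b * c * k)).
  by move=> b0 c0 k0; field; rewrite b0 c0 k0.
have alg2 (a b c k : R) : b != 0 -> c != 0 -> k != 0 ->
    a / c = a / (b * c * k) * b * k.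
  by move=> b0 c0 k0; field; rewrite b0 c0 k0.
set K := key_number n; have K1 : 1 <= K := key_number_ge1 n.
have K0 : 0 < K by exact: lt_le_trans K1.
pose g e := ln (q e.1 e.2 / pr e.1 e.2).
pose Z x s := if s \in blocks_from n x then wt pr x s / block_weight n x s else 0.
have E : \sum_(x <- V) \sum_(s <- wordsn V n)
     (Qword x s * (- vsum g x s) + Qword x s * (1 - ln K)) =
    - n%:R * (\sum_(e <- F) nu e * g e) + (1 - ln K).
  under eq_bigr do rewrite big_split/= -mulr_suml.
  rewrite big_split/= -mulr_suml sum_Qword mul1r; congr (_ + _).
  rewrite mulNr -sum_Qword_vsum -sumrN; apply: eq_bigr => x _.
  by rewrite -sumrN; apply: eq_bigr => s _; rewrite mulrN.
have -> : - n%:R * (\sum_(e <- F) nu e * g e) - ln K =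
   \sum_(x <- V) \sum_(s <- wordsn V n)
     (Qword x s * (- vsum g x s) + Qword x s * (1 - ln K)) - 1.
  by rewrite E addrA addrAC addrK.
have sZ : \sum_(x <- V) \sum_(s <- wordsn V n) Z x s <= K.
  rewrite /K; apply: le_trans (sum_block_ratio n); apply: ler_sum => x _.
  rewrite big_filter [leRHS]big_mkcond/= big_seq [leRHS]big_seq; apply: ler_sum => s sn.
  by rewrite /Z mem_filter sn andbT; case: ifP.
apply: (@le_trans _ _ (\sum_(x <- V) \sum_(s <- wordsn V n)
     (Qword x s * (- vsum g x s) + Qword x s * (1 - ln K)) -
     (\sum_(x <- V) \sum_(s <- wordsn V n) Z x s) / K)).
  by rewrite lerD2l lerN2 ler_pdivrMr// mul1r.
rewrite mulr_suml -sumrB big_seq [leRHS]big_seq; apply: ler_sum => x xV.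
rewrite mulr_suml -sumrB big_seq [leRHS]big_seq; apply: ler_sum => s sn.
have Z0 : 0 <= Z x s / K.
  rewrite divr_ge0 ?(ltW K0)// /Z; case: ifP => // sb.
  by rewrite divr_ge0 ?wt_ge0// sumr_ge0// => *; exact: wt_ge0.
have [Q0|Q0] := eqVneq (Qword x s) 0; first by rewrite Q0 !mul0r addr0 sub0r oppr_le0.
have Qp : 0 < Qword x s by rewrite lt_neqAle eq_sym Q0 mulr_ge0 ?vmass_ge0// wt_ge0//; exact: q_ge0.
have [sb wp wq] := Qword_gt0 sn Qp.
have Wp : 0 < block_weight n x s by apply: lt_le_trans (wt_le_block_weight sb).
rewrite -mulrDr /Z sb.
have -> : wt pr x s / block_weight n x s / K =
    Qword x s * (wt pr x s / (block_weight n x s * Qword x s * K)).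
  by apply: alg1; rewrite gt_eqF.
rewrite -mulrBr ler_pM2l//.
set u := _ / (_ * _ * K); have u0 : 0 < u.
  by apply: divr_gt0 => //; apply: mulr_gt0 => //; exact: mulr_gt0.
have lnu : ln u <= u - 1.
  by rewrite -[in ln u](subrKC 1 u) le_ln1Dx// ltrBrDl subrr.
have lnuE : ln u = ln (wt pr x s / Qword x s) - ln (block_weight n x s) - ln K.
  have -> : wt pr x s / Qword x s = u * block_weight n x s * K.
    by apply: alg2; rewrite gt_eqF.
  have ub : 0 < u * block_weight n x s by exact: mulr_gt0.
  by rewrite (lnM ub K0) (lnM u0 Wp); lra.
(* [Qword] differs from [wt q] by the factor [vmass x <= 1], so dropping that factor goes in the
   right direction. *)
have lnQ : - vsum g x s <= ln (wt pr x s / Qword x s).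
  rewrite vsum_ln_ratio// -lnV ?posrE ?divr_gt0// invf_div.
  rewrite ler_ln ?posrE ?divr_gt0// ler_pM2l// lef_pV2 ?posrE// /Qword.
  by rewrite ler_piMl ?(ltW wq)// vmass_le1.
by move: lnu lnuE lnQ; lra.
Qed.

Lemma vsum_block n x s s' (h : S * S -> R) : s \in blocks_from n x ->
  s' \in blocks_from n x -> block_key x s' = block_key x s ->
  vsum h x s' = vsum h x s.
Proof.
rewrite !mem_filter => /andP[/allP sF _] /andP[/allP s'F _] [_ key].
rewrite /vsum -(sum_count h uF sF) -(sum_count h uF s'F).
apply: eq_big_seq => e eF; congr (_%:R * _).
have := congr1 (fun l => nth 0%N l (index e F)) key.
by rewrite !(nth_map e) ?index_mem// nth_index.
Qed.

End blocks.

(** * Bundles of words *)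

Section bundles.
Context (S : choiceType) (R : realType).
Variable pr : S -> S -> R.
Implicit Types (M : (S * S -> R) -> R) (w : R) (x y z : S).

(* A bundle is a finite set of words with common start, end, length and edge
   sums, together with its total weight. *)
Definition bundle x y n M w := exists l : seq (seq S),
  [/\ uniq l, all (fun s => size s == n) l,
   forall s, s \in l -> last x s = y /\ (forall h, vsum h x s = M h) &
   w = \sum_(s <- l) wt pr x s].

Lemma bundle_eq x y n n' M M' w w' : bundle x y n M w -> n = n' -> M =1 M' ->
  w = w' -> bundle x y n' M' w'.
Proof.
move=> [l [ul sl hl wl]] <- MM <-; exists l; split => // s /hl[ly h].
by split => // g; rewrite h MM.
Qed.

Lemma bundle_word x s :
  bundle x (last x s) (size s) (fun h => vsum h x s) (wt pr x s).
Proof.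
exists [:: s]; split => //=; [by rewrite eqxx| |by rewrite big_seq1].
by move=> s'; rewrite mem_seq1 => /eqP ->.
Qed.

Lemma bundle_cat x y z n n' M M' w w' : bundle x y n M w -> bundle y z n' M' w' ->
  bundle x z (n + n')%N (fun h => M h + M' h) (w * w').
Proof.
move=> [l [ul sl hl ->]] [l' [ul' sl' hl' ->]].
exists [seq s ++ s' | s <- l, s' <- l']; split.
- apply: allpairs_uniq => // -[a b] [a' b'] /allpairsP[[c d] /= [cl dl [-> ->]]].
  move=> /allpairsP[[c' d'] /= [cl' dl' [-> ->]]] /eqP.
  (* The first words all have the same length, so a concatenation determines both factors and the
     weights multiply. *)
  rewrite eqseq_cat; last by rewrite (eqP (allP sl _ cl)) (eqP (allP sl _ cl')).
  by move=> /andP[/eqP -> /eqP ->].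
- apply/allP => s /allpairsP[[a b] /= [al bl ->]].
  by rewrite size_cat (eqP (allP sl _ al)) (eqP (allP sl' _ bl)).
- move=> s /allpairsP[[a b] /= [/hl[la ha] /hl'[lb hb] ->]].
  by rewrite last_cat la; split => // h; rewrite vsum_cat la ha hb.
rewrite big_allpairs_dep mulr_suml; apply: eq_big_seq => s /hl[ls _].
by rewrite mulr_sumr; apply: eq_bigr => s' _; rewrite wt_cat ls.
Qed.

Lemma bundle_nil x : bundle x x 0 (fun=> 0) 1.
Proof.
apply: bundle_eq (bundle_word x [::]) _ _ _ => //; last by rewrite wt_nil.
by move=> h; rewrite /vsum big_nil.
Qed.

Lemma bundle_iter x n M w k : bundle x x n M w ->
  bundle x x (k * n)%N (fun h => k%:R * M h) (w ^+ k).
Proof.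
move=> b; elim: k => [|k IH].
  by apply: bundle_eq (bundle_nil x) _ _ _ => // h; rewrite mul0r.
apply: bundle_eq (bundle_cat b IH) _ _ _; rewrite ?mulSn ?exprS// => h.
by rewrite -natr1 mulrDl mul1r addrC.
Qed.

(** Reachability with the empty word allowed, hence reflexive, as needed to sort loops that share a
    base point. *)
Definition linked x y := exists2 s, last x s = y & 0 < wt pr x s.

(** The words leading from one base point to the next are chosen once, before the numbers of turns
    [k]. Their total length, weight and edge sums are therefore constants, while [k] stays free. *)
Lemma schedule (I : eqType) (bx : I -> S) (bn : I -> nat)
  (bM : I -> (S * S -> R) -> R) (bw : I -> R) (L : seq I) x :
  (forall i, i \in L -> bundle (bx i) (bx i) (bn i) (bM i) (bw i)) ->
  path (fun a b => `[< linked a b >]) x (map bx L) ->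
  exists y C0 c0 Mc, [/\ 0 < c0,
    forall h (B : R), (forall u, `|h u| <= B) -> `|Mc h| <= B * C0%:R &
    forall k : I -> nat, bundle x y (\sum_(i <- L) k i * bn i + C0)%N
      (fun h => \sum_(i <- L) (k i)%:R * bM i h + Mc h)
      (c0 * \prod_(i <- L) bw i ^+ k i)].
Proof.
elim: L x => [|i L IH] x hL /=.
  move=> _; exists x, 0%N, 1, (fun=> 0); split => //.
    by move=> h B _; rewrite normr0 mulr0.
  move=> k; apply: bundle_eq (bundle_nil x) _ _ _ => [|h|].
  - by rewrite big_nil.
  - by rewrite big_nil addr0.
  - by rewrite big_nil mulr1.
move=> /andP[/asboolP[s ls ws] pL].
have [|y [C0 [c0 [Mc [c00 hMc hk]]]]] := IH (bx i) _ pL.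
  by move=> j jL; apply: hL; rewrite in_cons jL orbT.
exists y, (size s + C0)%N, (wt pr x s * c0), (fun h => vsum h x s + Mc h); split.
- exact: mulr_gt0.
- move=> h B hB; rewrite (le_trans (ler_normD _ _))// natrD mulrDr lerD ?hMc//.
  exact: vsum_le.
move=> k; have bs := bundle_word x s; rewrite ls in bs.
have bi := bundle_iter (k i) (hL i (mem_head _ _)).
apply: bundle_eq (bundle_cat bs (bundle_cat bi (hk k))) _ _ _.
- by rewrite big_cons; lia.
- by move=> h; rewrite big_cons; ring.
- by rewrite big_cons; ring.
Qed.

End bundles.

(** * Probability of following a schedule of loops *)

Section schedule_bound.
Context dO (Omega : measurableType dO) d (S : measurableType d) (R : realType).
Variables (P : probability Omega R) (beta : probability S R) (p : R.-pker S ~> S).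
Variable X : nat -> {RV P >-> S}.
Hypotheses (hS : discrete S) (hX : markov_chain beta p X).
Let hS2 := discrete_prod hS.
Variables (I : eqType) (bx : I -> S) (bn : I -> nat)
  (bM : I -> (S * S -> R) -> R) (bw : I -> R) (L : seq I) (z : S) (al : I -> R).
Hypotheses (bz : 0 < mass beta z)
  (hL : forall i, i \in L -> bundle (pr p) (bx i) (bx i) (bn i) (bM i) (bw i))
  (pL : path (fun a b => `[< linked (pr p) a b >]) z (map bx L))
  (bw0 : forall i, i \in L -> 0 < bw i)
  (al0 : forall i, 0 <= al i)
  (al1 : \sum_(i <- L) al i * (bn i)%:R = 1).

Lemma truncn_dist (a : R) (c t : nat) : 0 <= a ->
  `|(Num.truncn (a * t%:R))%:R - a * (t + c)%:R| <= 1 + a * c%:R.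
Proof.
move=> a0; have /truncn_itv/andP[h1 h2] : 0 <= a * t%:R by rewrite mulr_ge0.
have aux (u v w : R) : 0 <= w -> u <= v -> v < u + 1 -> `|u - (v + w)| <= 1 + w.
  by move=> *; rewrite ler_norml; apply/andP; split; lra.
by rewrite natrD mulrDr; apply: aux => //; [rewrite mulr_ge0|rewrite natr1].
Qed.

(** [al i] is the number of turns of loop [i] per unit of time, so time [t] takes the integer part
    of [al i * t] turns. Rounding, the linking words and the unfinished end have bounded effect,
    which vanishes after division by [n.+1]. *)
Lemma schedule_lower_bound k (V : nat -> S * S -> R) (B e eps : R) (c : nat -> R) :
  (forall i u, `|V i u| <= B) ->
  (forall j, (j < k)%N -> `|\sum_(i <- L) al i * bM i (V j) - c j| < e) ->
  0 < eps -> \forall n \near \oo,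
  ((expR (n.+1%:R * (\sum_(i <- L) al i * ln (bw i) - eps)))%:E <=
   P (L2 X n @^-1` [set nu | forall j, (j < k)%N -> (`|pairing nu (V j) - c j| < e)%R]))%E.
Proof.
move=> hB hc eps0.
have [y [C0 [c0 [Mc [c00 hMc hk]]]]] := schedule hL pL.
pose A (g : I -> R) : R := \sum_(i <- L) al i * g i.
pose D (g : I -> R) : R := \sum_(i <- L) (1 + al i * C0%:R) * `|g i|.
pose kk t i := Num.truncn (al i * t%:R : R).
have kkA t g : `|\sum_(i <- L) (kk t i)%:R * g i - (t + C0)%:R * A g| <= D g.
  rewrite /A mulr_sumr -sumrB; apply: le_trans (ler_norm_sum _ _ _) _.
  apply: ler_sum => i _; rewrite mulrA -mulrBl normrM ler_wpM2r//.
  by rewrite [_ * al i]mulrC truncn_dist.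
have len_le t : (\sum_(i <- L) kk t i * bn i <= t)%N.
  rewrite -(ler_nat R) natr_sum -[leRHS]mul1r -[X in _ <= X * _]al1 mulr_suml; apply: ler_sum => i _.
  rewrite natrM mulrAC ler_wpM2r//.
  by have /truncn_itv/andP[] : 0 <= al i * t%:R by rewrite mulr_ge0.
have len_ge t : (t%:R : R) - (\sum_(i <- L) kk t i * bn i)%N%:R <= (\sum_(i <- L) bn i)%N%:R.
  rewrite !natr_sum -[X in X - _]mul1r -[X in X * _ - _]al1 mulr_suml -sumrB; apply: ler_sum => i _.
  rewrite natrM mulrAC -mulrBl ler_piMl//.
  have /truncn_itv/andP[_] : 0 <= al i * t%:R by rewrite mulr_ge0.
  by rewrite -natr1 /kk; lra.
(* The bundle fixes only a prefix. The free end has at most one full turn of every loop as length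
   and costs at most [B] per step. *)
have word_bound j t s : size s = (t + C0)%N ->
    (exists2 l : seq (seq S), take (\sum_(i <- L) kk t i * bn i + C0)%N s \in l &
      forall s, s \in l -> last z s = y /\ (forall h, vsum h z s =
        \sum_(i <- L) (kk t i)%:R * bM i h + Mc h)) ->
    `|vsum (V j) z s - (t + C0)%:R * A (fun i => bM i (V j))| <=
      D (fun i => bM i (V j)) + B * C0%:R + B * (\sum_(i <- L) bn i)%N%:R.
  move=> ss [l sl hl]; set len := (_ + C0)%N in sl.
  rewrite -{1}(cat_take_drop len s) vsum_cat (hl _ sl).2 (hl _ sl).1.
  have b1 := kkA t (fun i => bM i (V j)).
  have b2 := hMc _ _ (hB j).
  have B0 : 0 <= B by apply: le_trans (hB 0%N point).
  have b3 : `|vsum (V j) y (drop len s)| <= B * (\sum_(i <- L) bn i)%N%:R.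
    apply: (le_trans (vsum_le _ _ (hB j))); rewrite ler_wpM2l//.
    rewrite size_drop ss /len subnDr natrB ?len_le//.
  move: b1 b2 b3; set u1 := \sum_(i <- L) _; set u2 := Mc _; set u3 := vsum _ _ _.
  set u4 := _ * A _ => b1 b2 b3.
  have -> : u1 + u2 + u3 - u4 = (u1 - u4) + u2 + u3 by ring.
  by rewrite (le_trans (ler_normD _ _))// lerD// (le_trans (ler_normD _ _))// lerD.
have near_pairing m : \forall n \near \oo, (C0 <= n.+1)%N /\ forall j, (j < m)%N -> (j < k)%N ->
    n.+1%:R^-1 * (D (fun i => bM i (V j)) + B * C0%:R + B * (\sum_(i <- L) bn i)%N%:R)
    < e - `|A (fun i => bM i (V j)) - c j|.
  elim: m => [|m IH].
    by exists C0 => // n /= Cn; split => //; exact: leq_trans Cn _.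
  have [mk|mk] := boolP (m < k)%N; last first.
    move: IH; apply: filterS => n [h1 h2]; split => // j; rewrite ltnS leq_eqVlt.
    by move=> /predU1P[->|/h2//]; rewrite (negbTE mk).
  set K := D (fun i => bM i (V m)) + B * C0%:R + B * (\sum_(i <- L) bn i)%N%:R.
  have gap : 0 < e - `|A (fun i => bM i (V m)) - c m| by rewrite subr_gt0 hc.
  have K1 : 0 < `|K| + 1 by rewrite ltr_wpDl.
  move: IH (near_invn (divr_gt0 gap K1)); apply: filterS2 => n [h1 h2] h3.
  split => // j; rewrite ltnS leq_eqVlt => /predU1P[-> _|/h2//].
  rewrite -/K (@le_lt_trans _ _ (n.+1%:R^-1 * `|K|))//.
    by rewrite ler_wpM2l ?invr_ge0// ler_norm.
  apply: lt_le_trans (_ : n.+1%:R^-1 * (`|K| + 1) <= _); last by rewrite -ler_pdivlMr.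
  by rewrite ltr_pM2l ?invr_gt0 ?ltr0n// ltrDl.
have near_weight : \forall n \near \oo,
    n.+1%:R^-1 * (D (fun i => ln (bw i)) + `|ln (mass beta z * c0)|) <= eps.
  set K := _ + _; have K1 : 0 < `|K| + 1 by rewrite ltr_wpDl.
  move: (near_invn (divr_gt0 eps0 K1)); apply: filterS => n h3.
  apply: (@le_trans _ _ (n.+1%:R^-1 * (`|K| + 1))); last by rewrite -ler_pdivlMr.
  by rewrite ler_wpM2l ?invr_ge0// (le_trans (ler_norm _))// lerDl.
move: (near_pairing k) near_weight; apply: filterS2 => n [Cn hn] hw.
pose t := (n.+1 - C0)%N; have tC : (t + C0)%N = n.+1 by rewrite subnK.
have [l [ul sl hl wl]] := hk (kk t).
have lenN : (\sum_(i <- L) kk t i * bn i + C0 <= n.+1)%N.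
  by rewrite -tC leq_add2r len_le.
apply: le_trans (prob_words_le hS hX (x := z) _ ul sl _); last 2 first.
- exact: measurable_L2.
- move=> w X0 tl j jk; rewrite pairing_L2//; last first.
    apply/bounded_funP; exists (`|B| + 1) => [|u]; first by rewrite ltr_wpDl.
    by rewrite (le_trans (hB j u))// (le_trans (ler_norm _))// lerDl.
  rewrite X0; have := @word_bound j t (traj X n.+1 w).
  rewrite size_traj tC => /(_ erefl)/(_ _)/le_trans wb.
  set a := A (fun i => bM i (V j)) in hn wb *.
  have n0 : n.+1%:R != 0 :> R by rewrite pnatr_eq0.
  have -> : n.+1%:R^-1 * vsum (V j) z (traj X n.+1 w) - c j =
    n.+1%:R^-1 * (vsum (V j) z (traj X n.+1 w) - n.+1%:R * a) + (a - c j).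
    by rewrite mulrBr mulKf// addrA subrK.
  apply: le_lt_trans (ler_normD _ _) _; rewrite -ltrBrDr.
  apply: le_lt_trans (hn j jk jk); rewrite normrM ger0_norm ?invr_ge0//.
  rewrite ler_wpM2l ?invr_ge0//; apply: wb => //.
  by exists l => //; rewrite take_traj.
rewrite lee_fin -wl.
have -> : \prod_(i <- L) bw i ^+ kk t i = expR (\sum_(i <- L) (kk t i)%:R * ln (bw i)).
  rewrite expR_sum; apply: eq_big_seq => i iL.
  by rewrite expRM_natl lnK// posrE bw0.
rewrite mulrA -[mass beta z * c0]lnK ?posrE ?mulr_gt0// -expRD ler_expR.
have := kkA t (fun i => ln (bw i)); rewrite tC ler_norml => /andP[h1 _].
have n0 : (0 : R) < n.+1%:R by rewrite ltr0n.
move: hw; rewrite ler_pdivrMl// => hw.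
have := ler_norm (- ln (mass beta z * c0)); rewrite normrN.
move: h1 hw; rewrite mulrBr -/(A (fun i => ln (bw i))).
set u1 := n.+1%:R * A _; set u2 := n.+1%:R * eps; set u3 := D _.
set u4 := \sum_(i <- L) _; set u5 := ln (mass _ _ * _); set u6 := `|u5|.
by lra.
Qed.

End schedule_bound.

(** * Normalized circulations close to [mu] *)

Section approx.
Context d (S : measurableType d) (R : realType).
Hypothesis hS : discrete S.
Variables (mu : probability (S * S)%type R) (p : R.-pker S ~> S).
Hypothesis bal : balanced mu.
Let hS2 := discrete_prod hS.
Local Notation m := (mass mu).
Local Notation pr := (pr p).
Local Notation rho := (ref_density mu p).

(* Chain rule for nu <= mu: ln (nu / (nu1 p)) <= ln (mu / (mu1 p)) + ln (mu1 / nu1),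
   and the last term is at most mu1 / nu1 - 1. *)
Lemma flow_entropy_le (nu : S * S -> R) (F : seq (S * S)) : uniq F ->
  (forall e, 0 <= nu e <= m e) -> (forall e, e \notin F -> nu e = 0) ->
  (forall e, rho e = 0 -> m e = 0) ->
  \sum_(e <- F) nu e * ln (step_kernel nu F e.1 e.2 / pr e.1 e.2) <=
  \sum_(e <- F) log_density mu rho e * nu e + (1 - \sum_(e <- F) nu e).
Proof.
move=> uF hnu nuF ac; set V := verts F.
have nu0 e : 0 <= nu e by case/andP: (hnu e).
pose v := vmass nu F.
apply: (@le_trans _ _ (\sum_(e <- F) (log_density mu rho e * nu e +
    nu e * (marginal mu e.1 / v e.1 - 1)))).
  rewrite big_seq [leRHS]big_seq; apply: ler_sum => e eF.
  have [->|n0] := eqVneq (nu e) 0; first by rewrite !mul0r mulr0 addr0.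
  have np : 0 < nu e by rewrite lt_neqAle eq_sym n0 nu0.
  rewrite [_ * nu e]mulrC -mulrDr ler_pM2l//.
  have mp : 0 < m e by apply: lt_le_trans np _; case/andP: (hnu e).
  have rp := rho_gt0 (ref_density_ge0 mu p) ac mp.
  have /andP[e1 e2] := verts_edge eF.
  have vp : 0 < v e.1.
    apply: lt_le_trans np _; rewrite {1}[e]surjective_pairing.
    exact: nu_le_vmass.
  have Mp : 0 < marginal mu e.1.
    apply: lt_le_trans mp _; rewrite {1}[e]surjective_pairing.
    exact: mass_le_marginal.
  have pp : 0 < pr e.1 e.2.
    by move: rp; rewrite /ref_density pmulr_rgt0.
  have lnu : ln (marginal mu e.1 / v e.1) <= marginal mu e.1 / v e.1 - 1.
    by rewrite -[in ln _](subrKC 1 (_ / _)) le_ln1Dx// ltrBrDl subrr divr_gt0.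
  apply: le_trans (lerD (lexx _) lnu).
  rewrite /log_density -lnM ?posrE; [|exact: divr_gt0|exact: divr_gt0].
  rewrite /step_kernel -surjective_pairing -/v.
  rewrite ler_ln ?posrE; [|by rewrite !divr_gt0|by rewrite mulr_gt0 ?divr_gt0].
  have -> : m e / rho e * (marginal mu e.1 / v e.1) = m e / v e.1 / pr e.1 e.2.
    by rewrite /ref_density; field; rewrite !gt_eqF.
  rewrite ler_pM2r ?invr_gt0// ler_pM2r ?invr_gt0//.
  by case/andP: (hnu e).
rewrite big_split/= lerD2l.
rewrite -(sum_verts uF nuF (fun e => marginal mu e.1 / v e.1 - 1)) /=.
have -> : \sum_(e <- F) nu e = \sum_(x <- V) v x.
  rewrite (eq_bigr (fun e => nu e * 1)) => [|e _]; last by rewrite mulr1.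
  rewrite -(sum_verts uF nuF (fun=> 1)); apply: eq_bigr => x _.
  by apply: eq_bigr => y _; rewrite mulr1.
(* Summed over end points, the weight of [marginal mu x / v x - 1] is [v x], which gives the
   difference; where [v x = 0] the left term is 0. *)
apply: (@le_trans _ _ (\sum_(x <- V) (marginal mu x - v x))).
  apply: ler_sum => x _; rewrite -mulr_suml -[\sum_(y <- V) _]/(v x).
  have v0 : 0 <= v x by exact: vmass_ge0.
  have [->|vn] := eqVneq (v x) 0.
    by rewrite mul0r subr0 marginal_ge0.
  by rewrite mulrBr mulr1 mulrC divfK.
by rewrite sumrB lerD2r sum_marginal_le1// uniq_verts.
Qed.

Lemma flow_approx (r delta : R) : 0 < delta -> (R2 p mu < r%:E)%E ->
  exists (nu : S * S -> R) (F : seq (S * S)),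
  [/\ uniq F, forall e, 0 <= nu e, forall e, e \notin F -> nu e = 0,
    \sum_(e <- F) nu e = 1 &
   [/\ forall phi : S -> R, \sum_(e <- F) nu e * (phi e.1 - phi e.2) = 0,
    forall e, 0 < nu e -> 0 < m e /\ 0 < pr e.1 e.2,
    \sum_(e <- F) nu e * ln (step_kernel nu F e.1 e.2 / pr e.1 e.2) <= r + 4 * delta &
    forall (V : S * S -> R) B, (forall u, `|V u| <= B) ->
      `|pairing mu V - \sum_(e <- F) nu e * V e| <= B * delta]].
Proof.
move=> d0; rewrite (R2E hS); case: asboolP => // ac /ltW hr.
(* [K] comes first, so that [K^-1 <= delta]; [eps] is then small enough to absorb [ln K]. After
   multiplication by [s], the missing mass [1 - s] appears with a factor at most [C + 2 * delta],
   and twice in the error on pairings. *)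
pose K := delta^-1 + 1; have K1 : 1 <= K by rewrite lerDr invr_ge0 ltW.
have K0 : 0 < K by exact: lt_le_trans K1.
pose C := ln K + 1 + `|r| + 2 * delta.
have C0 : 0 < C.
  have := ln_ge0 K1; have := normr_ge0 r; rewrite /C; move: d0; lra.
have C4 : 0 < C + C + 4 by move: C0; lra.
pose eps := Num.min (2^-1) (delta / (C + C + 4)).
have eps0 : 0 < eps.
  by rewrite lt_min invr_gt0 ltr0n/= divr_gt0.
have [nu0 [F [uF hnu nuF snu bnu]]] := cycle_approx hS bal eps0.
pose s := \sum_(e <- F) nu0 e.
have s1 : s <= 1.
  apply: le_trans (sum_mass_le1 hS2 mu uF); apply: ler_sum => e _.
  by case/andP: (hnu e).
have eps2 : eps <= 2^-1 by rewrite ge_min lexx.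
have epsd : eps * (C + C + 4) <= delta.
  by rewrite -ler_pdivlMr// ge_min lexx orbT.
have snu' : 1 - eps < s := snu.
have s0 : 0 < s by move: snu' eps2; lra.
have n0 e : 0 <= nu0 e by case/andP: (hnu e).
(* The kernel is homogeneous of degree 0, so normalization only divides the entropy sum by [s]. *)
have skE x y : step_kernel (fun e => nu0 e / s) F x y = step_kernel nu0 F x y.
  rewrite /step_kernel /vmass -mulr_suml.
  have [->|v0] := eqVneq (\sum_(z <- verts F) nu0 (x, z)) 0.
    by rewrite mul0r !invr0 !mulr0.
  by field; rewrite v0 gt_eqF.
exists (fun e => nu0 e / s), F; split => //.
- by move=> e; rewrite divr_ge0 ?(ltW s0).
- by move=> e /nuF ->; rewrite mul0r.
- by rewrite -mulr_suml mulfV// gt_eqF.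
split.
- move=> phi; under eq_bigr do rewrite mulrAC.
  by rewrite -mulr_suml bnu mul0r.
- move=> e; rewrite pmulr_lgt0 ?invr_gt0// => e0.
  have mp : 0 < m e by apply: lt_le_trans e0 _; case/andP: (hnu e).
  split => //; have := rho_gt0 (ref_density_ge0 mu p) ac mp.
  rewrite /ref_density pmulr_rgt0//; apply: lt_le_trans mp _.
  by rewrite {1}[e]surjective_pairing; exact: mass_le_marginal.
- have h1 := flow_entropy_le uF hnu nuF ac.
  have h2 := log_density_truncated hS2 (ref_density_ge0 mu p)
    (sum_ref_density_le1 hS mu p) ac K1 uF (fun e _ => hnu e) hr.
  have Kd : K^-1 <= delta.
    by rewrite -[leRHS]invrK lef_pV2 ?posrE ?invr_gt0// lerDl.
  set H := \sum_(e <- F) nu0 e * _ in h1.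
  have -> : \sum_(e <- F) nu0 e / s *
      ln (step_kernel (fun e => nu0 e / s) F e.1 e.2 / pr e.1 e.2) = H / s.
    by rewrite mulr_suml; apply: eq_bigr => e _; rewrite skE mulrAC.
  rewrite -/s in h1 h2; rewrite ler_pdivrMr//.
  have lnK := ln_ge0 K1.
  have es : 0 <= 1 - s <= eps by move: snu' s1; lra.
  have h3 : (1 - s) * (C + 2 * delta) <= eps * (C + C + 4).
    have /andP[q1 q2] := es; apply: ler_pM => //; first by move: C0 d0; lra.
    by have := normr_ge0 r; rewrite /C; move: d0 lnK; lra.
  have h4 : (1 - s) * r <= (1 - s) * `|r|.
    by rewrite ler_wpM2l ?ler_norm//; case/andP: es.
  move: h1 h2 h3 h4 epsd Kd; rewrite /C; move: d0 s1 => d0' s1'.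
  move: (ln K) (`|r|) K^-1 (eps * _) => lK ar Ki ec; lra.
- move=> V B hB; have B0 : 0 <= B by apply: le_trans (hB point).
  have h1 := pairing_approx hS2 uF hB (fun e _ => hnu e).
  set A := \sum_(e <- F) nu0 e * V e in h1.
  have -> : \sum_(e <- F) nu0 e / s * V e = A / s.
    by rewrite mulr_suml; apply: eq_bigr => e _; rewrite mulrAC.
  have hA : `|A| <= B * s.
    rewrite /A (le_trans (ler_norm_sum _ _ _))// mulr_sumr; apply: ler_sum => e _.
    by rewrite normrM ger0_norm// mulrC ler_wpM2r.
  have h2 : `|A - A / s| <= B * (1 - s).
    have -> : A - A / s = (A / s) * (s - 1) by field; rewrite gt_eqF.
    rewrite normrM [`|s - 1|]distrC (ger0_norm (_ : 0 <= 1 - s)) ?subr_ge0//.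
    by rewrite ler_wpM2r ?subr_ge0// normrM normfV (gtr0_norm s0) ler_pdivrMr.
  have -> : pairing mu V - A / s = (pairing mu V - A) + (A - A / s) by ring.
  apply: (le_trans (ler_normD _ _)); apply: le_trans (lerD h1 h2) _.
  have eC : 0 <= eps * C by apply: mulr_ge0; exact: ltW.
  rewrite -mulrDr ler_wpM2l// -/s; move: snu' epsd eC eps0.
  by rewrite !mulrDr; move: (eps * C) => ec; lra.
Qed.

End approx.

(** * The lower bound *)

(** With [n = m * (m + 2)] one has [n + 1 = (m + 1) ^ 2], whose logarithm is at most [2 * m], while
    [delta * n] is quadratic in [m]. *)
Lemma ln_polynomial_small (R : realType) (a b : nat) (C delta : R) : (0 < a)%N ->
  0 < delta -> exists2 n : nat, (0 < n)%N &
    ln ((a ^ 2 * n.+1 ^ b)%N%:R) + C <= delta * n%:R.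
Proof.
move=> a0 d0; pose C3 : R := 2 * ln a%:R + 2 * b%:R + `|C|.
have lna : 0 <= ln a%:R :> R by rewrite ln_ge0// ler1n.
have b0 : 0 <= b%:R :> R by [].
pose m := (Num.truncn (C3 / delta)).+1.
have hm : C3 <= delta * m%:R.
  by rewrite mulrC -ler_pdivrMr// ltW// truncnS_gt.
have m1 : (1 : R) <= m%:R by rewrite ler1n.
exists (m * m.+2)%N; first by rewrite muln_gt0.
have -> : (m * m.+2).+1 = (m.+1 ^ 2)%N by lia.
have -> : ln ((a ^ 2 * (m.+1 ^ 2) ^ b)%N%:R : R) =
    2 * ln a%:R + (2 * b)%N%:R * ln m.+1%:R.
  rewrite natrM -expnM !natrX lnM ?posrE ?exprn_gt0 ?ltr0n//.
  rewrite !lnXn ?ltr0n//.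
  by rewrite -[ln a%:R *+ 2]mulr_natl -[ln _ *+ (2 * b)]mulr_natl.
have lnm : ln (m.+1%:R : R) <= m%:R.
  by rewrite -natr1 addrC le_ln1Dx// (lt_le_trans _ (ler0n _ _)).
have h1 : (2 * b)%N%:R * ln (m.+1%:R : R) <= 2 * (b%:R * m%:R).
  by rewrite natrM -mulrA ler_pM2l ?ltr0n//; apply: ler_wpM2l.
have h2 : 2 * ln a%:R + 2 * (b%:R * m%:R) + C <= C3 * m%:R.
  rewrite /C3 !mulrDl -!mulrA; have := ler_norm C.
  have : ln a%:R * 1 <= ln a%:R * m%:R :> R by rewrite ler_wpM2l.
  have : `|C| * 1 <= `|C| * m%:R by rewrite ler_wpM2l.
  by rewrite !mulr1; move: (ln a%:R * _) (`|C| * _) (b%:R * _) => x y w; lra.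
have h3 : C3 * m%:R <= delta * (m * m.+2)%:R.
  rewrite natrM mulrA; apply: (@le_trans _ _ (delta * m%:R * m%:R)).
    by rewrite ler_wpM2r.
  by rewrite ler_wpM2l ?mulr_ge0 ?(ltW d0)// ler_nat -addn2 leq_addr.
by apply: le_trans h3; apply: le_trans h2; rewrite lerD2r lerD2l.
Qed.

(** Here [nn] is the block length, [lE] the mean length of the closing words, [N] that of a loop,
    [A] the [nu]-average of a test function, [Ec] the mean share of the closing words and [pm] the
    target pairing. Blocks are so long that closing them shifts the average by at most [delta]. *)
Lemma block_average (R : realFieldType) (nn lE N A Ec pm B C delta e : R) :
  N = nn + lE -> 0 < N -> 0 <= lE <= C -> `|A| <= B -> `|Ec| <= B * C ->
  `|pm - A| <= B * delta -> B * C + B * C <= delta * nn -> 0 <= delta ->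
  (B + 1) * delta < e -> `|(nn * A + Ec) / N - pm| < e.
Proof.
move=> NE N0 /andP[lE0 lEC] hA hEc hpm hB d0 he.
have -> : (nn * A + Ec) / N - pm = (Ec - lE * A) / N - (pm - A).
  have -> : nn = N - lE by rewrite NE addrK.
  by field; rewrite gt_eqF.
have h : `|lE * A| <= B * C.
  by rewrite normrM ger0_norm// mulrC; apply: ler_pM.
have h2 : `|(Ec - lE * A) / N| <= delta.
  rewrite normrM normfV (gtr0_norm N0) ler_pdivrMr//.
  apply: le_trans (ler_normB _ _) _; apply: le_trans (lerD hEc h) _.
  by apply: le_trans hB _; rewrite ler_wpM2l// NE lerDl.
apply: le_lt_trans (ler_normB _ _) _; move: he; rewrite mulrDl mul1r.
by apply: le_lt_trans; rewrite addrC lerD.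
Qed.

(** Same notation, with [EW] the mean logarithm of the group weights, [lk] that of the number of
    groups and [H] the entropy of [nu]. Grouping and closing are paid by the multiples of [delta]
    added to [H]. *)
Lemma block_rate (R : realFieldType) (nn lE N EW Ec lk H C delta r : R) :
  N = nn + lE -> 0 < N -> 0 <= lE <= C -> `|Ec| <= C -> - nn * H - lk <= EW ->
  lk + (`|H| * C + C) <= delta * nn -> 0 <= delta -> H <= r + 4 * delta ->
  - (r + 6 * delta) <= (EW + Ec) / N.
Proof.
move=> NE N0 /andP[lE0 lEC] hEc hEW hn d0 hH.
rewrite ler_pdivlMr//.
have h1 : (H + 2 * delta) * N <= (r + 6 * delta) * N.
  by rewrite ler_wpM2r ?(ltW N0)//; lra.
have h2 : - (lE * H) <= `|H| * C.
  apply: (le_trans (ler_norm _)).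
  by rewrite normrN normrM ger0_norm// mulrC ler_wpM2l.
have h3 : delta * nn <= delta * N by rewrite ler_wpM2l// NE lerDl.
have h4 : nn * H = N * H - lE * H by rewrite NE; ring.
move: hEc; rewrite ler_norml => /andP[hEc _].
have h5 : 0 <= delta * N by rewrite mulr_ge0 ?(ltW N0).
move: h1 hEW hn h2 h3 h5; rewrite mulNr h4 !mulrDl.
by move: (`|H| * C) (lE * H) => x y; lra.
Qed.

(** * Connecting words *)

Section linked.
Context d (S : measurableType d) (R : realType) (p : R.-pker S ~> S).
Hypothesis hS : discrete S.
Local Notation linked := (linked (pr p)).

Lemma linked_refl x : linked x x.
Proof. by exists [::]; rewrite ?wt_nil. Qed.

Lemma linked_trans y x z : linked x y -> linked y z -> linked x z.
Proof.
move=> [s <- ws] [t <- wt']; exists (s ++ t); first by rewrite last_cat.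
by rewrite wt_cat mulr_gt0.
Qed.

Lemma reach_linked x y : reach p x y -> linked x y.
Proof. by move=> /(reachP p hS)[s [_ sy ws]]; exists s. Qed.

(** The way back is built edge by edge. It applies to words over edges charged by an admissible
    measure, whose ends reach each other. *)
Lemma linked_back x s :
  (forall e, e \in edges x s -> reach p e.2 e.1) -> linked (last x s) x.
Proof.
elim: s x => [|y s IH] x h; first exact: linked_refl.
apply: (linked_trans (y := y)).
  by apply: IH => e es; apply: h; rewrite in_cons es orbT.
by apply: reach_linked; apply: (h (x, y)); rewrite mem_head.
Qed.

(** The choice depends on the end points only, so finitely many connectors occur and their cost does
    not grow with the block length. *)
Definition connector x y : seq S :=
  if pselect (linked x y) is left h then s2val (cid2 h) else [::].

Lemma connectorP x y : linked x y ->
  last x (connector x y) = y /\ 0 < wt (pr p) x (connector x y).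
Proof.
by move=> h; rewrite /connector; case: pselect => // h'; case: cid2.
Qed.

End linked.

Section lower_bound.
Context dO (Omega : measurableType dO) d (S : measurableType d) (R : realType).
Variables (P : probability Omega R) (beta : probability S R) (p : R.-pker S ~> S).
Variable X : nat -> {RV P >-> S}.
Hypotheses (hS : discrete S) (hX : markov_chain beta p X).
Let hS2 := discrete_prod hS.
Variable mu : probability (S * S)%type R.
Hypothesis adm : adm_bal beta p mu.
Local Notation linked := (linked (pr p)).

Lemma neighborhood_lower_bound k (V : nat -> S * S -> R) (B e c : R) :
  0 < B -> 0 < e -> (forall i u, `|V i u| <= B) -> (R2 p mu < c%:E)%E ->
  \forall n \near \oo,
  ((expR (n.+1%:R * - c))%:E <=
   P (L2 X n @^-1` [set nu | forall j, (j < k)%N ->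
     (`|pairing nu (V j) - pairing mu (V j)| < e)%R]))%E.
Proof.
move=> B0 e0 hB /lte_real_dense[r /andP[hr]]; rewrite lte_fin => rc.
have [/(admissibleP _ _ hS)[A1 A2 A3] bal] := adm.
(* Six multiples of [delta] are lost in [block_rate] and one in [schedule_lower_bound]; the second
   term gives [(B + 1) * delta < e] for [block_average]. *)
pose delta := Num.min ((c - r) / 7) (e / (B + 2)).
have B2 : 0 < B + 2 by rewrite addr_gt0.
have d0 : 0 < delta.
  rewrite /delta lt_min; apply/andP; split; apply: divr_gt0 => //.
  by rewrite subr_gt0.
have d1 : r + 7 * delta <= c.
  have : delta <= (c - r) / 7 by rewrite ge_min lexx.
  lra.
have d2 : (B + 1) * delta < e.
  have : delta * (B + 2) <= e by rewrite -ler_pdivlMr// ge_min lexx orbT.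
  by rewrite mulrDr mulrDl; move: d0; lra.
have [nu [F [uF nu0 nuF nu1 [nub nup nuH nuV]]]] := flow_approx hS bal d0 hr.
have pr0 := pr_ge0 p.
have nupr e' : 0 < nu e' -> 0 < pr p e'.1 e'.2 by case/nup.
pose VV := verts F; pose Q := Qword nu F.
have Q0 x s : 0 <= Q x s.
  by apply: mulr_ge0; [exact: vmass_ge0|apply: wt_ge0; exact: q_ge0].
pose cn x s : seq S := connector p (last x s) x.
pose C := \sum_(x <- VV) \sum_(y <- VV)
  ((size (connector p y x))%:R + `|ln (wt (pr p) y (connector p y x))|) : R.
have hC x y : x \in VV -> y \in VV -> (size (connector p y x))%:R <= C /\
    `|ln (wt (pr p) y (connector p y x))| <= C.
  move=> xV yV; set u : R := (size _)%:R; set v : R := `|ln (wt _ _ _)|.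
  have u0 : 0 <= u by [].
  have v0 : 0 <= v by exact: normr_ge0.
  have : u + v <= C.
    rewrite /C (bigD1_seq x)//= ?uniq_verts// (bigD1_seq y)//= ?uniq_verts//.
    rewrite -addrA lerDl addr_ge0//; first by apply: sumr_ge0 => *; rewrite addr_ge0.
    by apply: sumr_ge0 => *; apply: sumr_ge0 => *; rewrite addr_ge0.
  by move: u v u0 v0 => u v u0 v0; split; lra.
have C0 : 0 <= C by apply: sumr_ge0 => *; apply: sumr_ge0 => *; rewrite addr_ge0.
pose H := \sum_(f <- F) nu f * ln (step_kernel nu F f.1 f.2 / pr p f.1 f.2).
have VV0 : (0 < size VV)%N.
  rewrite lt0n size_eq0; apply/eqP => VE; have := sum_vmass uF nuF nu1.
  by rewrite -/VV VE big_nil => /eqP; rewrite eq_sym oner_eq0.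
(* The block length is chosen after [C] and [H]: the constant adds up the closing costs of
   [block_rate] and [block_average]. *)
have [n n0 hn] := ln_polynomial_small (size F) (`|H| * C + C + B * C *+ 2) VV0 d0.
pose E (g : S * seq S -> R) := \sum_(x <- VV) \sum_(s <- wordsn VV n) Q x s * g (x, s).
have E1 : E (fun=> 1) = 1.
  rewrite /E -[RHS](sum_Qword uF nu0 nuF nu1 nub n).
  by apply: eq_bigr => x _; apply: eq_bigr => s _; rewrite mulr1.
have ED g h : E (fun u => g u + h u) = E g + E h.
  rewrite /E -big_split; apply: eq_bigr => x _; rewrite /= -big_split.
  by apply: eq_bigr => s _; rewrite /= mulrDr.
have EZ a g : E (fun u => a * g u) = a * E g.
  rewrite /E mulr_sumr; apply: eq_bigr => x _; rewrite mulr_sumr.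
  by apply: eq_bigr => s _; rewrite mulrCA.
have Eabs g a : 0 <= a -> (forall x s, x \in VV -> s \in wordsn VV n -> 0 < Q x s ->
    `|g (x, s)| <= a) -> `|E g| <= a.
  move=> a0 h; rewrite -[a]mulr1 -E1 -EZ /E; apply: le_trans (ler_norm_sum _ _ _) _.
  rewrite big_seq [leRHS]big_seq; apply: ler_sum => x xV.
  apply: le_trans (ler_norm_sum _ _ _) _.
  rewrite big_seq [leRHS]big_seq; apply: ler_sum => s sn.
  have [Qz|Qn] := eqVneq (Q x s) 0; first by rewrite Qz !mul0r normr0.
  rewrite normrM ger0_norm// mulr1 ler_wpM2l// h// lt_neqAle eq_sym Qn//.
  exact: Q0.
(* Only words of positive probability stay: their edges are charged by [mu], so they can be closed,
   and their groups have positive weight. *)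
pose L0 := [seq u <- [seq (x, s) | x <- VV, s <- wordsn VV n] | 0 < Q u.1 u.2].
have L0E g : \sum_(u <- L0) Q u.1 u.2 * g u = E g.
  rewrite big_filter big_mkcond big_allpairs_dep /=; apply: eq_bigr => x _.
  apply: eq_bigr => s _; case: ifPn => //; rewrite lt_neqAle Q0 andbT negbK.
  by move=> /eqP <-; rewrite mul0r.
have memL0 u : u \in L0 -> [/\ u.1 \in VV, u.2 \in wordsn VV n & 0 < Q u.1 u.2].
  by rewrite mem_filter => /andP[q0 /allpairsP[[x s] /= [xV sV uE]]]; rewrite uE in q0 *.
have wordL0 u : u \in L0 -> [/\ u.2 \in blocks_from F n u.1, size u.2 = n,
    forall f, f \in edges u.1 u.2 -> 0 < mass mu f &
    0 < block_weight (pr p) F n u.1 u.2].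
  move=> /memL0[uV us uQ].
  have [sb wp wq] := Qword_gt0 nu0 nuF nupr us uQ.
  split => //.
  - by move: us; rewrite mem_wordsn => /andP[/eqP].
  - by move=> f /(wt_q_gt0 nu0 wq)/nup[].
  - by apply: (lt_le_trans wp); exact: (wt_le_block_weight pr0 sb).
have lastV u : u \in L0 -> last u.1 u.2 \in VV.
  move=> /memL0[uV +  _]; rewrite mem_wordsn => /andP[_].
  case/lastP: (u.2) => // s y; rewrite all_rcons last_rcons => /andP[]//.
have cnP u : u \in L0 -> last (last u.1 u.2) (cn u.1 u.2) = u.1 /\
    0 < wt (pr p) (last u.1 u.2) (cn u.1 u.2).
  move=> /wordL0[_ _ hm _]; apply: connectorP; apply: (linked_back hS) => f /hm fm.
  by have [] := A1 _ fm.
pose bx (u : S * seq S) := u.1.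
pose bn (u : S * seq S) := (n + size (cn u.1 u.2))%N.
pose bM (u : S * seq S) h : R := vsum h u.1 u.2 + vsum h (last u.1 u.2) (cn u.1 u.2).
pose bw (u : S * seq S) : R :=
  block_weight (pr p) F n u.1 u.2 * wt (pr p) (last u.1 u.2) (cn u.1 u.2).
pose N := n%:R + E (fun u => (size (cn u.1 u.2))%:R).
have lE0 : 0 <= E (fun u => (size (cn u.1 u.2))%:R).
  by apply: sumr_ge0 => x _; apply: sumr_ge0 => s _; rewrite mulr_ge0.
have nR : (0 : R) < n%:R by rewrite ltr0n.
have N0 : 0 < N by rewrite /N ltr_wpDr.
(* Division by the mean loop length turns probabilities of blocks into turns per unit of time, so
   that [al1] holds. *)
pose al (u : S * seq S) := Q u.1 u.2 / N.
(* By admissibility [linked] is total on the base points, so sorting gives a list where each loop is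
   linked to the next. *)
pose L := sort (fun u v => `[< linked (bx u) (bx v) >]) L0.
have LL0 : L =i L0 by move=> u; rewrite mem_sort.
have LE g : \sum_(u <- L) al u * g u = E g / N.
  rewrite (perm_big _ (permEl (perm_sort _ _))) -L0E mulr_suml.
  by apply: eq_bigr => u _; rewrite /al mulrAC.
have hLb u : u \in L -> bundle (pr p) (bx u) (bx u) (bn u) (bM u) (bw u).
  rewrite LL0 => uL; have [ub _ _ _] := wordL0 _ uL; have [lc _] := cnP _ uL.
  have bc := bundle_word (pr p) (last u.1 u.2) (cn u.1 u.2); rewrite lc in bc.
  apply: bundle_cat bc.
  exists [seq s <- blocks_from F n u.1 | block_key F u.1 s == block_key F u.1 u.2].
  split.
  - by rewrite !filter_uniq// uniq_wordsn// uniq_verts.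
  - apply/allP => s; rewrite mem_filter => /andP[_]; rewrite mem_filter => /andP[_].
    by rewrite mem_wordsn => /andP[].
  - move=> s; rewrite mem_filter => /andP[/eqP sk sb]; split.
      by have := congr1 fst sk.
    by move=> h; exact: (vsum_block uF h ub sb sk).
  - by rewrite big_filter.
have first_edge u : u \in L0 -> exists2 f, 0 < mass mu f & f.1 = u.1.
  move=> /wordL0[_ su hm _]; case: u su hm => x [|y s] /= su hm.
    by move: n0; rewrite -su.
  by exists (x, y) => //; apply: hm; rewrite mem_head.
have sL : sorted (fun u v => `[< linked (bx u) (bx v) >]) L.
  apply: (@sort_sorted_in _ [in L0]); last by apply/allP.
  move=> u v /first_edge[f mf fu] /first_edge[g mg gv]; rewrite /bx -fu -gv.
  have [h|h] := A2 _ _ mf mg; apply/orP; [left|right];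
  by apply/asboolP; exact: reach_linked.
(* The initial law either charges the base point of the first loop or charges a point that reaches
   it. *)
have [z bz pL] : exists2 z, 0 < mass beta z &
    path (fun a b => `[< linked a b >]) z (map bx L).
  have L0n : L0 != [::].
    apply/eqP => L0nil; have := L0E (fun=> 1).
    by rewrite L0nil big_nil E1 => /eqP; rewrite eq_sym oner_eq0.
  move: sL LL0; case: (L) => [_ LL0|u L' /= pL' LL0].
    by case: (L0) L0n LL0 => // u l _ /(_ u); rewrite mem_head.
  have [f mf fu] : exists2 f, 0 < mass mu f & f.1 = u.1.
    by apply: first_edge; rewrite -LL0 mem_head.
  have pL'' : path (fun a b => `[< linked a b >]) (bx u) (map bx L') by rewrite path_map.
  have [bf|[z bz zf]] := A3 _ mf.
    exists (bx u); first by rewrite /bx -fu; move: bf; rewrite (massE hS) lte_fin.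
    by rewrite pL'' andbT; apply/asboolP; exact: linked_refl.
  exists z; first by move: bz; rewrite (massE hS) lte_fin.
  by rewrite pL'' andbT; apply/asboolP; rewrite /bx -fu; exact: reach_linked.
have bw0 u : u \in L -> 0 < bw u.
  by rewrite LL0 => uL; have [_ _ _ w0] := wordL0 _ uL; have [_] := cnP _ uL; exact: mulr_gt0.
have al0 u : 0 <= al u by rewrite divr_ge0 ?Q0 ?(ltW N0).
have al1 : \sum_(u <- L) al u * (bn u)%:R = 1.
  rewrite LE /bn; have -> : E (fun u => (n + size (cn u.1 u.2))%:R) = N.
    rewrite (_ : N = n%:R * E (fun=> 1) + E (fun u => (size (cn u.1 u.2))%:R)).
      rewrite -EZ -ED; congr E.
      by apply/funext => u; rewrite natrD mulr1.
    by rewrite E1 mulr1.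
  by rewrite mulfV// gt_eqF.
have lEC : E (fun u => (size (cn u.1 u.2))%:R) <= C.
  apply: le_trans (ler_norm _) _; apply: Eabs => // x s xV sV sQ.
  have xsL : (x, s) \in L0.
    by rewrite mem_filter sQ/=; apply: allpairs_f.
  by rewrite ger0_norm//; have [] := hC x (last x s) xV (lastV _ xsL).
have lnK0 : 0 <= ln ((size VV ^ 2 * n.+1 ^ size F)%N%:R : R).
  by rewrite ln_ge0// (key_number_ge1 uF nuF nu1 n).
have nN : n%:R <= N by rewrite /N lerDl.
have BC0 : 0 <= B * C by rewrite mulr_ge0// ltW.
have HC0 : 0 <= `|H| * C by rewrite mulr_ge0.
have hM j : (j < k)%N -> `|\sum_(u <- L) al u * bM u (V j) - pairing mu (V j)| < e.
  move=> jk; rewrite LE /bM ED.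
  have -> : E (fun u => vsum (V j) u.1 u.2) = n%:R * \sum_(f <- F) nu f * V j f.
    exact: (sum_Qword_vsum uF nu0 nuF nub).
  have h1 := nuV _ _ (hB j).
  set A := \sum_(f <- F) _ in h1 *; set Ec := E _.
  have hEc : `|Ec| <= B * C.
    apply: Eabs => // x s xV sV sQ; apply: (le_trans (vsum_le _ _ (hB j))).
    have xsL : (x, s) \in L0 by rewrite mem_filter sQ/=; apply: allpairs_f.
    by rewrite ler_pM2l//; have [] := hC x (last x s) xV (lastV _ xsL).
  have hA : `|A| <= B.
    rewrite /A (le_trans (ler_norm_sum _ _ _))// -[leRHS]mulr1 -nu1 mulr_sumr.
    by apply: ler_sum => f _; rewrite normrM ger0_norm// mulrC ler_wpM2r.
  apply: (block_average (B := B) (C := C) (delta := delta) _ N0 _ hA hEc) => //.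
  - by rewrite lE0.
  - apply: le_trans hn; rewrite mulr2n; move: lnK0 HC0 BC0 C0.
    by set x := ln _; set y := _ * C; set w := B * C; lra.
  - exact: ltW.
have hw : - (r + 6 * delta) <= \sum_(u <- L) al u * ln (bw u).
  rewrite LE.
  have -> : E (fun u => ln (bw u)) =
      E (fun u => ln (block_weight (pr p) F n u.1 u.2)) +
      E (fun u => ln (wt (pr p) (last u.1 u.2) (cn u.1 u.2))).
    rewrite -ED -!L0E; apply: eq_big_seq => u uL; rewrite /bw lnM ?posrE//.
      by have [] := wordL0 _ uL.
    by have [] := cnP _ uL.
  have hE := block_entropy pr0 uF nu0 nuF nu1 nub nupr n.
  have hEc : `|E (fun u => ln (wt (pr p) (last u.1 u.2) (cn u.1 u.2)))| <= C.
    apply: Eabs => // x s xV sV sQ.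
    have xsL : (x, s) \in L0 by rewrite mem_filter sQ/=; apply: allpairs_f.
    by have [] := hC x (last x s) xV (lastV _ xsL).
  apply: (block_rate (C := C) (H := H) _ N0 _ hEc hE) => //.
  - by rewrite lE0.
  - apply: le_trans hn; rewrite mulr2n; move: BC0.
    by rewrite /key_number -/VV; set x := ln _; set y := _ * C; set w := B * C; lra.
  - exact: ltW.
have := schedule_lower_bound hS hX bz hLb pL bw0 al0 al1 hB hM d0.
apply: filterS => l; apply: le_trans; rewrite lee_fin ler_expR ler_wpM2l//.
by move: hw d1; lra.
Qed.

End lower_bound.

(** * Comparison of the three rate functions *)

Section assembly.
Local Open Scope ereal_scope.
Context dO (Omega : measurableType dO) d (S : measurableType d) (R : realType).
Variables (P : probability Omega R) (beta : probability S R) (p : R.-pker S ~> S).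
Variable X : nat -> {RV P >-> S}.
Hypotheses (hS : discrete S) (hX : markov_chain beta p X).
Local Notation wprob2 := (weak_prob (S * S)%type R).

Lemma open_lower_bound (U : set wprob2) (mu : wprob2) : adm_bal beta p mu ->
  open U -> U mu ->
  - R2 p mu <= limn_einf (fun n => (n.+1%:R^-1)%:E * lne (P (L2 X n @^-1` U))).
Proof.
move=> adm oU Umu; rewrite leeNl leNgt; apply/negP => /lte_real_dense[c /andP[Rc]].
rewrite lteNr; apply/negP; rewrite -leNgt -EFinN.
have [k [V [M [e [e0 M0 hV hU]]]]] := weak_open_pairing oU Umu.
apply: le_limn_einf_near.
have := neighborhood_lower_bound hS hX adm k M0 e0 hV Rc.
apply: filterS => n h; rewrite le_mul_lne//; apply: (le_trans h).
apply: le_measure; rewrite ?inE; try exact: measurable_L2.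
by move=> w /= hw; apply: hU.
Qed.

(** The easy half of Varadhan's lemma: restricting the expectation to the event that the pairing
    with [V] is close to [pairing mu V] bounds [Lambda2 X V] below by [pairing mu V - R2 p mu], up
    to the gap [e]. *)
Lemma Lambda2_conj_le_R2 (mu : wprob2) : adm_bal beta p mu ->
  Lambda2_conj X mu <= R2 p mu.
Proof.
move=> adm; apply: ge_ereal_sup => _ [V bV <-].
have /bounded_funP[M M0 hV] := bV.
rewrite leNgt; apply/negP => /lte_real_dense[c /andP[Rc]].
have [c' /andP[Rc' c'c]] := lte_real_dense Rc; rewrite lte_fin in c'c.
have e0 : (0 < (c - c') / 2)%R by rewrite divr_gt0// subr_gt0.
have := neighborhood_lower_bound hS hX adm 1 (V := fun=> V) M0 e0 (fun _ => hV) Rc'.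
set e := ((c - c') / 2)%R => near_P.
have : (pairing mu V - c)%:E <= Lambda2 X V.
  apply: le_limn_esup_near; move: near_P; apply: filterS => n hn.
  rewrite le_mul_lne; last by apply: expectation_ge0 => w; exact: expR_ge0.
  apply: le_trans (prob_L2_lt X hS (pairing mu V - e)%R n bV).
  apply: (@le_trans _ _ ((expR (n.+1%:R * (pairing mu V - e)))%:E *
    (expR (n.+1%:R * - c'))%:E)).
    rewrite -EFinM -expRD lee_fin ler_expR -mulrDr ler_wpM2l// /e.
    by lra.
  apply: lee_wpmul2l; first by rewrite lee_fin expR_ge0.
  apply: (le_trans hn); apply: le_measure; rewrite ?inE; try exact: measurable_L2.
  by move=> w /= /(_ 0%N isT); rewrite ltr_norml => /andP[+ _]; lra.
move=> hL; apply/negP; rewrite -leNgt; move: hL.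
case: (Lambda2 X V) => [l| |].
- by rewrite -EFinB !lee_fin; lra.
- by move=> _; exact: leNye.
- by rewrite leeNy_eq.
Qed.

Lemma Lambda2_conj_J2_R2 (mu : probability (S * S)%type R) : adm_bal beta p mu ->
  Lambda2_conj X mu = J2 p mu /\ J2 p mu = R2 p mu.
Proof.
move=> adm; have h1 := R2_le_J2 hS mu p; have h2 := J2_le_Lambda2_conj hS hX mu.
have h3 := Lambda2_conj_le_R2 adm.
split; apply/eqP; rewrite eq_le; apply/andP; split.
- exact: le_trans h3 h1.
- exact: h2.
- exact: le_trans h2 h3.
- exact: h1.
Qed.

End assembly.

Theorem theorem1p3 (R : realType)
  (dO : measure_display) (Omega : measurableType dO) (P : probability Omega R)
  (dS : measure_display) (S : measurableType dS) (hS : discrete S)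
  (beta : probability S R) (p : R.-pker S ~> S)
  (X : nat -> {RV P >-> S}) (hX : markov_chain beta p X) :
  weak_ldp P (X := weak_prob (S * S)%type R) (L2 X) (I2 beta p X) /\
  (forall mu : probability (S * S)%type R, adm_bal beta p mu ->
    Lambda2_conj X mu = J2 p mu /\ J2 p mu = R2 p mu).
Proof.
split; last by move=> mu adm; exact: (Lambda2_conj_J2_R2 hS hX adm).
split.
- by move=> mu; exact: I2_ge0.
- exact: I2_lsc.
- by move=> K cK; exact: (compact_upper_bound hS hX cK).
move=> U oU; rewrite leeNl; apply: le_ereal_inf_tmp => _ [mu Umu <-].
(* Points outside [adm_bal] have infinite rate and impose no condition. *)
rewrite /I2; case: asboolP => [adm|_]; last exact: leey.
have [-> ->] := Lambda2_conj_J2_R2 hS hX adm.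
rewrite leeNl; exact: (open_lower_bound hS hX adm oU Umu).
Qed.
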